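(* For each integer $n\ge 1$ there is a constant $c(n)>0$ such that the following holds. Let $1\le k\le n$, let $R$ be an $n$-dimensional rectangle with dimensions $R_1\le\dots\le R_n$, and let $S$ be an $n$-dimensional rectangle with dimensions $S_1\le\dots\le S_n$. If there is a $k$-expanding embedding from $S$ into $R$, then for all integers $j,l$ with $0\le j<k\le l\le n$, $$ (R_1\cdots R_j)^{\frac{l-j}{k-j}}\, R_{j+1}\cdots R_l \;\ge\; c(n)\,(S_1\cdots S_j)^{\frac{l-j}{k-j}}\, S_{j+1}\cdots S_l .$$
   Context: An $n$-dimensional rectangle with dimensions $R_1\le\dots\le R_n$ (all positive) is the open set $(0,R_1)\times\dots\times(0,R_n)\subset\mathbb{R}^n$ with the Euclidean metric. For open sets $U,V\subset\mathbb{R}^n$, a (smooth) embedding $I:V\to U$ is called $k$-expanding if for every $k$-dimensional surface $\Sigma\subset V$ the $k$-dimensional volume of $I(\Sigma)$ is at least the $k$-dimensional volume of $\Sigma$. Empty products (case $j=0$) equal $1$. *)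

(* Defs.v *)
From HB Require Import structures.
From mathcomp Require Import all_boot all_order all_algebra.
From mathcomp Require Import all_classical all_reals all_analysis.

Set Implicit Arguments.
Unset Strict Implicit.
Unset Printing Implicit Defensive.

Import Order.TTheory GRing.Theory Num.Theory.
Import numFieldNormedType.Exports.

Local Open Scope classical_set_scope.
Local Open Scope ring_scope.

(* Indices are 0-based: [d i] is the (i+1)-st side length. *)
Definition rectangle (K : realType) (n : nat) (d : 'I_n -> K) : set 'rV[K]_n :=
  [set x | forall i, 0 < x ord0 i < d i].

Definition rectangle_dims (K : realType) (n : nat) (d : 'I_n -> K) : Prop :=
  (forall i, 0 < d i) /\ (forall i j : 'I_n, (i <= j)%N -> d i <= d j).

(* The library norm on ['rV[K]_n] is the sup norm; it induces the right
   topology, but lengths and volumes need the Euclidean distance. *)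
Definition edist (K : realType) (n : nat) (x y : 'rV[K]_n) : K :=
  Num.sqrt (\sum_i (x ord0 i - y ord0 i) ^+ 2).

(* [maxe 0] only matters for the empty set, whose supremum is [-oo]. *)
Definition ediam (K : realType) (n : nat) (E : set 'rV[K]_n) : \bar K :=
  maxe 0%E (ereal_sup [set (edist x y)%:E | x in E & y in E]).

Definition hausdorff_content (K : realType) (n k : nat) (delta : K)
    (A : set 'rV[K]_n) : \bar K :=
  ereal_inf [set (\sum_(0 <= i <oo) (ediam (E i) ^+ k))%E
            | E in [set E : nat -> set 'rV[K]_n |
                     A `<=` \bigcup_i E i /\
                     forall i, (ediam (E i) <= delta%:E)%E]].

(* Lebesgue measure of the unit ball of R^k, by the recurrence
   omega_(k+2) = 2 pi / (k + 2) * omega_k. *)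
Fixpoint unit_ball_volume (K : realType) (k : nat) : K :=
  match k with
  | 0 => 1
  | 1 => 2
  | k'.+2 => 2 * pi / k'.+2%:R * unit_ball_volume K k'
  end.

(* k-dimensional volume (k >= 1): the k-dimensional Hausdorff measure of the
   Euclidean metric, normalised to agree with Lebesgue measure on k-planes and
   hence with the Riemannian volume on smooth k-dimensional submanifolds. *)
Definition kvol (K : realType) (n k : nat) (A : set 'rV[K]_n) : \bar K :=
  ((unit_ball_volume K k / 2 ^+ k)%R%:E *
   ereal_sup [set hausdorff_content k delta A | delta in [set d : K | (0 < d)%R]])%E.

Fixpoint iter_derive (K : realType) (m n : nat) (vs : seq 'rV[K]_m)
    (f : 'rV[K]_m -> 'rV[K]_n) : 'rV[K]_m -> 'rV[K]_n :=
  if vs is v :: vs' then (fun x => 'D_v (iter_derive vs' f) x) else f.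

(* C^infinity on an open set [U]; the values of [f] outside [U] are irrelevant. *)
Definition smooth_on (K : realType) (m n : nat) (U : set 'rV[K]_m)
    (f : 'rV[K]_m -> 'rV[K]_n) : Prop :=
  forall vs x, U x -> differentiable (iter_derive vs f) x.

(* A smooth immersion of the open set [U] that is a homeomorphism onto its
   image. Jacobians act on row vectors, so [row_free] means that the
   differential is injective. *)
Definition smooth_embedding (K : realType) (m n : nat) (U : set 'rV[K]_m)
    (f : 'rV[K]_m -> 'rV[K]_n) : Prop :=
  [/\ smooth_on U f,
      forall x, U x -> row_free (jacobian f x)
    & exists2 g : 'rV[K]_n -> 'rV[K]_m,
        (forall x, U x -> g (f x) = x) & {within f @` U, continuous g}].

(* Smooth embedded k-dimensional submanifolds of R^n, not necessarily closed,
   connected or covered by a single chart. *)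
Definition surface (K : realType) (n k : nat) (Sigma : set 'rV[K]_n) : Prop :=
  forall p, Sigma p ->
    exists (W : set 'rV[K]_n) (U : set 'rV[K]_k) (phi : 'rV[K]_k -> 'rV[K]_n),
      [/\ open W, W p, open U, smooth_embedding U phi
        & phi @` U = Sigma `&` W].

Definition expanding (K : realType) (n k : nat) (V : set 'rV[K]_n)
    (f : 'rV[K]_n -> 'rV[K]_n) : Prop :=
  forall Sigma : set 'rV[K]_n, Sigma `<=` V -> surface k Sigma ->
    (kvol k Sigma <= kvol k (f @` Sigma))%E.

Definition expanding_embedding (K : realType) (n k : nat) (V U : set 'rV[K]_n)
    (f : 'rV[K]_n -> 'rV[K]_n) : Prop :=
  [/\ smooth_embedding V f, f @` V `<=` U & expanding k V f].

(* Main.v *)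
(* The argument is a random filling, made finite and derandomized. Since I is k-expanding, the
   k x k minors of its inverse Jacobian are bounded by a constant; so the part of S that I maps into
   a cell of side delta of R lies in a parallelepiped whose projections to k coordinates have volume
   O(delta^k).

   Suppose that the inequality fails badly. Assign to each lattice point y of R a point g(y) of S
   whose a-th coordinate is a random number attached to a label of y. The label rounds the
   coordinates of y with a phase depending on a, so that near any y at most n - l of the n
   coordinates of g feel the rounding of y_i, i > l. The coordinates y_i, j < i <= l, only enter
   through their distances to equally spaced walls, and only the h = l - k smallest distances count;
   thus near y all but n - l coordinates of g are locally constant up to an error S_(j+1) (their
   coarse part depends on y_i, i > l, only), and all but n - l + h of them are locally constant.
   The probability that I(g(y)) lies in a cell close to y in the last n - j coordinates is then
   small, by two different counts of cells according to whether y is close to h walls (where the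
   coarse parts are averaged too) or not. A greedy choice fixes the random numbers so that this
   never happens; interpolating g across the walls then contradicts the Poincare-Miranda
   theorem. *)

Require Import Defs.
From HB Require Import structures.
From mathcomp Require Import all_boot all_order all_algebra all_fingroup.
From mathcomp Require Import zify ring lra.

Set Implicit Arguments.
Unset Strict Implicit.
Unset Printing Implicit Defensive.

Import Order.TTheory GRing.Theory Num.Theory.

(** * A discrete Poincare-Miranda theorem *)

(** Write [sigma] for S_(j+1). With walls [2 * x] apart, the two counts forbid that C1 R_1...R_j
    x^(k-j) < S_1...S_j sigma^(k-j) and C2 R_1...R_l sigma^(l-k) < S_1...S_l x^(l-k) hold together.
    Taking [x] so that the first holds by a factor 2 makes the second fail, and eliminating [x]
    gives the exponent (l-j)/(k-j) = 1 + (l-k)/(k-j). The obstacle is that only k x k minors are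
    controlled: a hit is made improbable by [k] coordinates of [g] that are known exactly, and [h]
    further ones can contribute only through their coarse parts. Rounding with the same thresholds
    for all coordinates of [g] would let one threshold unsettle all of them at once; with [n] phases
    it unsettles one. No condition is imposed on y_1, ..., y_j, which costs a factor R_1...R_j in
    the number of cells. The events are not independent, since a label is shared by many points. The
    greedy choice only needs the number of events sharing a label to be bounded, and it is bounded
    in terms of [n] alone. *)

Lemma involution_even (T : finType) (A : {set T}) (phi : T -> T) :
  (forall x, x \in A -> phi x \in A) -> (forall x, x \in A -> phi (phi x) = x) ->
  (forall x, x \in A -> phi x != x) -> ~~ odd #|A|.
Proof.
have [N] := ubnP #|A|; elim: N A => // N IH A ltAN phiA phiK phiN.
have [->|[x xA]] := set_0Vmem A; first by rewrite cards0.
have yA := phiA _ xA.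
have yAx : phi x \in A :\ x by rewrite in_setD1 phiN.
rewrite (cardsD1 x) xA (cardsD1 (phi x)) yAx /= negbK.
apply: IH.
- move: ltAN; rewrite (cardsD1 x) xA (cardsD1 (phi x)) yAx /=; lia.
- move=> z; rewrite !in_setD1 => /and3P[zy zx zA].
  rewrite phiA // andbT; apply/andP; split.
    by apply: contraNN zx => /eqP e; rewrite -(phiK _ zA) e phiK.
  by apply: contraNN zy => /eqP <-; rewrite phiK.
- by move=> z; rewrite !in_setD1 => /and3P[_ _ zA]; apply: phiK.
- by move=> z; rewrite !in_setD1 => /and3P[_ _ zA]; apply: phiN.
Qed.

Lemma odd_sum (I : finType) (F : I -> nat) :
  odd (\sum_i F i) = odd #|[set i | odd (F i)]|.
Proof.
rewrite cardsE -sum1_card (big_morph odd oddD (erefl _)) (big_morph odd oddD (erefl _)).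
rewrite [RHS]big_mkcond /=; apply: eq_bigr => i _.
by rewrite unfold_in; case: (odd (F i)).
Qed.

(* Removing a vertex leaves all labels below [N] either for exactly one vertex
   (all labels present) or for none or two vertices (some label repeated). *)
Lemma odd_doors (T : finType) (A : {set T}) (N : nat) (f : T -> nat) :
  #|A| = N.+1 -> (forall q, q \in A -> f q <= N) ->
  odd #|[set p in A | [forall a : 'I_N, [exists q in A :\ p, f q == a]]]|
  = [forall a : 'I_N.+1, [exists q in A, f q == a]].
Proof.
move=> cA fN.
have sizeim (B : {set T}) : size [seq f q | q <- enum B] = #|B| by rewrite size_map cardE.
have memim (B : {set T}) a : (a \in [seq f q | q <- enum B]) = [exists q in B, f q == a].
  apply/mapP/existsP => [[q qB ->]|[q /andP[qB /eqP <-]]].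
    by exists q; rewrite eqxx andbT -mem_enum.
  by exists q; rewrite ?mem_enum.
case: (boolP (dinjectiveb f A)) => [/dinjectiveP injf|/dinjectivePn[q1 q1A [q2 + f12]]].
  have full a : a < N.+1 -> [exists q in A, f q == a].
    move=> aN; rewrite -memim.
    have u : uniq [seq f q | q <- enum A].
      by rewrite map_inj_in_uniq ?enum_uniq // => x y; rewrite !mem_enum; apply: injf.
    have [||_ ->] := uniq_min_size u (s2 := iota 0 N.+1).
    - by move=> x /mapP[q]; rewrite mem_enum => qA ->; rewrite mem_iota /= add0n ltnS fN.
    - by rewrite size_iota sizeim cA.
    - by rewrite mem_iota.
  rewrite [RHS](_ : _ = true); last by apply/forallP => a; apply: full.
  have /existsP[p /andP[pA /eqP fp]] := full N (ltnSn N).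
  rewrite (_ : [set _ in _ | _] = [set p]) ?cards1 //.
  apply/setP => x; rewrite !inE; apply/andP/eqP => [[xA /forallP h]|->].
    apply: (injf _ _ xA pA); rewrite fp; apply/eqP; rewrite eqn_leq fN //= leqNgt.
    apply/negP => fx; have /existsP[q] := h (Ordinal fx).
    by rewrite !inE => /andP[/andP[qx qA] /eqP /(injf _ _ qA xA) e]; rewrite e eqxx in qx.
  split=> //; apply/forallP => a; have /existsP[q /andP[qA /eqP fq]] := full a (ltnW (ltn_ord a)).
  apply/existsP; exists q; rewrite !inE qA fq eqxx !andbT.
  by apply: contraTneq (ltn_ord a) => e; rewrite -fq e fp ltnn.
rewrite inE /= eq_sym => /andP[qq q2A].
rewrite [RHS](_ : _ = false); last first.
  apply/negbTE/negP => /forallP h.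
  have /dinjectiveP injf : dinjectiveb f A.
    apply: (@leq_size_uniq _ (iota 0 N.+1)); first exact: iota_uniq.
      by move=> a; rewrite mem_iota /= add0n => aN; rewrite memim; apply: (h (Ordinal aN)).
    by rewrite size_iota sizeim cA.
  by rewrite (injf _ _ q1A q2A f12) eqxx in qq.
set D := [set p in A | _].
have sub : D \subset [set q1; q2].
  apply/subsetP => p; rewrite !inE => /andP[pA /forallP h].
  apply/negPn; rewrite negb_or; apply/negP => /andP[pq1 pq2].
  have /dinjectiveP injf : dinjectiveb f (A :\ p).
    apply: (@leq_size_uniq _ (iota 0 N)); first exact: iota_uniq.
      by move=> a; rewrite mem_iota /= add0n => aN; rewrite memim; apply: (h (Ordinal aN)).
    by rewrite size_iota sizeim; move: cA; rewrite (cardsD1 p) pA /=; lia.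
  have e : q1 = q2 by apply: injf => //; rewrite !inE ?(eq_sym _ p) ?pq1 ?pq2.
  by rewrite e eqxx in qq.
have sw p q : p \in A -> q \in A -> p != q -> f p = f q -> p \in D -> q \in D.
  move=> pA qA pq fpq; rewrite !inE pA qA /= => /forallP h; apply/forallP => a.
  have /existsP[x] := h a; rewrite !inE => /andP[/andP[xp xA] fx].
  have [e|xq] := eqVneq x q.
    by apply/existsP; exists p; rewrite !inE pq pA /= fpq -e.
  by apply/existsP; exists x; rewrite !inE xq xA.
have e12 : (q1 \in D) = (q2 \in D).
  by apply/idP/idP; apply: sw => //; rewrite eq_sym.
have -> : D = if q1 \in D then [set q1; q2] else set0.
  case: (boolP (q1 \in D)) => q1D.
    apply/eqP; rewrite eqEsubset sub; apply/subsetP => x; rewrite in_set2.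
    by case/orP => /eqP ->; rewrite -?e12.
  apply/setP => x; rewrite in_set0; apply/negP => xD.
  by have := subsetP sub x xD; rewrite in_set2 => /orP[]/eqP e;
     move: xD; rewrite e -?e12; apply/negP.
by case: ifP; rewrite ?cards0 // cards2 qq.
Qed.

Section Kuhn.
Variables (n M : nat) (c : 'I_n.+1 -> {ffun 'I_n.+1 -> nat} -> bool).
Hypothesis c_low : forall i (y : {ffun _ -> _}), y i = 0 -> ~~ c i y.
Hypothesis c_high : forall i (y : {ffun _ -> _}), y i = M.+1 -> c i y.

(** A Sperner labelling by the first failing test, with [n.+1], the length of the enumeration, when
    all tests succeed. By [c_low] the label is at most [m] where coordinate [m] vanishes; by
    [c_high] it is never [i] where coordinate [i] equals [M.+1]. *)
Let label (y : {ffun 'I_n.+1 -> nat}) := find (fun i => ~~ c i y) (enum 'I_n.+1).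

Let label_has (a : 'I_n.+1) y : label y = a -> ~~ c a y.
Proof.
move=> e; have lt : has (fun i => ~~ c i y) (enum 'I_n.+1).
  by rewrite has_find size_enum_ord -/(label y) e.
by have := nth_find ord0 lt; rewrite -/(label y) e nth_ord_enum.
Qed.

Let label_gt (a : 'I_n.+1) y : a < label y -> c a y.
Proof. by move=> /(before_find ord0); rewrite nth_ord_enum => /negbFE. Qed.

Let label_le (a : 'I_n.+1) y : ~~ c a y -> label y <= a.
Proof. by move=> nc; rewrite leqNgt; apply: contraNN nc; apply: label_gt. Qed.

Let simplex := ({ffun 'I_n.+1 -> 'I_M.+1} * 'S_n.+1)%type.

(* The simplex [(z, rho)] of the Freudenthal triangulation has vertices obtained
   from [z] by raising the coordinates of rank [rho] below [q]. *)
Definition vertex (s : simplex) (q : nat) : {ffun 'I_n.+1 -> nat} :=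
  [ffun i => s.1 i + (s.2 i < q)].

(* Simplices of dimension [m] in the face where coordinates [i >= m] vanish. *)
Let simp m (s : simplex) := [forall i : 'I_n.+1, (m <= i) ==> (s.1 i == 0 :> nat) && (s.2 i == i)].
Let verts m := [set q : 'I_n.+2 | q <= m].
Let full m := [set s : simplex | simp m s &&
  [forall a : 'I_m.+1, [exists q in verts m, label (vertex s q) == a]]].
(** A facet is given as a simplex with the rank of the omitted vertex. A facet between two simplices
    therefore occurs twice, which is what the pairing [shift] uses. *)
Let door m := [set x : simplex * 'I_n.+2 | [&& simp m x.1, x.2 \in verts m &
  [forall a : 'I_m, [exists q in verts m :\ x.2, label (vertex x.1 q) == a]]]].

Let simpP m s : simp m s -> forall i : 'I_n.+1, m <= i -> s.1 i = 0 :> nat /\ s.2 i = i.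
Proof. by move=> /forallP h i mi; have /implyP/(_ mi)/andP[/eqP ? /eqP ?] := h i. Qed.

Let simp_lt m s (i : 'I_n.+1) : simp m s -> (s.2 i < m) = (i < m).
Proof.
move=> sm; case: (ltnP i m) => im; last first.
  by rewrite (simpP sm im).2 ltnNge im.
rewrite ltnNge; apply/negP => h.
have [_ e] := simpP sm h.
by move: (perm_inj e) => e'; rewrite e' leqNgt im in h.
Qed.

Let card_verts m : m <= n.+1 -> #|verts m| = m.+1.
Proof.
move=> mn; rewrite -sum1_card (eq_bigl (fun q : 'I_n.+2 => q < m.+1)); last by move=> q; rewrite inE.
by rewrite (big_ord_narrow_cond (F := fun=> 1) (P := xpredT) (n1 := m.+1)) // sum1_card card_ord.
Qed.

Let label_simp m s q : simp m s -> q <= m -> m <= n.+1 -> label (vertex s q) <= m.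
Proof.
move=> sm qm; rewrite leq_eqVlt => /orP[/eqP ->|mn].
  by rewrite -[X in _ <= X]size_enum_ord find_size.
apply: (@label_le (Ordinal mn)); apply: c_low.
rewrite ffunE; have [-> ->] := simpP (i := Ordinal mn) sm (leqnn _).
by rewrite /= ltnNge qm.
Qed.

Let odd_full m : m <= n.+1 -> odd #|full m| = odd #|door m|.
Proof.
move=> mn; rewrite -[#|door m|]sum1_card.
rewrite (eq_bigl (fun x : simplex * 'I_n.+2 => true && ((x.1, x.2) \in door m))); last by case.
rewrite -(pair_big_dep xpredT (fun s p => (s, p) \in door m) (fun _ _ => 1)) /=.
rewrite odd_sum; congr (odd _); apply: eq_card => s; rewrite [in LHS]inE [in RHS]inE sum1_card.
case: (boolP (simp m s)) => sm /=.
  rewrite -(odd_doors (card_verts mn)); last by move=> q; rewrite inE => qm; apply: label_simp.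
  congr (odd _); apply: eq_card => p; rewrite inE.
  by transitivity ((s, p) \in door m); first rewrite [in RHS]inE /= sm.
apply/esym; rewrite eq_card0 // => p.
by transitivity ((s, p) \in door m); last rewrite inE /= (negbTE sm).
Qed.

Section Step.
Variable m : nat.
Hypothesis mn : m <= n.

Let rot (t : 'I_n.+1) : 'I_n.+1 :=
  if t == 0 :> nat then inord m else if t <= m then inord t.-1 else t.

Let rotE t : rot t = (if t == 0 :> nat then m else if t <= m then t.-1 else t) :> nat.
Proof.
rewrite /rot; case: eqP => _; first by rewrite inordK.
by case: ifP => // tm; rewrite inordK //; lia.
Qed.

Let rot_inj : injective rot.
Proof.
move=> t u /(congr1 val) /=; rewrite !rotE; have lt := ltn_ord t; have lu := ltn_ord u => e.
by apply: val_inj => /=; move: e; repeat (case: ifP => ?); move=> e; lia.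
Qed.

Let cyc : 'S_n.+1 := perm rot_inj.

Let cycE t : cyc t = (if t == 0 :> nat then m else if t <= m then t.-1 else t) :> nat.
Proof. by rewrite permE rotE. Qed.

Let rank (s : simplex) (t : nat) : 'I_n.+1 := (s.2^-1)%g (inord t).

Let rankK (s : simplex) t : t <= n -> s.2 (rank s t) = t :> nat.
Proof. by move=> tn; rewrite /rank permKV inordK. Qed.

Let rank_eq (s : simplex) t i : t <= n -> (i == rank s t) = (s.2 i == t :> nat).
Proof.
move=> tn; apply/eqP/eqP => [->|e]; first exact: rankK.
by apply: (@perm_inj _ s.2); apply: val_inj => /=; rewrite rankK.
Qed.

(** The neighbour across the facet opposite vertex 0: vertices 1, ..., [m.+1] keep their order and a
    new last vertex is added. [down] is its inverse, across the facet opposite the last vertex;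
    [swap] exchanges two consecutive directions, which changes vertex [p] only. *)
Let up (s : simplex) : simplex :=
  ([ffun i => if i == rank s 0 then inord (s.1 i).+1 else s.1 i], (s.2 * cyc)%g).
Let down (s : simplex) : simplex :=
  ([ffun i => if i == rank s m then inord (s.1 i).-1 else s.1 i], (s.2 * cyc^-1)%g).
Let swap (s : simplex) (p : nat) : simplex :=
  (s.1, (s.2 * tperm (inord p.-1) (inord p))%g).

Let rank_up (s : simplex) : rank (up s) m = rank s 0.
Proof.
apply/esym/eqP; rewrite rank_eq // /up /= permM cycE rankK //.
Qed.

Let rank_down (s : simplex) : rank (down s) 0 = rank s m.
Proof.
apply/esym/eqP; rewrite rank_eq // /down /= permM; apply/eqP.
have -> : s.2 (rank s m) = cyc ord0 by apply: val_inj => /=; rewrite rankK // cycE.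
by rewrite permK.
Qed.

Let downK (s : simplex) : 0 < s.1 (rank s m) -> up (down s) = s.
Proof.
move=> pos; rewrite /up rank_down [in RHS](surjective_pairing s) /=; congr (_, _).
  apply/ffunP => i; rewrite !ffunE; case: eqP => // ->.
  have := ltn_ord (s.1 (rank s m)) => lt.
  by apply: val_inj => /=; rewrite !inordK ?prednK //; lia.
by rewrite mulgKV.
Qed.

Let upK (s : simplex) : s.1 (rank s 0) < M -> down (up s) = s.
Proof.
move=> pos; rewrite /down rank_up [in RHS](surjective_pairing s) /=; congr (_, _).
  apply/ffunP => i; rewrite !ffunE; case: eqP => // ->.
  by apply: val_inj => /=; rewrite !inordK //=; lia.
by rewrite mulgK.
Qed.

Let vertex_up (s : simplex) q : s.1 (rank s 0) < M -> q <= m -> vertex (up s) q = vertex s q.+1.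
Proof.
move=> pos qm; apply/ffunP => i; rewrite !ffunE /= permM cycE rank_eq //.
case: eqP => [e|ne].
  have ei : i = rank s 0 by apply/eqP; rewrite rank_eq // e.
  by rewrite inordK ?e /=; [lia|rewrite ei; lia].
by case: ifP => sm; congr (_ + nat_of_bool _); lia.
Qed.

Let simp_up (s : simplex) : simp m.+1 s -> simp m.+1 (up s).
Proof.
move=> sm; apply/forallP => i; apply/implyP => mi; have [z0 ri] := simpP sm mi.
rewrite ffunE rank_eq //= permM ri.
have -> : (i == 0 :> nat) = false by apply/eqP; lia.
rewrite z0 eqxx /=; apply/eqP/val_inj => /=; rewrite cycE.
by case: eqP; [lia|]; case: ifP; lia.
Qed.

Let simp_down (s : simplex) : simp m.+1 s -> simp m.+1 (down s).
Proof.
move=> sm; apply/forallP => i; apply/implyP => mi; have [z0 ri] := simpP sm mi.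
rewrite ffunE rank_eq //= permM ri.
have -> : (i == m :> nat) = false by apply/eqP; lia.
rewrite z0 eqxx /=; apply/eqP; rewrite -[RHS](permK cyc); congr (_ _).
apply/val_inj => /=; rewrite cycE.
by case: eqP; [lia|]; case: ifP; lia.
Qed.

Let simp_swap (s : simplex) p : 0 < p <= m -> simp m.+1 s -> simp m.+1 (swap s p).
Proof.
move=> pm sm; apply/forallP => i; apply/implyP => mi; have [z0 ri] := simpP sm mi.
rewrite /= z0 eqxx /= permM ri tpermD //; apply/eqP => /(congr1 val) /=;
  rewrite inordK; lia.
Qed.

Let vertex_swap (s : simplex) p q : 0 < p <= m -> q != p -> vertex (swap s p) q = vertex s q.
Proof.
move=> pm qp; apply/ffunP => i; rewrite !ffunE /= permM; congr (_ + nat_of_bool _).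
case: tpermP => [-> | -> | //]; rewrite !inordK; lia.
Qed.

Let swapK (s : simplex) p : swap (swap s p) p = s.
Proof. by rewrite /swap /= -mulgA tperm2 mulg1; case: s. Qed.

Let doorP (s : simplex) (p : 'I_n.+2) : (s, p) \in door m.+1 ->
  [/\ simp m.+1 s, p <= m.+1 & forall a, a <= m ->
    exists q, [/\ q <= m.+1, q != p & label (vertex s q) = a]].
Proof.
rewrite inE /= => /and3P[sm]; rewrite inE => pm /forallP h; split=> // a am.
have /existsP[q] := h (Ordinal (am : a < m.+1)); rewrite !inE => /andP[/andP[qp qm] /eqP lq].
by exists q.
Qed.

Let doorI (s : simplex) (p : 'I_n.+2) : simp m.+1 s -> p <= m.+1 -> (forall a, a <= m ->
    exists q, [/\ q <= m.+1, q != p & label (vertex s q) = a]) -> (s, p) \in door m.+1.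
Proof.
move=> sm pm h; rewrite inE /= sm inE pm /=; apply/forallP => a.
have [q [qm qp lq]] := h a (ltn_ord a); apply/existsP.
exists (inord q); rewrite !inE inordK ?qm ?lq ?eqxx ?andbT //; last by lia.
by apply: contraNN qp => /eqP <-; rewrite inordK //; lia.
Qed.

(** The doors inside the face where coordinate [m] vanishes too. They have no partner in dimension
    [m.+1]; they are the full simplices of dimension [m], which drives the induction. *)
Let boundary := [set x in door m.+1 | [&& x.2 == m.+1 :> nat, x.1.2 (inord m) == inord m
  & x.1.1 (inord m) == 0 :> nat]].

(** Otherwise the facet lies on the side [M.+1] of the cube in direction [rank s 0], where that
    label cannot occur; but a door shows all labels up to [m]. *)
Let door_up (s : simplex) (p : 'I_n.+2) : (s, p) \in door m.+1 -> p = 0 :> nat -> s.1 (rank s 0) < M.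
Proof.
move=> /doorP[sm pm h] p0; rewrite ltnNge; apply/negP => hM.
have im : rank s 0 < m.+1 by rewrite -(simp_lt _ sm) rankK.
have [q [_ qp /label_has]] := h (rank s 0) im.
apply/negP; rewrite negbK; apply: c_high; rewrite ffunE rankK //.
have := ltn_ord (s.1 (rank s 0)); rewrite p0 in qp; lia.
Qed.

(** If the coordinate of rank [m] were 0 on the whole facet, the label [m] present there would force
    its index to be at least [m], hence exactly [m], and the door would belong to [boundary]. *)
Let door_down (s : simplex) (p : 'I_n.+2) : (s, p) \in door m.+1 :\: boundary -> p = m.+1 :> nat ->
  0 < s.1 (rank s m).
Proof.
rewrite inE => /andP[nb d] pE; have [sm pm h] := doorP d.
rewrite lt0n; apply: contraNN nb => /eqP z0; rewrite inE d /= pE eqxx /=.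
have im : rank s m < m.+1 by rewrite -(simp_lt _ sm) rankK.
have [q [qm qp lq]] := h m (leqnn _).
have mi : m <= rank s m.
  rewrite -{1}lq; apply: label_le; apply: c_low; rewrite ffunE z0 rankK //.
  rewrite pE in qp; lia.
have e : rank s m = inord m by apply: val_inj => /=; rewrite inordK //; lia.
rewrite -e z0 eqxx andbT; apply/eqP/val_inj => /=; rewrite rankK //; lia.
Qed.

Let shift (x : simplex * 'I_n.+2) : simplex * 'I_n.+2 :=
  if x.2 == 0 :> nat then (up x.1, inord m.+1)
  else if x.2 == m.+1 :> nat then (down x.1, ord0)
  else (swap x.1 x.2, x.2).

Let shift_interior x : x \in door m.+1 :\: boundary -> shift x \in door m.+1 :\: boundary.
Proof.
case: x => s p dp; have d : (s, p) \in door m.+1 by move: dp; rewrite inE => /andP[].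
have [sm pm h] := doorP d; rewrite /shift /=; case: eqP => [p0|p0].
  have lt := door_up d p0.
  have d' : (up s, inord m.+1) \in door m.+1.
    apply: doorI; [exact: simp_up|by rewrite inordK //; lia|move=> a am].
    have [[|q] [qm qp lq]] := h a am; first by rewrite p0 in qp.
    exists q; split; [lia| |by rewrite vertex_up].
    by rewrite inordK; lia.
  rewrite inE d' andbT; apply/negP; rewrite inE d' /= => /and3P[_ /eqP e1 /eqP e2].
  have e : inord m = rank s 0.
    by apply/eqP; rewrite -rank_up rank_eq //= e1 inordK.
  by move: e2; rewrite ffunE e eqxx inordK //; lia.
case: eqP => [pE|pE].
  have pos := door_down dp pE.
  have d' : (down s, ord0) \in door m.+1.
    apply: doorI; [exact: simp_down|by []|move=> a am].
    have [q [qm qp lq]] := h a am; exists q.+1; split => //.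
      by rewrite pE in qp; lia.
    rewrite -vertex_up ?downK ?rank_down //; last by rewrite pE in qp; lia.
    have lt : s.1 (rank s m) < M.+1 := ltn_ord _.
    rewrite ffunE eqxx inordK; last exact: leq_ltn_trans (leq_pred _) lt.
    by rewrite prednK.
  by rewrite inE d' andbT inE d' /=.
have pp : 0 < p <= m by lia.
have d' : (swap s p, p) \in door m.+1.
  apply: doorI; [exact: simp_swap|by []|move=> a am].
  by have [q [qm qp lq]] := h a am; exists q; rewrite vertex_swap.
by rewrite inE d' andbT inE d' /= (introF eqP pE).
Qed.

Let interior_even : ~~ odd #|door m.+1 :\: boundary|.
Proof.
apply: (@involution_even _ _ shift); first exact: shift_interior.
  move=> [s p] dp; have d : (s, p) \in door m.+1 by move: dp; rewrite inE => /andP[].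
  have [sm pm h] := doorP d; rewrite {2}/shift /=; case: eqP => [p0|p0].
    rewrite /shift /= inordK //= eqxx upK; last exact: door_up d p0.
    by congr (_, _); apply: val_inj.
  case: eqP => [pE|pE].
    rewrite /shift /= downK; last exact: door_down dp pE.
    by congr (_, _); apply: val_inj; rewrite /= inordK.
  by rewrite /shift /= (introF eqP p0) (introF eqP pE) swapK.
move=> [s p] dp; have d : (s, p) \in door m.+1 by move: dp; rewrite inE => /andP[].
have [sm pm h] := doorP d; rewrite /shift /=; case: (eqVneq (nat_of_ord p) 0) => [p0|p0].
  by apply/eqP => /(congr1 (fun x => nat_of_ord x.2)) /=; rewrite inordK // p0.
case: (eqVneq (nat_of_ord p) m.+1) => [pE|pE].
  by apply/eqP => /(congr1 (fun x => nat_of_ord x.2)) /=; rewrite pE.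
apply/eqP => -[/(congr1 snd) /= e].
have := congr1 (fun r : 'S_n.+1 => r (rank s p)) e; rewrite /= permM.
have -> : s.2 (rank s p) = inord p by apply: val_inj; rewrite /= rankK ?inordK //; lia.
by rewrite tpermR => /(congr1 val) /=; rewrite !inordK; lia.
Qed.

Let card_boundary : #|boundary| = #|full m|.
Proof.
have inj : injective (fun s : simplex => (s, inord m.+1 : 'I_n.+2)) by move=> s t [].
rewrite -(card_imset (full m) inj); apply: eq_card => -[s p].
apply/idP/imsetP => [|[t tf [-> ->]]].
  rewrite inE => /andP[d /and3P[/eqP /= pE /eqP e1 /eqP e2]].
  have [sm pm h] := doorP d.
  exists s; last by congr (_, _); apply: val_inj; rewrite /= inordK.
  rewrite inE; apply/andP; split.
    apply/forallP => i; apply/implyP; rewrite leq_eqVlt => /orP[/eqP mi|mi].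
      by have <- : inord m = i; [apply: val_inj; rewrite /= inordK|rewrite e1 e2 !eqxx].
    by have [-> ->] := simpP sm mi; rewrite !eqxx.
  apply/forallP => a; have [q [qm qp lq]] := h a (ltn_ord a).
  apply/existsP; exists (inord q); rewrite pE in qp.
  by rewrite !inE !inordK ?lq ?eqxx ?andbT //; lia.
move: tf; rewrite inE => /andP[sm /forallP h].
have [z0 ri] := simpP (i := inord m) sm (eq_leq (esym (inordK (mn : m < n.+1)))).
rewrite inE /= ri z0 inordK // !eqxx !andbT; apply: doorI => //.
- apply/forallP => i; apply/implyP => mi.
  by have [-> ->] := simpP sm (ltnW mi); rewrite !eqxx.
- by rewrite inordK.
- move=> a am; have /existsP[q /andP[]] := h (Ordinal (am : a < m.+1)).
  rewrite inE => qm /eqP lq; exists q; split=> //; first exact: leqW.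
  by rewrite inordK; lia.
Qed.

Lemma odd_step : odd #|full m.+1| = odd #|full m|.
Proof.
rewrite odd_full // -card_boundary -(cardsID boundary) oddD (negbTE interior_even) addbF.
by congr (odd _); apply: eq_card => x; rewrite inE [in X in _ && X]inE [in RHS]inE; case: (_ \in _).
Qed.

End Step.

Let odd_all m : m <= n.+1 -> odd #|full m|.
Proof.
elim: m => [_|m IH mn]; last by rewrite odd_step // IH // ltnW.
rewrite (_ : full 0 = [set ([ffun=> ord0], 1%g)]) ?cards1 //.
apply/setP => -[z r]; rewrite !inE; apply/idP/eqP => [/andP[sm _]|[-> ->]].
  congr (_, _); first by apply/ffunP => i; rewrite ffunE; apply: val_inj; have [] := simpP sm (leq0n i).
  by apply/permP => i; rewrite perm1; have [] := simpP sm (leq0n i).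
apply/andP; split.
  by apply/forallP => i; rewrite ffunE perm1 !eqxx.
apply/forallP => a; apply/existsP; exists ord0; rewrite inE /= ord1 /=.
rewrite -leqn0; apply: (@label_le ord0); apply: c_low.
by rewrite !ffunE.
Qed.

(** In a full simplex the vertex labelled [n.+1] passes every test, and the vertex labelled [i]
    fails the test [i]. *)
Lemma discrete_miranda : exists z : 'I_n.+1 -> nat, (forall i, z i <= M) /\
  forall i, exists y y' : {ffun 'I_n.+1 -> nat},
    [/\ forall t, z t <= y t <= (z t).+1, forall t, z t <= y' t <= (z t).+1, c i y & ~~ c i y'].
Proof.
have : #|full n.+1| != 0 by have := odd_all (leqnn _); case: #|_|.
rewrite cards_eq0 => /set0Pn[s]; rewrite inE => /andP[sm /forallP h].
exists (fun i => nat_of_ord (s.1 i)); split=> [i|i]; first by rewrite -ltnS ltn_ord.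
have vtx q t : nat_of_ord (s.1 t) <= vertex s q t <= (s.1 t).+1.
  by rewrite ffunE leq_addr /= -[X in _ <= X]addn1 leq_add2l leq_b1.
have /existsP[q1 /andP[_ /eqP l1]] := h ord_max.
have /existsP[q2 /andP[_ /eqP l2]] := h (widen_ord (leqnSn _) i).
exists (vertex s q1), (vertex s q2); split=> //; last exact: label_has.
by apply: label_gt; rewrite l1 /=.
Qed.

End Kuhn.

(** * Staggered labels of lattice points *)

Definition nearby n (r : nat) (y y' : 'I_n -> nat) := [forall i, (y i <= y' i + r) && (y' i <= y i + r)].

Lemma card_ord_interval n j l : l <= n -> #|[set i : 'I_n | j <= i < l]| = l - j.
Proof.
move=> ln; have lt (i : 'I_(l - j)) : j + i < n by have := ltn_ord i; lia.
rewrite -[RHS]card_ord -[RHS]cardsT -(card_imset (f := fun i => Ordinal (lt i))); last first.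
  by move=> i i' /(congr1 val) /= /addnI e; apply: val_inj.
apply: eq_card => i; rewrite inE; apply/idP/imsetP => [/andP[ji il]|[i' _ ->]] /=.
  have il' : i - j < l - j by lia.
  by exists (Ordinal il') => //; apply: val_inj => /=; lia.
have := ltn_ord i'; lia.
Qed.

Lemma card_bigcup_le1 (I T : finType) (A : {set I}) (F : I -> {set T}) :
  (forall i, i \in A -> #|F i| <= 1) -> #|\bigcup_(i in A) F i| <= #|A|.
Proof.
move=> h; rewrite -[X in _ <= X]sum1_card; elim/big_rec2: _ => [|i k B iA le]; first by rewrite cards0.
by rewrite (leq_trans (leq_card_setU _ _)) // leq_add // h.
Qed.

Lemma divn_phase (n t a : nat) x : t <= x <= t.+1 -> ~~ (n %| (t + a).+1) -> (x + a) %/ n = (t + a) %/ n.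
Proof.
move=> /andP[tx xt] nd; have [->//|ne] := eqVneq x t.
have -> : x = t.+1 by apply/eqP; rewrite eqn_leq xt ltn_neqAle eq_sym ne.
case: n nd => [|n] nd; first by rewrite !divn0.
by rewrite addSn divnS // (negbTE nd).
Qed.

(** This is what the staggering buys: passing from [t] to [t.+1] crosses a rounding threshold of at
    most one of the [n] phases. *)
Lemma card_phase_hit n t : #|[set a : 'I_n | n %| (t + a).+1]| <= 1.
Proof.
apply/card_le1P => a; rewrite inE => /dvdnP[x ex] b; rewrite !inE.
apply/idP/eqP => [/dvdnP[z ez]|->]; last by apply/dvdnP; exists x.
apply: val_inj => /=; have := ltn_ord a; have := ltn_ord b => lb la.
have [xz|zx|e] := ltngtP x z; [nia|nia|]; rewrite e in ex; lia.
Qed.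

Section Labels.
Variables (n j l h step w : nat).

(* A coordinate [j <= i < l] is measured by its distance to the walls [w * step] modulo
   [2 * w * step], a coordinate [l <= i] by its value. The label of phase [a] rounds these numbers
   to multiples of [n] cells; the [n] phases have disjoint sets of rounding thresholds. *)
Definition isu (i : 'I_n) := j <= i < l.
Definition isv (i : 'I_n) := l <= i.
(** Truncated subtraction turns the sum into an absolute value. With [p = 2 * c], as in all uses, it
    is the distance from [x] to the nearest number congruent to [c] modulo [p]. *)
Definition gap (p c x : nat) := (x %% p - c) + (c - x %% p).
Definition tau (i : 'I_n) (y : 'I_n -> nat) :=
  (if isv i then y i else gap (2 * w * step) (w * step) (y i)) %/ step.
Definition phased (a i : 'I_n) y := (tau i y + a) %/ n.
(* The [h]-th smallest rounded distance to the walls. Larger distances are forgotten, so that they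
   cannot change the label of phase [a]: this leaves [h] unstable phases in [card_uunlocked]. *)
Definition crowded (a : 'I_n) y (s : nat) := h <= #|[set i | isu i && (phased a i y <= s)]|.
Definition cutoff (a : 'I_n) y := find (crowded a y) (iota 0 w.+2).

Definition vlabel (a : 'I_n) y : {ffun 'I_n -> nat} :=
  [ffun i => if isv i then phased a i y else 0].
Definition ulabel1 (a : 'I_n) y : {ffun 'I_n -> nat} :=
  [ffun i => if isu i then minn (phased a i y) (cutoff a y) else 0].
(* The wall near [y i], or else the interval between walls that contains [y i]. *)
Definition ulabel2 (a : 'I_n) y : {ffun 'I_n -> nat} :=
  [ffun i => if isu i && (0 < cutoff a y) then
    (if phased a i y == 0 then y i %/ (2 * w * step) else (y i + w * step) %/ (2 * w * step)) else 0].
Definition ulabel a y := (ulabel1 a y, ulabel2 a y, cutoff a y).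
Definition label a y := (vlabel a y, ulabel a y).

Hypothesis step_gt0 : 0 < step.
Hypothesis w_gt0 : 0 < w.
Hypothesis hu : h <= #|[set i | isu i]|.

Lemma gap_le x : gap (2 * w * step) (w * step) x <= w * step.
Proof.
rewrite /gap; have : x %% (2 * w * step) < 2 * w * step by rewrite ltn_mod !muln_gt0 w_gt0.
by rewrite -mulnA mul2n -addnn; lia.
Qed.

Lemma phased_le (a i : 'I_n) y : isu i -> phased a i y <= w.
Proof.
move=> /andP[_ il]; rewrite /phased -ltnS ltn_divLR; last by apply: leq_ltn_trans (ltn_ord a).
have : tau i y <= w.
  rewrite /tau /isv (leqNgt l) il /=.
  by apply: leq_trans (leq_div2r step (gap_le _)) _; rewrite mulnK.
by have := ltn_ord a; nia.
Qed.

Lemma crowded_cutoff a y : crowded a y (cutoff a y).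
Proof.
have hs : has (crowded a y) (iota 0 w.+2).
  apply/hasP; exists w; first by rewrite mem_iota; lia.
  apply: leq_trans hu _; apply/subset_leq_card/subsetP => i; rewrite !inE => ui.
  by rewrite ui phased_le.
have := nth_find 0 hs; rewrite nth_iota //.
by move: hs; rewrite has_find size_iota.
Qed.

Lemma cutoff_min a y z : crowded a y z -> cutoff a y <= z.
Proof.
move=> cz; rewrite leqNgt; apply/negP => zc.
have := before_find 0 zc; rewrite nth_iota ?cz //.
by apply: leq_trans zc _; rewrite -[X in _ <= X](size_iota 0) find_size.
Qed.

Lemma cutoff_shift a y a' y' : (forall i, isu i -> phased a' i y' <= (phased a i y).+1) ->
  cutoff a' y' <= (cutoff a y).+1.
Proof.
move=> le; apply: cutoff_min; apply: leq_trans (crowded_cutoff a y) _.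
apply/subset_leq_card/subsetP => i; rewrite !inE => /andP[ui si].
by rewrite ui (leq_trans (le i ui)).
Qed.

Lemma gap_lip p x x' r : 0 < p -> x <= x' + r -> x' <= x + r ->
  gap (2 * p) p x <= gap (2 * p) p x' + r.
Proof.
move=> p0 h1 h2; rewrite /gap.
have l1 : x %% (2 * p) < 2 * p by rewrite ltn_mod; lia.
have l2 : x' %% (2 * p) < 2 * p by rewrite ltn_mod; lia.
have e1 := divn_eq x (2 * p); have e2 := divn_eq x' (2 * p).
move: (x %% _) (x' %% _) (x %/ _) (x' %/ _) e1 e2 l1 l2 => m m' q q' e1 e2 l1 l2.
have [rp|rp] := leqP p r; first by lia.
have [qq|qq|e] := ltngtP q q'.
- have : q' = q.+1 by nia.
  by move=> e; rewrite e in e2; nia.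
- have : q = q'.+1 by nia.
  by move=> e; rewrite e in e1; nia.
- by rewrite e in e1; nia.
Qed.

(** A window of radius [r] is shorter than [step], so it meets at most two cells, and the lower one
    is named here. For distances to walls this uses that [gap] is 1-Lipschitz. *)
Lemma tau_near r y y' i : 2 * r < step -> nearby r y y' ->
  let t := ((if isv i then y i else gap (2 * w * step) (w * step) (y i)) - r) %/ step in
  t <= tau i y' <= t.+1.
Proof.
move=> rs /forallP/(_ i)/andP[h1 h2] /=; rewrite /tau.
set u := (X in (X - r) %/ _); set u' := (X in _ <= X %/ step <= _).
have [b1 b2] : u <= u' + r /\ u' <= u + r.
  rewrite /u /u'; case: ifP => _ //; rewrite -mulnA.
  by split; apply: gap_lip; rewrite ?muln_gt0 ?w_gt0.
rewrite leq_div2r /=; last by lia.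
apply: leq_trans (_ : (u - r + step) %/ step <= _); first by apply: leq_div2r; lia.
by rewrite divnDr // divnn step_gt0 addn1.
Qed.

Lemma near_refl r (y : 'I_n -> nat) : nearby r y y.
Proof. by apply/forallP => i; rewrite leq_addr. Qed.

Variable r : nat.
Hypothesis r_small : 2 * r < step.

Section Unlocked.
Variable y : 'I_n -> nat.
Let t i := ((if isv i then y i else gap (2 * w * step) (w * step) (y i)) - r) %/ step.
Let tP i y' : nearby r y y' -> t i <= tau i y' <= (t i).+1.
Proof. by move=> /(tau_near i r_small). Qed.

(** A coarse label is unstable only if some coordinate [i] with [isv i] crosses a threshold of its
    phase, and each coordinate does so for at most one phase. *)
Lemma card_vunlocked (U : {set 'I_n}) :
  (forall a, a \in U -> exists y', nearby r y y' /\ vlabel a y' <> vlabel a y) ->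
  #|U| <= #|[set i | isv i]|.
Proof.
move=> hU; apply: leq_trans (card_bigcup_le1 (F := fun i => [set a : 'I_n | n %| (t i + a).+1]) _); last first.
  by move=> i _; apply: card_phase_hit.
apply/subset_leq_card/subsetP => a aU; apply/bigcupP.
have [y' [yy' ne]] := hU a aU.
have [/existsP[i /andP[iv hit]]|/existsPn no] := boolP [exists i, isv i && (n %| (t i + a).+1)].
  by exists i; rewrite inE.
case: ne; apply/ffunP => i; rewrite !ffunE; case: ifP => // iv.
have := no i; rewrite iv /= => nh.
by rewrite /phased (divn_phase (tP i yy')) // (divn_phase (tP i (near_refl r _))).
Qed.

(** The coordinates that can influence a cutoff: fewer than [h] others are strictly closer to the
    walls. Ties are kept, so there may be more than [h] of them. *)
Let Rel := [set i | isu i && (#|[set i' | isu i' && (t i' < t i)]| < h)].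

Let s (a i : 'I_n) := (t i + a) %/ n.

Let phased_ge a i y' : nearby r y y' -> s a i <= phased a i y'.
Proof. by move=> /(tP i)/andP[h1 _]; apply: leq_div2r; rewrite leq_add2r. Qed.

Section Locked.
Variable a : 'I_n.
Hypothesis nohit : forall i, i \in Rel -> ~~ (n %| (t i + a).+1).

Let phasedE i y' : nearby r y y' -> i \in Rel -> phased a i y' = s a i.
Proof. by move=> yy' iR; apply: divn_phase (tP i yy') (nohit iR). Qed.

(** If a coordinate outside [Rel] belongs to the crowd, then so do the at least [h] coordinates
    strictly closer to the walls than the closest one outside [Rel]; these are in [Rel], hence
    stable by [nohit]. *)
Let crowdedE y' z : nearby r y y' ->
  crowded a y' z = (h <= #|[set i | isu i && (s a i <= z)]|).
Proof.
move=> yy'; apply/idP/idP => hz.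
  apply: leq_trans hz _; apply/subset_leq_card/subsetP => i; rewrite !inE => /andP[-> /=].
  exact: leq_trans (phased_ge _ _ yy').
have [/existsP[i0 i0P]|/existsPn no] := boolP [exists i, [&& isu i, s a i <= z & i \notin Rel]].
  case: (@arg_minnP _ i0 (fun i => isu i && (i \notin Rel)) t).
    by case/and3P: i0P => -> _ ->.
  move=> i1 /andP[u1 n1] min1.
  have s1 : s a i1 <= z.
    case/and3P: i0P => u0 s0 n0; apply: leq_trans s0; apply: leq_div2r.
    by rewrite leq_add2r min1 // u0.
  have : h <= #|[set i' | isu i' && (t i' < t i1)]|.
    by move: n1; rewrite inE u1 /= -leqNgt.
  move=> /leq_trans; apply; apply/subset_leq_card/subsetP => i; rewrite !inE => /andP[ui ti].
  rewrite ui /= phasedE //; last first.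
    by apply: contraTT ti => nR; rewrite -leqNgt; apply: min1; rewrite ui.
  by apply: leq_trans s1; apply: leq_div2r; rewrite leq_add2r ltnW.
apply: leq_trans hz _; apply/subset_leq_card/subsetP => i; rewrite !inE => /andP[ui si].
by rewrite ui phasedE //; have := no i; rewrite ui si /= negbK.
Qed.

Let cutoffE y' : nearby r y y' -> cutoff a y' = cutoff a y.
Proof.
move=> yy'; apply: eq_find => z.
by rewrite !crowdedE //; apply: near_refl.
Qed.


Hypothesis wn : n.+1 < w.

Let rel_cutoff i : isu i -> i \notin Rel -> cutoff a y <= s a i.
Proof.
move=> ui; rewrite inE ui /= -leqNgt => hi; apply: cutoff_min.
rewrite crowdedE; last exact: near_refl.
apply: leq_trans hi _; apply/subset_leq_card/subsetP => i'; rewrite !inE => /andP[-> /= ti].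
by apply: leq_div2r; rewrite leq_add2r ltnW.
Qed.

(** Outside [Rel] the rounded distance is at least the cutoff, so [minn] hides its changes. The
    entry of [ulabel2] is the index of a block centred at a wall if [y i] is near one, and of a
    block between two walls otherwise: in both cases a move by [r] cannot leave the block. *)
Lemma ulabel_locked y' : nearby r y y' -> ulabel a y' = ulabel a y.
Proof.
move=> yy'; rewrite /ulabel cutoffE //; congr (_, _, _); apply/ffunP => i; rewrite !ffunE.
  case: (boolP (isu i)) => //= ui; rewrite cutoffE //.
  have [iR|iR] := boolP (i \in Rel).
    by rewrite !phasedE //; apply: near_refl.
  have := rel_cutoff ui iR => le.
  have := phased_ge a i yy'; have := phased_ge a i (near_refl r y); lia.
rewrite cutoffE //; case: (boolP (isu i)) => //= ui; case: (posnP (cutoff a y)) => // c0.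
have same : (phased a i y' == 0) = (phased a i y == 0).
  have [iR|iR] := boolP (i \in Rel).
    by rewrite !phasedE //; apply: near_refl.
  have := rel_cutoff ui iR => le.
  have := phased_ge a i yy'; have := phased_ge a i (near_refl r y); lia.
rewrite same.
have gapE z : tau i z = gap (2 * w * step) (w * step) (z i) %/ step.
  by rewrite /tau /isv leqNgt; case/andP: ui => _ ->.
have an := ltn_ord a.
have /andP[n1 n2] : (y i <= y' i + r) && (y' i <= y i + r) by exact: (forallP yy' i).
have ws0 : 0 < w * step by rewrite muln_gt0 w_gt0.
have lm z : z %% (2 * w * step) < 2 * w * step by rewrite ltn_mod -mulnA muln_gt0.
have es : 2 * w * step = w * step + w * step by rewrite -mulnA mul2n addnn.
case: eqP => p0.
  have near0 z : phased a i z = 0 -> gap (2 * w * step) (w * step) (z i) < n * step.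
    move=> /eqP; rewrite /phased -leqn0 -ltnS ltn_divLR; last by apply: leq_ltn_trans an.
    rewrite mul1n gapE => lt; rewrite -ltn_divLR //.
    by apply: leq_ltn_trans lt; apply: leq_addr.
  have g1 := near0 _ p0; have g2 : gap (2 * w * step) (w * step) (y' i) < n * step.
    by apply: near0; apply/eqP; rewrite same p0.
  move: g1 g2; rewrite /gap => g1 g2.
  have e1 := divn_eq (y i) (2 * w * step); have e2 := divn_eq (y' i) (2 * w * step).
  have l1 := lm (y i); have l2 := lm (y' i).
  (* [n.+1 < w] keeps the strip of [n] cells about a wall, with a margin for [r], inside its
     block. *)
  have wb : n * step + step + step <= w * step by rewrite -!mulSnr leq_mul2r wn orbT.
  move: (2 * w * step) (n * step) (w * step) (y i %/ _) (y' i %/ _) (y i %% _) (y' i %% _) es ws0 wb e1 e2 l1 l2 g1 g2.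
  move=> W ns ws q q' m m' -> ws0 wb e1 e2 l1 l2 g1 g2.
  by have [qq|qq|//] := ltngtP q q'; nia.
have far z : phased a i z <> 0 -> step <= gap (2 * w * step) (w * step) (z i).
  move=> pz; rewrite leqNgt; apply/negP => lt; apply: pz.
  by rewrite /phased gapE (divn_small lt) add0n divn_small.
have g1 := far _ p0.
have e1 := divn_eq (y i + w * step) (2 * w * step).
have e2 := divn_eq (y' i + w * step) (2 * w * step).
have e3 := divn_eq (y i) (2 * w * step).
have l1 := lm (y i + w * step); have l2 := lm (y' i + w * step); have l3 := lm (y i).
move: g1; rewrite /gap => g1.
move: (2 * w * step) (w * step) (y i %/ _) (y i %% _) ((y i + _) %/ _) ((y' i + _) %/ _)
  ((y i + _) %% _) ((y' i + _) %% _) es ws0 e1 e2 e3 l1 l2 l3 g1.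
move=> W ws q0 m0 q q' m m' -> ws0 e1 e2 e3 l1 l2 l3 g1.
have [qq|qq|//] := ltngtP q q'.
- have ? : q' = q.+1 by nia.
  have [?|?] := leqP q0 q; last by nia.
  have ? : q0 = q \/ q0.+1 = q by nia.
  by nia.
- have ? : q = q'.+1 by nia.
  have ? : q0 = q \/ q0.+1 = q by nia.
  by nia.
Qed.

End Locked.

(** An unstable phase comes from a relevant coordinate crossing one of its thresholds. Tied
    coordinates cross thresholds of the same phase, so distinct unstable phases have distinct ranks,
    and the ranks are below [h]. *)
Lemma card_uunlocked (U : {set 'I_n}) : n.+1 < w ->
  (forall a, a \in U -> exists y', nearby r y y' /\ ulabel a y' <> ulabel a y) -> #|U| <= h.
Proof.
move=> wn hU.
have wit a : exists i, (a \in U) ==> (i \in Rel) && (n %| (t i + a).+1).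
  have [aU|aU] := boolP (a \in U); last by exists a.
  have [/existsP[i ih]|/existsPn no] := boolP [exists i, (i \in Rel) && (n %| (t i + a).+1)].
    by exists i.
  have [y' [yy' ne]] := hU a aU; case: ne; apply: ulabel_locked => // i iR.
  by have := no i; rewrite iR.
have [f hf] := fin_all_exists wit.
pose rk i := #|[set i' | isu i' && (t i' < t i)]|.
have rk_lt a : a \in U -> rk (f a) < h.
  by move=> aU; have := hf a; rewrite aU /= => /andP[]; rewrite inE => /andP[].
rewrite -[h]card_ord; case: (posnP h) => [h0|h0].
  rewrite (_ : U = set0) ?cards0 //; apply/setP => a; rewrite inE; apply/negP => /rk_lt.
  by rewrite h0.
apply: leq_trans (_ : #|[set x : 'I_h | true]| <= _); last exact: max_card.
have hK : h.-1.+1 = h by rewrite prednK.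
pose F a : 'I_h := cast_ord hK (inord (rk (f a))).
rewrite -(card_in_imset (f := F) (D := U)); first by apply/subset_leq_card/subsetP => x; rewrite inE.
move=> a b aU bU /(congr1 val); rewrite /= !inordK ?hK ?rk_lt // => rab.
have := hf a; have := hf b; rewrite aU bU /= => /andP[bR bh] /andP[aR ah].
have te : t (f a) = t (f b).
  have mono i i' : i \in Rel -> t i < t i' -> rk i < rk i'.
    rewrite inE => /andP[ui _] tt; apply: proper_card; apply/properP; split.
      by apply/subsetP => z; rewrite !inE => /andP[-> /ltn_trans]; apply.
    by exists i; rewrite !inE ui ?ltnn //.
  have [lt|lt|//] := ltngtP (t (f a)) (t (f b)).
    by have := mono _ _ aR lt; rewrite rab ltnn.
  by have := mono _ _ bR lt; rewrite rab ltnn.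
have /card_le1P := card_phase_hit n (t (f b)) => /(_ a); rewrite inE -te ah => /(_ isT b).
by rewrite !inE te bh => /esym/eqP.
Qed.

End Unlocked.

Section Compare.
Variables (a a' : 'I_n) (y y' : 'I_n -> nat).

Lemma phased_shift i : phased a i y <= (phased a' i y).+1.
Proof.
have n0 : 0 < n by apply: leq_ltn_trans (ltn_ord a).
rewrite /phased; apply: leq_trans (_ : (tau i y + a' + n) %/ n <= _).
  by apply: leq_div2r; have := ltn_ord a; lia.
by rewrite divnDr // divnn n0 addn1.
Qed.

End Compare.

Lemma phased_dist a a' i y y' : phased a i y = phased a i y' ->
  phased a' i y <= phased a' i y' + 2.
Proof.
move=> e; have := phased_shift a' a y i; have := phased_shift a a' y' i; lia.
Qed.

Lemma cutoff_phase a a' y : cutoff a y <= (cutoff a' y).+1.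
Proof. by apply: cutoff_shift => i _; apply: phased_shift. Qed.

(* The labels of one point for two phases differ by at most 1, so residues modulo 4 recover a label
   from the label of another phase; this bounds the number of label tuples with a given entry. *)
Definition mod4 (T : finType) (f : {ffun T -> nat}) : {ffun T -> 'I_4} := [ffun i => inord (f i %% 4)].

Lemma mod4_inj (T : finType) (f g : {ffun T -> nat}) : mod4 f = mod4 g ->
  (forall i, f i <= g i + 3 /\ g i <= f i + 3) -> f = g.
Proof.
move=> e d; apply/ffunP => i; have [d1 d2] := d i.
have := congr1 (fun u : {ffun T -> 'I_4} => u i : nat) e; rewrite !ffunE !inordK ?ltn_mod //.
lia.
Qed.

Lemma vlabel_code a a' y y' : vlabel a y = vlabel a y' ->
  mod4 (vlabel a' y) = mod4 (vlabel a' y') -> vlabel a' y = vlabel a' y'.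
Proof.
move=> /ffunP e me; apply: mod4_inj => // i; have := e i; rewrite !ffunE.
case: ifP => // _ pe; have := phased_dist a' pe; have := phased_dist a' (esym pe); lia.
Qed.

Definition ucode a y := (mod4 (ulabel1 a y), mod4 (ulabel2 a y), inord (cutoff a y %% 4) : 'I_4).

(** With cutoff 0 the label of phase [a] records no block, and a code modulo 4 could not recover the
    block of phase [a']. With a positive cutoff the two phases index the same blocks or blocks
    shifted by half a period, so the indices differ by at most 1. *)
Lemma ulabel_code a a' y y' : ulabel a y = ulabel a y' -> 0 < cutoff a y ->
  ucode a' y = ucode a' y' -> ulabel a' y = ulabel a' y'.
Proof.
case=> /ffunP e1 /ffunP e2 ec c0 [] m1 m2 /(congr1 val) /=; rewrite !inordK ?ltn_mod // => mc.
have c1 := cutoff_phase a' a y; have c2 := cutoff_phase a a' y.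
have c3 := cutoff_phase a' a y'; have c4 := cutoff_phase a a' y'.
have ce : cutoff a' y = cutoff a' y' by lia.
have c0' : 0 < cutoff a y' by rewrite -ec.
rewrite /ulabel ce; congr (_, _, _).
  apply: (mod4_inj m1) => i; have := e1 i; rewrite !ffunE; case: (isu i) => //.
  have := phased_shift a' a y i; have := phased_shift a a' y i.
  have := phased_shift a' a y' i; have := phased_shift a a' y' i; lia.
have dv z : z %/ (2 * w * step) <= (z + w * step) %/ (2 * w * step) <= (z %/ (2 * w * step)).+1.
  rewrite leq_div2r ?leq_addr //=.
  apply: leq_trans (_ : (z + 2 * w * step) %/ (2 * w * step) <= _).
    by apply: leq_div2r; rewrite leq_add2l -mulnA leq_pmull.
  by rewrite divnDr // divnn -mulnA !muln_gt0 w_gt0 step_gt0 addn1.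
apply: (mod4_inj m2) => i; have := e2 i; rewrite !ffunE ce c0 c0' !andbT.
move=> {e1 e2 m1 m2 mc c1 c2 c3 c4 ec c0 c0' ce}; case: (isu i) => //=; case: (0 < cutoff a' y') => //=.
have := dv (y i); have := dv (y' i).
move: (y i %/ _) (y' i %/ _) ((y i + _) %/ _) ((y' i + _) %/ _) => p1 p2 p3 p4.
move: (phased a i y == 0) (phased a i y' == 0) (phased a' i y == 0) (phased a' i y' == 0).
by clear => b1 b2 b3 b4; case: b1; case: b2; case: b3; case: b4; lia.
Qed.

(* [kappa] is the index of a cell of side [step] adjacent to the cell of [y]. *)
Definition adjacent (kappa y : 'I_n -> nat) :=
  forall i : 'I_n, j <= i -> kappa i <= y i %/ step + 1 /\ y i %/ step <= kappa i + 1.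

Lemma gap_cell p x : 0 < p -> gap (2 * p) p (x %/ step) <= gap (2 * p * step) (p * step) x %/ step + 1 /\
  gap (2 * p * step) (p * step) x %/ step <= gap (2 * p) p (x %/ step).
Proof.
move=> p0; rewrite /gap.
have e : x %% (2 * p * step) = ((x %/ step) %% (2 * p)) * step + x %% step.
  by rewrite {1}(divn_eq (x %% (2 * p * step)) step) -modn_divl modn_dvdm // dvdn_mull.
rewrite {}e; move: ((x %/ step) %% _) (x %% step) (ltn_pmod x step_gt0) => m s ls.
have [pm|pm] := leqP p m.
  have -> : m * step + s - p * step = (m - p) * step + s by rewrite mulnBl; nia.
  have -> : p * step - (m * step + s) = 0 by nia.
  by rewrite addn0 divnMDl // (divn_small ls); lia.
have -> : m * step + s - p * step = 0 by nia.
rewrite add0n; split.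
  suff : p - m - 1 <= (p * step - (m * step + s)) %/ step by lia.
  by rewrite leq_divRL //; nia.
apply: leq_trans (_ : (p - m) * step %/ step <= _); last by rewrite mulnK //; lia.
by apply: leq_div2r; rewrite mulnBl; lia.
Qed.

(** In [n + 2], rounding to multiples of [n] with a phase accounts for [n], the neighbouring cell
    for 1 and the measuring of gaps in whole cells for 1. *)
Lemma cell_tight (a i : 'I_n) kappa y : adjacent kappa y -> isu i ->
  gap (2 * w) w (kappa i) <= n * phased a i y + (n + 2) /\
  n * phased a i y <= gap (2 * w) w (kappa i) + (n + 2).
Proof.
move=> adj ui; have /andP[ji il] := ui; have [k1 k2] := adj i ji.
have g1 := gap_lip w_gt0 k1 k2; have g2 := gap_lip w_gt0 k2 k1.
have [g3 g4] := gap_cell (y i) w_gt0.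
rewrite /phased /tau /isv (leqNgt l) il /=.
move: g1 g2 g3 g4; move: (_ %/ step) (gap _ _ (kappa i)) => u v g1 g2 g3 g4.
have := divn_eq (u + a) n; have := ltn_ord a => an.
have : (u + a) %% n < n by rewrite ltn_mod; lia.
by rewrite mulnC; lia.
Qed.

Lemma cell_v (a i : 'I_n) kappa y : adjacent kappa y -> isv i -> j <= l ->
  kappa i <= n * phased a i y + (n + 2) /\ n * phased a i y <= kappa i + (n + 2).
Proof.
move=> adj iv jl; have [k1 k2] := adj i (leq_trans jl iv).
rewrite /phased /tau iv; have := divn_eq (y i %/ step + a) n; have := ltn_ord a => an.
have : (y i %/ step + a) %% n < n by rewrite ltn_mod; lia.
by rewrite mulnC; lia.
Qed.

Lemma cell_loose (a i : 'I_n) kappa kappa' y y' : adjacent kappa y -> adjacent kappa' y' ->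
  isu i -> ulabel a y = ulabel a y' -> 0 < cutoff a y ->
  kappa i <= kappa' i + (2 * w + 3).
Proof.
move=> adj adj' ui [] /ffunP/(_ i) e1 /ffunP/(_ i) e2 ec c0.
have /andP[ji il] := ui; have [k1 k2] := adj i ji; have [k3 k4] := adj' i ji.
have c0' : 0 < cutoff a y' by rewrite -ec.
move: e1 e2; rewrite !ffunE ui c0 c0' /= => e1.
have -> : (phased a i y == 0) = (phased a i y' == 0) by lia.
have block c : (y i + c) %/ (2 * w * step) = (y' i + c) %/ (2 * w * step) -> y i < y' i + 2 * w * step.
  move=> e; have := divn_eq (y i + c) (2 * w * step); have := divn_eq (y' i + c) (2 * w * step).
  have : (y i + c) %% (2 * w * step) < 2 * w * step by rewrite ltn_mod -mulnA !muln_gt0 w_gt0.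
  by move: (_ %% _) (_ %% _) (_ %/ _) (_ %/ _) e => m1 m2 q1 q2 -> l1 e1' e2'; move: e1' e2' l1; clear; lia.
move=> e2; have lt : y i < y' i + 2 * w * step.
  by move: e2; case: ifP => _ e2; [apply: (block 0); rewrite !addn0|apply: block e2].
have : y i %/ step <= (y' i + 2 * w * step) %/ step by apply: leq_div2r; apply: ltnW.
by rewrite (divnDr _ (dvdn_mull _ (dvdnn _))) mulnK //; clear -k1 k4; lia.
Qed.

End Labels.

Local Open Scope ring_scope.

(** * Greedy choice and Lipschitz extension *)

(** Exchanging the new value with the old one is an involution, so redrawing one coordinate of a
    uniformly random function leaves it uniform. *)
Lemma sum_ffun_resample (K : nmodType) (I V : finType) (a0 : I) (F : {ffun I -> V} -> K) :
  \sum_v \sum_(z : {ffun I -> V}) F [ffun a => if a == a0 then v else z a] = (\sum_z F z) *+ #|V|.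
Proof.
rewrite pair_big /=.
pose phi (p : V * {ffun I -> V}) := (p.2 a0, [ffun a => if a == a0 then p.1 else p.2 a]).
have phiK : involutive phi.
  move=> [v z]; rewrite /phi /= ffunE eqxx; congr (_, _); apply/ffunP => a.
  by rewrite !ffunE; case: eqP => // ->.
rewrite (reindex_inj (inv_inj phiK)) /= -(pair_big xpredT xpredT (fun (v : V) (z : {ffun I -> V}) => F [ffun a =>
  if a == a0 then z a0 else [ffun a1 => if a1 == a0 then v else z a1] a])) /=.
rewrite -sumr_const; apply: eq_bigr => v _; apply: eq_bigr => z _; congr F.
by apply/ffunP => a; rewrite !ffunE; case: eqP => // ->.
Qed.

Lemma exists_le_mean (K : realFieldType) (V : finType) (F : V -> K) (c : K) :
  (0 < #|V|)%N -> \sum_v F v <= c *+ #|V| -> exists v, F v <= c.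
Proof.
move=> V0 le; apply/existsP; rewrite -[X in is_true X]negbK; apply/negP => /existsPn h.
have : \sum_(v : V) c < \sum_v F v.
  apply: ltr_sum; first by apply/hasP; have /card_gt0P[v _] := V0; exists v; rewrite ?mem_index_enum.
  by move=> v _; rewrite ltNge h.
by rewrite sumr_const ltNge le.
Qed.

(* Conditional expectations: fixing one more variable at its best value multiplies
   the conditional mean of the at most [D] events containing it by at most [D.+1]. *)
Lemma greedy_choice (K : realFieldType) (n : nat) (L V : finType)
    (Ev : {set {ffun 'I_n -> L}}) (g : {ffun 'I_n -> L} -> {ffun 'I_n -> V} -> K)
    (D : nat) (eps : K) :
  (0 < #|V|)%N -> 0 < eps -> (forall e z, 0 <= g e z) ->
  (forall a l, #|[set e in Ev | e a == l]| <= D)%N ->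
  (forall e, e \in Ev -> \sum_z g e z <= eps * #|V|%:R ^+ n) ->
  exists x : 'I_n -> L -> V, forall e, e \in Ev ->
    g e [ffun a => x a (e a)] <= eps * D.+1%:R ^+ n.
Proof.
move=> V0 eps0 g0 deg mean.
pose T : finType := ('I_n * L)%type.
pose E (A : {set T}) (x : {ffun T -> V}) (e : {ffun 'I_n -> L}) :=
  \sum_(z : {ffun 'I_n -> V}) g e [ffun a => if (a, e a) \in A then x (a, e a) else z a].
pose cnt (A : {set T}) (e : {ffun 'I_n -> L}) := #|[set a | (a, e a) \in A]|.
(* The bound on an event grows by the factor [D.+1] with each of its own variables that gets fixed,
   at most [n] times in all. *)
pose b A e : K := eps * #|V|%:R ^+ n * D.+1%:R ^+ cnt A e.
have b0 A e : 0 < b A e by rewrite !mulr_gt0 ?exprn_gt0 ?ltr0n.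
have key m : (m <= #|T|)%N -> exists (A : {set T}) (x : {ffun T -> V}),
    #|A| = m /\ forall e, e \in Ev -> E A x e <= b A e.
  elim: m => [_|m IH mT].
    have /card_gt0P[v0 _] := V0.
    exists set0, [ffun=> v0]; split; first exact: cards0.
    move=> e eEv; rewrite /b /cnt (_ : [set a | _] = set0) ?cards0 ?expr0 ?mulr1; last first.
      by apply/setP => a; rewrite !inE.
    apply: le_trans (mean e eEv); apply: ler_sum => z _.
    by rewrite (_ : [ffun a => _] = z) //; apply/ffunP => a; rewrite ffunE inE.
  have [A [x [cA hA]]] := IH (ltnW mT).
  have [w wA] : exists w, w \notin A.
    apply/existsP; rewrite -[X in is_true X]negbK; apply/negP => /existsPn h.
    have : #|A| = #|T| by apply: eq_card => t; rewrite -[t \in A]negbK h.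
    by rewrite cA => e; rewrite e ltnn in mT.
  pose xv v := [ffun t => if t == w then v else x t] : {ffun T -> V}.
  pose Ew := [set e in Ev | e w.1 == w.2].
  have bw e : e \in Ew -> b (w |: A) e = D.+1%:R * b A e.
    rewrite inE => /andP[_ /eqP ew]; rewrite /b mulrCA -exprS; congr (_ * _ ^+ _).
    rewrite /cnt (_ : [set a | _] = w.1 |: [set a | (a, e a) \in A]).
      rewrite cardsU1 inE ew (_ : (w.1, w.2) = w) ?wA //; by case: (w).
    apply/setP => a; rewrite !inE; congr (_ || _).
    apply/eqP/eqP => [<- //|->]; rewrite ew; by case: (w).
  have bnw e : e \in Ev -> e \notin Ew -> forall v, E (w |: A) (xv v) e <= b (w |: A) e.
    move=> eEv; rewrite inE eEv /= => ew v.
    have neq a : ((a, e a) == w) = false.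
      by apply/eqP => h; move: ew; rewrite -h /= eqxx.
    rewrite /b /cnt (_ : [set a | _] = [set a | (a, e a) \in A]); last first.
      by apply/setP => a; rewrite !inE neq.
    apply: le_trans (hA e eEv); apply: ler_sum => z _.
    by rewrite (_ : [ffun a => _] = [ffun a => if (a, e a) \in A then x (a, e a) else z a])//;
       apply/ffunP => a; rewrite !ffunE !inE neq.
  have sumE e : e \in Ew -> \sum_v E (w |: A) (xv v) e = E A x e *+ #|V|.
    rewrite inE => /andP[_ /eqP ew].
    rewrite /E -(sum_ffun_resample w.1 (fun z : {ffun 'I_n -> V} => g e [ffun a =>
      if (a, e a) \in A then x (a, e a) else z a])).
    apply: eq_bigr => v _; apply: eq_bigr => z _; congr (g e _); apply/ffunP => a.
    rewrite !ffunE !inE; have [->|aw] := eqVneq a w.1.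
      have -> : (w.1, e w.1) = w by rewrite ew; case: (w).
      by rewrite eqxx (negbTE wA).
    by rewrite (_ : ((a, e a) == w) = false) //; apply/eqP => h; move: aw; rewrite -h /= eqxx.
  (* Averaged over [v], each ratio is at most 1, and at most [D] events contain [w]; so some [v]
     keeps the sum of the ratios, hence each single one, at most [D]. *)
  have [v hv] : exists v, \sum_(e in Ew) E (w |: A) (xv v) e / b A e <= D%:R.
    apply: exists_le_mean => //; rewrite exchange_big /=.
    apply: le_trans (_ : \sum_(e in Ew) #|V|%:R <= _).
      apply: ler_sum => e eEw; rewrite -mulr_suml sumE // ler_pdivrMr // mulr_natl.
      rewrite lerMn2r hA ?orbT //; by move: eEw; rewrite inE => /andP[].
    by rewrite sumr_const -mulrnA mulnC mulrnA lerMn2r ler_nat deg orbT.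
  exists (w |: A), (xv v); split; first by rewrite cardsU1 wA cA.
  move=> e eEv; case: (boolP (e \in Ew)) => eEw; last exact: bnw.
  rewrite bw // -ler_pdivrMr //; apply: le_trans (_ : D%:R <= _); last by rewrite ler_nat.
  apply: le_trans hv; rewrite (bigD1 e) //= lerDl.
  apply: sumr_ge0 => e' _; apply: divr_ge0; last exact: ltW.
  by rewrite /E; apply: sumr_ge0 => z _; apply: g0.
have [A [x [cA hA]]] := key _ (leqnn _).
have AT t : t \in A by have /eqP -> : A == setT; rewrite ?inE // eqEcard subsetT cardsT cA /=.
exists (fun a l => x (a, l)) => e eEv.
have := hA e eEv; rewrite /E /b /cnt (_ : [set a | _] = setT); last first.
  by apply/setP => a; rewrite !inE AT.
rewrite cardsT card_ord (eq_bigr (fun=> g e [ffun a => x (a, e a)])); last first.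
  by move=> z _; congr (g e _); apply/ffunP => a; rewrite !ffunE AT.
have cT : #|(xpredT : pred {ffun 'I_n -> V})| = (#|V| ^ n)%N.
  by rewrite -[n in RHS]card_ord -card_ffun.
rewrite sumr_const cT -[_ *+ _]mulr_natl natrX mulrAC mulrC.
by rewrite ler_pM2r // exprn_gt0 // ltr0n.
Qed.

(* McShane's extension, from the set of points of [C]. *)
Lemma lipschitz_extension (K : realFieldType) (T : finType) (d : T -> T -> nat)
    (C : {set T}) (val : T -> K) (r : nat) (M : K) :
  (0 < r)%N -> 0 <= M -> (forall x, d x x = 0%N) ->
  (forall x y z, d x z <= d x y + d y z)%N ->
  (forall x, x \in C -> 0 <= val x <= M) ->
  (forall x y, x \in C -> y \in C -> (d x y <= r)%N -> val x = val y) ->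
  exists f : T -> K, [/\ forall x, 0 <= f x <= M, forall x, x \in C -> f x = val x
    & forall x y, f x <= f y + M / r%:R * (d x y)%:R].
Proof.
move=> r0 M0 d0 dtri valM loc.
have r0' : 0 < r%:R :> K by rewrite ltr0n.
have Mr : 0 <= M / r%:R by rewrite divr_ge0.
pose f x := \big[Num.min/M]_(y in C) (val y + M / r%:R * (d x y)%:R).
have f_le x y : y \in C -> f x <= val y + M / r%:R * (d x y)%:R.
  by move=> yC; apply: bigmin_le_cond.
have fM x : f x <= M by apply: bigmin_le_id.
exists f; split=> [x|x xC|x y].
- rewrite fM andbT; apply/bigmin_geP; split=> // y yC.
  by have /andP[? _] := valM y yC; rewrite addr_ge0 // mulr_ge0.
- apply/le_anti/andP; split; first by have := f_le x x xC; rewrite d0 mulr0 addr0.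
  apply/bigmin_geP; split=> [|y yC]; first by have /andP[] := valM x xC.
  have [le|lt] := leqP (d x y) r.
    by rewrite (loc x y) // lerDl mulr_ge0.
  have /andP[_ h1] := valM x xC; have /andP[h2 _] := valM y yC.
  have : M <= M / r%:R * (d x y)%:R.
    by rewrite -mulrA ler_peMr // ler_pdivlMl // mulr1 ler_nat ltnW.
  by move=> ?; lra.
- suff : f x - M / r%:R * (d x y)%:R <= f y by lra.
  apply/bigmin_geP; split=> [|z zC].
    have : 0 <= M / r%:R * (d x y)%:R by rewrite mulr_ge0.
    by have := fM x; lra.
  have := f_le x z zC.
  have : M / r%:R * (d x z)%:R <= M / r%:R * (d x y)%:R + M / r%:R * (d y z)%:R.
    by rewrite -mulrDr ler_wpM2l // -natrD ler_nat.
  by move=> ? ?; lra.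
Qed.

From mathcomp Require Import boolp reals.

(** * The random map *)

Lemma sum_ffun_mix (K : pzRingType) (I V : finType) (A : {set I}) (F : {ffun I -> V} -> K) :
  \sum_(x : {ffun I -> V}) \sum_(z : {ffun I -> V}) F [ffun a => if a \in A then x a else z a]
  = (\sum_z F z) *+ (#|V| ^ #|I|).
Proof.
rewrite pair_big /=.
pose phi (p : {ffun I -> V} * {ffun I -> V}) :=
  ([ffun a => if a \in A then p.1 a else p.2 a], [ffun a => if a \in A then p.2 a else p.1 a]) :
  {ffun I -> V} * {ffun I -> V}.
have phiK : involutive phi.
  by move=> [x z]; rewrite /phi /=; congr (_, _); apply/ffunP => a; rewrite !ffunE; case: (a \in A).
rewrite (reindex_inj (inv_inj phiK)) /=.
rewrite (eq_bigr (fun p : {ffun I -> V} * {ffun I -> V} => F p.1)); last first.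
  by move=> [x z] _ /=; congr F; apply/ffunP => a; rewrite !ffunE /=; case: (a \in A).
rewrite -(pair_big xpredT xpredT (fun x (_ : {ffun I -> V}) => F x)) /= -sumrMnl.
by apply: eq_bigr => x _; rewrite sumr_const card_ffun.
Qed.

Section Canonical.
Variables (T : finType) (E : eqType) (f : T -> E).

(** Labels lie in an infinite type, whereas the greedy choice indexes its variables by a finite one;
    a point chosen in each fibre of [f] stands for the label. *)
Definition canonical (x : T) : T := odflt x [pick y | f y == f x].

Lemma canonicalE x : f (canonical x) = f x.
Proof. by rewrite /canonical; case: pickP => [y /eqP|]. Qed.

Lemma eq_canonical x y : (canonical x == canonical y) = (f x == f y).
Proof.
apply/eqP/eqP => [e|e]; first by rewrite -canonicalE e canonicalE.
rewrite /canonical e; case: pickP => // /(_ y); by rewrite eqxx.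
Qed.

End Canonical.

(** The degree bound for the greedy choice: among the tuples with a prescribed entry, the code
    determines the tuple. *)
Lemma card_fiber_code (T C : finType) (E : finType) (enc : T -> E) (code : T -> C) (P : pred E) :
  (forall x y, P (enc x) -> P (enc y) -> code x = code y -> enc x = enc y) ->
  (#|[set e in [set enc x | x in T] | P e]| <= #|C|)%N.
Proof.
move=> h.
have [->|[e0 e0P]] := set_0Vmem [set e in [set enc x | x in T] | P e]; first by rewrite cards0.
have [x0 _ _] : exists2 x0, x0 \in T & e0 = enc x0.
  by move: e0P; rewrite inE => /andP[/imsetP].
pose inv e := odflt x0 [pick x | enc x == e].
have invK e : e \in [set enc x | x in T] -> enc (inv e) = e.
  move=> /imsetP[x _ ->]; rewrite /inv; case: pickP => [y /eqP //|/(_ x)].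
  by rewrite eqxx.
rewrite -(card_in_imset (f := fun e => code (inv e))) ?max_card //.
move=> e e'; rewrite !inE => /andP[h1 p1] /andP[h2 p2] ce.
by rewrite -(invK e) // -(invK e') //; apply: h; rewrite ?invK.
Qed.

Lemma card_set_ord n : #|{set 'I_n}| = (2 ^ n)%N.
Proof. by rewrite -cardsT -powersetT card_powerset cardsT card_ord. Qed.

Lemma subset_of_card (T : finType) (A : {set T}) (m : nat) :
  (m <= #|A|)%N -> exists2 B : {set T}, B \subset A & #|B| = m.
Proof.
move=> mA; exists [set x in take m (enum A)].
  by apply/subsetP => x; rewrite inE => /mem_take; rewrite mem_enum.
have := card_uniqP (take_uniq m (enum_uniq A)); rewrite size_take -cardE.
by rewrite cardsE => ->; case: ltngtP mA.
Qed.

Lemma cell_window (K : realFieldType) (P P1 P2 s z y1 y2 : K) : 0 < s ->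
  `|P1 - P| <= 4^-1 -> `|P2 - P| <= 4^-1 -> y1 <= z + 1 -> z <= y2 ->
  P1 * s < y1 -> y2 <= P2 * s -> z - s / 4 <= P * s < z + 1 + s / 4.
Proof.
move=> s0; rewrite !ler_distl => /andP[a1 a2] /andP[a3 a4] h1 h2 h3 h4.
have m1 : (P - 4^-1) * s <= P1 * s by rewrite ler_pM2r.
have m2 : P2 * s <= (P + 4^-1) * s by rewrite ler_pM2r.
by apply/andP; split; lra.
Qed.

Lemma cell_window_upper (K : realFieldType) (P s z t : K) : 0 < s ->
  z + 1 <= (t + 1) * s -> P * s < z + 1 + s / 4 -> P * s < (t + 2) * s.
Proof. by move=> *; lra. Qed.

Lemma cell_window_lower (K : realFieldType) (P s z t c : K) : 0 < s ->
  t * s <= z -> z - s / 4 <= P * s -> P * s < (c + 1) * s -> t * s < (c + 2) * s.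
Proof. by move=> *; lra. Qed.

(** * Two greedy choices of the values of [g], and the contradiction *)

Section Assignment.
Variables (K : realType) (n' j l k h : nat).
Local Notation n := n'.+1.
Variables (step w r M N Mc : nat) (Nc : 'I_n -> nat) (Kmax : 'I_n -> nat).
Variable Phi : ('I_n -> K) -> 'I_n -> K.

Hypotheses (jl : (j <= l)%N) (ln : (l <= n)%N) (khl : (k + h = l)%N) (hu : (h <= l - j)%N).
Hypotheses (r0 : (0 < r)%N) (r_step : (2 * r < step)%N) (step4 : (4 <= step)%N) (wn : (n.+1 < w)%N).
Hypotheses (N0 : (0 < N)%N) (Mc0 : (0 < Mc)%N) (Nc0 : forall a, (0 < Nc a)%N).

Definition box (xi : 'I_n -> K) := forall a, 0 <= xi a <= (Nc a)%:R.

Hypothesis Phi_gt0 : forall xi i, box xi -> 0 < Phi xi i.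
Hypothesis Phi_lt : forall xi i, box xi -> Phi xi i * step%:R < M.+1%:R.
Hypothesis Phi_max : forall xi i, box xi -> Phi xi i < (Kmax i).+1%:R.
Hypothesis Phi_cont : forall xi xi', box xi -> box xi' ->
  (forall a, `|xi a - xi' a| <= (Nc a)%:R / r%:R) -> forall i, `|Phi xi i - Phi xi' i| <= 4^-1.

Local Notation point := {ffun 'I_n -> 'I_M.+2}.
Local Notation val_ y := (fun i => nat_of_ord (y i)).
Local Notation vlab a y := (vlabel l step w a (val_ y)).
Local Notation lab a y := (label j l h step w a (val_ y)).
Local Notation cut a y := (cutoff j l h step w a (val_ y)).

(* On [I] the numbers [c] and [z] give the coordinate exactly, on [J] only up to its coarse part. *)
Definition hits (kappa : point) (I J : {set 'I_n}) (c : 'I_n -> nat) (z : 'I_n -> nat) :=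
  exists xi, [/\ box xi, forall i, (kappa i)%:R <= Phi xi i < (kappa i).+1%:R,
    forall a, a \in I -> xi a = (c a %% Nc a)%:R + (z a)%:R / N%:R
    & forall a, a \in J -> (c a %% Nc a)%:R <= xi a <= (c a %% Nc a)%:R + 1].

Definition hit (kappa : point) (c : 'I_n -> nat) (z : 'I_n -> nat) : bool :=
  `[< exists I J : {set 'I_n}, [/\ #|I| = k, #|J| = h, [disjoint I & J] & hits kappa I J c z] >].

(** The first [j] coordinates of [kappa] are restricted by the size of the target alone. *)
Definition admissible (kappa y : point) :=
  `[< adjacent j step (val_ kappa) (val_ y) /\ forall i, (kappa i <= Kmax i)%N >].

(** The first choice knows only the coarse labels, so it has to beat every cell that some point with
    these coarse labels, close to [h] walls, could ask for. *)
Definition regionA (y0 : point) : {set point} := [set kappa | [exists y : point,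
  [&& [forall a, vlab a y == vlab a y0], admissible kappa y & [exists a, cut a y == 0%N]]]].

Definition region (y0 : point) : {set point} := [set kappa | [exists y : point,
  [forall a, lab a y == lab a y0] && admissible kappa y]].

Variables (PA PB QA QB : K).
Hypotheses (PA0 : 0 < PA) (PB0 : 0 < PB) (QA0 : 0 < QA) (QB0 : 0 < QB).
Hypothesis mean_hits_le : forall kappa, \sum_(c : {ffun 'I_n -> 'I_Mc})
  #|[set z : {ffun 'I_n -> 'I_N} | hit kappa (val_ c) (val_ z)]|%:R <= PA * Mc%:R ^+ n * N%:R ^+ n.
Hypothesis hits_le : forall kappa c,
  #|[set z : {ffun 'I_n -> 'I_N} | hit kappa c (val_ z)]|%:R <= PB * N%:R ^+ n.
Hypothesis regionA_le : forall y : point, #|regionA y|%:R <= QA.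
Hypothesis region_le : forall y : point, (forall a, 0 < cut a y)%N -> #|region y|%:R <= QB.

(** [D1] counts the codes of tuples of coarse labels, [D2] those of tuples of full labels. They
    bound how many events share one label and depend on [n] only. *)
Definition D1 := #|{ffun 'I_n -> {ffun 'I_n -> 'I_4}}|.
Definition D2 := #|{ffun 'I_n -> {ffun 'I_n -> 'I_4} *
  ({ffun 'I_n -> 'I_4} * {ffun 'I_n -> 'I_4} * 'I_4)}|.
Definition B1 : K := QA * 2 ^+ n * PA * D1.+1%:R ^+ n.
Hypothesis smallA : B1 * D2.+1%:R ^+ n < 1.
Hypothesis smallB : QB * PB * D2.+1%:R ^+ n < 1.

Definition vrep (a : 'I_n) (y : point) : point := canonical (fun y : point => vlab a y) y.
Definition lrep (a : 'I_n) (y : point) : point := canonical (fun y : point => lab a y) y.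
Definition frep (y : point) : point := canonical (fun y : point => [ffun a : 'I_n => lab a y]) y.

Lemma lab_vlab a (y y' : point) : lab a y = lab a y' -> vlab a y = vlab a y'.
Proof. by rewrite /label => -[]. Qed.

Lemma lab_cut a (y y' : point) : lab a y = lab a y' -> cut a y = cut a y'.
Proof. by rewrite /label /ulabel => -[]. Qed.

Let st0 : (0 < step)%N. Proof. lia. Qed.
Let w0 : (0 < w)%N. Proof. lia. Qed.
Let hu' : (h <= #|[set i : 'I_n | isu j l i]|)%N.
Proof.
by rewrite (card_ord_interval j ln : #|[set i : 'I_n | isu j l i]| = _).
Qed.

(** A label with cutoff 0 records no block, so the tuples containing it admit no bound by codes; at
    such phases the fine value is attached to the coarse label already. Which phases these are is
    not visible from the coarse labels, hence the sum over all [A], at the cost of [2 ^ n]. *)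
Lemma coarse_assignment : exists x1 : 'I_n -> point -> 'I_Mc * 'I_N, forall y : point,
  \sum_(kappa in regionA y) \sum_(A : {set 'I_n})
    #|[set z : {ffun 'I_n -> 'I_N} | hit kappa (fun a => (x1 a (vrep a y)).1)
      (fun a => if a \in A then (x1 a (vrep a y)).2 : nat else z a)]|%:R / N%:R ^+ n <= B1.
Proof.
pose enc (y : point) := [ffun a => vrep a y].
pose g (e : {ffun 'I_n -> point}) (cz : {ffun 'I_n -> 'I_Mc * 'I_N}) : K :=
  if [pick y | enc y == e] is Some y then
    \sum_(kappa in regionA y) \sum_(A : {set 'I_n})
      #|[set z : {ffun 'I_n -> 'I_N} | hit kappa (fun a => (cz a).1)
      (fun a => if a \in A then (cz a).2 : nat else z a)]|%:R / N%:R ^+ n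
  else 0.
have encP y y' : enc y = enc y' -> forall a, vlab a y = vlab a y'.
  by move=> /ffunP e a; have := e a; rewrite !ffunE => /eqP; rewrite eq_canonical => /eqP.
have regE y y' : enc y = enc y' -> regionA y = regionA y'.
  move=> e; apply/setP => kappa; rewrite !inE; apply: eq_existsb => z; congr (_ && _).
  by apply: eq_forallb => a; rewrite (encP _ _ e).
have Nn0 : 0 < N%:R ^+ n :> K by rewrite exprn_gt0 // ltr0n.
have := @greedy_choice K n point ('I_Mc * 'I_N)%type [set enc y | y in point] g D1
  (QA * 2 ^+ n * PA); case.
- by rewrite card_prod !card_ord muln_gt0 Mc0.
- by rewrite !mulr_gt0 ?exprn_gt0.
- move=> e z; rewrite /g; case: pickP => // y _; apply: sumr_ge0 => kappa _; apply: sumr_ge0 => A _.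
  by rewrite divr_ge0 // ltW.
- move=> a y0; apply: (@card_fiber_code _ _ _ enc (fun y => [ffun a' => mod4 (vlab a' y)]) (fun e => e a == y0)).
  move=> y y'; rewrite !ffunE => /eqP e /eqP e' /ffunP ce; apply/ffunP => a'; rewrite !ffunE.
  apply/eqP; rewrite eq_canonical; apply/eqP; have := ce a'; rewrite !ffunE.
  apply: (vlabel_code st0 w0 hu' r_step (a := a)).
  by apply/eqP; rewrite -(eq_canonical (fun y : point => vlab a y)) -/(vrep a y) e -e'.
- move=> e _; rewrite /g; case: pickP => [y _|_]; last first.
    by rewrite big1 // !mulr_ge0 ?exprn_ge0 ?(ltW QA0) ?(ltW PA0).
  rewrite exchange_big /=; set Vn : K := #|_|%:R ^+ n.
  have Vn0 : 0 < Vn by rewrite /Vn exprn_gt0 // card_prod !card_ord ltr0n muln_gt0 Mc0.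
  apply: (@le_trans _ _ (\sum_(kappa in regionA y) (2 ^+ n * PA * Vn))); last first.
    rewrite sumr_const -[_ *+ #|_|]mulr_natl mulrA ler_pM2r //.
    by rewrite -!mulrA ler_pM2r ?regionA_le // mulr_gt0 ?exprn_gt0.
  apply: ler_sum => kappa _; rewrite exchange_big /=.
  apply: (@le_trans _ _ (\sum_(A : {set 'I_n}) (PA * Vn))); last first.
    rewrite sumr_const -[_ *+ #|_|]mulr_natl mulrA.
    have -> : #|(xpredT : pred {set 'I_n})| = (2 ^ n)%N.
      transitivity #|{set 'I_n}|; first by apply: eq_card.
      by rewrite card_set_ord.
    by rewrite natrX.
  apply: ler_sum => A _; rewrite -mulr_suml ler_pdivrMr //.
  pose pr (cz : {ffun 'I_n -> 'I_Mc * 'I_N}) := ([ffun a => (cz a).1], [ffun a => (cz a).2]) :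
    {ffun 'I_n -> 'I_Mc} * {ffun 'I_n -> 'I_N}.
  pose pr' (p : {ffun 'I_n -> 'I_Mc} * {ffun 'I_n -> 'I_N}) := [ffun a => (p.1 a, p.2 a)].
  have prK : cancel pr' pr.
    by move=> [c z]; rewrite /pr /pr'; congr (_, _); apply/ffunP => a; rewrite !ffunE.
  have prK' : cancel pr pr'.
    by move=> cz; rewrite /pr /pr'; apply/ffunP => a; rewrite !ffunE /=; case: (cz a).
  rewrite (reindex pr'); last by exists pr => p _; [exact: prK|exact: prK'].
  rewrite -(pair_big xpredT xpredT (fun c z0 => #|[set z : {ffun 'I_n -> 'I_N} |
     hit kappa (fun a => (pr' (c, z0) a).1) (fun a => if a \in A then (pr' (c, z0) a).2 : nat else z a)]|%:R)) /=.
  rewrite /Vn card_prod !card_ord natrM exprMn.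
  apply: le_trans (_ : \sum_(c : {ffun 'I_n -> 'I_Mc}) (#|[set z : {ffun 'I_n -> 'I_N} |
     hit kappa (val_ c) (val_ z)]|%:R *+ (N ^ n)) <= _); last first.
    rewrite sumrMnl -[_ *+ (N ^ n)]mulr_natr natrX ler_pM2r // mulrA; exact: mean_hits_le.
  apply: ler_sum => c _; rewrite le_eqVlt; apply/orP; left; apply/eqP.
  have cardE (P : pred {ffun 'I_n -> 'I_N}) : #|[set z | P z]|%:R = \sum_z (P z)%:R :> K.
    by rewrite -sum1_card natr_sum big_mkcond /=; apply: eq_bigr => z _; rewrite inE; case: (P z).
  pose F (z : {ffun 'I_n -> 'I_N}) : K := (hit kappa (val_ c) (val_ z))%:R.
  have := sum_ffun_mix A F; rewrite !card_ord => mixE; rewrite cardE -mixE.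
  apply: eq_bigr => z0 _; rewrite cardE; apply: eq_bigr => z _; congr ((hit _ _ _)%:R).
    by apply/funext => a; rewrite ffunE.
  by apply/funext => a; rewrite !ffunE /=; case: ifP.
- move=> x1 hx1; exists x1 => y.
  have ey : enc y \in [set enc y | y in point] by apply/imsetP; exists y.
  have := hx1 _ ey; rewrite /g; case: pickP => [y' /eqP e|/(_ y)]; last by rewrite eqxx.
  rewrite (regE _ _ e) /B1 => le; apply: le_trans le.
  rewrite le_eqVlt; apply/orP; left; apply/eqP; apply: eq_bigr => kappa _.
  apply: eq_bigr => A _; congr (_%:R / _); apply: eq_card => z; rewrite !inE.
  by congr (hit _ _ _); apply/funext => a; rewrite !ffunE.
Qed.


(** The value of a phase of cutoff 0 is already drawn, so its entry is a dummy variable that carries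
    the whole tuple and is shared with no other event. *)
Let enc (y : point) : {ffun 'I_n -> bool * point} :=
  [ffun a => if (0 < cut a y)%N then (true, lrep a y) else (false, frep y)].

Let lrepP a (y y' : point) : lrep a y = lrep a y' -> lab a y = lab a y'.
Proof. by move=> /eqP; rewrite eq_canonical => /eqP. Qed.

Let frepP (y y' : point) : frep y = frep y' -> forall a, lab a y = lab a y'.
Proof. by move=> /eqP; rewrite eq_canonical => /eqP/ffunP e a; have := e a; rewrite !ffunE. Qed.

Let encI (y y' : point) : (forall a, lab a y = lab a y') -> enc y = enc y'.
Proof.
move=> e; apply/ffunP => a; rewrite !ffunE (lab_cut (e a)).
have -> : frep y = frep y'.
  by apply/eqP; rewrite eq_canonical; apply/eqP/ffunP => a'; rewrite !ffunE.
suff -> : lrep a y = lrep a y' by [].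
by apply/eqP; rewrite eq_canonical; apply/eqP.
Qed.

Let encP (y y' : point) : enc y = enc y' -> forall a, lab a y = lab a y'.
Proof.
move=> /ffunP e a; have := e a; rewrite !ffunE.
case: ifP => _; case: ifP => _ // -[]; first exact: lrepP.
by move/frepP; apply.
Qed.

Lemma fine_assignment (x1 : 'I_n -> point -> 'I_Mc * 'I_N) :
  (forall y : point, \sum_(kappa in regionA y) \sum_(A : {set 'I_n})
    #|[set z : {ffun 'I_n -> 'I_N} | hit kappa (fun a => (x1 a (vrep a y)).1)
      (fun a => if a \in A then (x1 a (vrep a y)).2 : nat else z a)]|%:R / N%:R ^+ n <= B1) ->
  exists x2 : 'I_n -> bool * point -> 'I_N, forall y kappa : point, kappa \in region y ->
    ~~ hit kappa (fun a => (x1 a (vrep a y)).1)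
      (fun a => if (cut a y == 0)%N then (x1 a (vrep a y)).2 : nat else x2 a (true, lrep a y)).
Proof.
move=> hx1.
have Nn0 : 0 < N%:R ^+ n :> K by rewrite exprn_gt0 // ltr0n.
pose hz (y kappa : point) (z : {ffun 'I_n -> 'I_N}) : bool :=
  hit kappa (fun a => (x1 a (vrep a y)).1)
      (fun a => if a \in [set a | cut a y == 0%N] then (x1 a (vrep a y)).2 : nat else z a).
pose g (e : {ffun 'I_n -> bool * point}) (z : {ffun 'I_n -> 'I_N}) : K :=
  if [pick y | enc y == e] is Some y then \sum_(kappa in region y) (hz y kappa z)%:R else 0.
have regE (y y' : point) : (forall a, lab a y = lab a y') -> region y = region y'.
  move=> e; apply/setP => kappa; rewrite [in LHS]inE [in RHS]inE; apply: eq_existsb => z.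
  by congr (_ && _); apply: eq_forallb => a; rewrite e.
have vrepE a (y y' : point) : lab a y = lab a y' -> vrep a y = vrep a y'.
  by move=> /lab_vlab e; apply/eqP; rewrite eq_canonical; apply/eqP.
pose eps := Num.max B1 (QB * PB).
have eps0 : 0 < eps by rewrite /eps lt_max; apply/orP; right; apply: mulr_gt0.
have := @greedy_choice K n (bool * point)%type 'I_N [set enc y | y in point] g D2 eps; case.
- by rewrite card_ord.
- exact: eps0.
- by move=> e z; rewrite /g; case: pickP => // y _; apply: sumr_ge0.
- move=> a [b y0].
  apply: (@card_fiber_code _ _ _ enc (fun y => [ffun a' => (mod4 (vlab a' y), ucode j l h step w a' (val_ y))]) (fun e => e a == (b, y0))).
  move=> y y'; rewrite !ffunE => /eqP e /eqP e' /ffunP ce; apply: encI => a'.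
  move: e e'; case: ifP => c; case: ifP => c' // [eb ey] [eb' ey'].
  - have el : lab a y = lab a y' by apply: lrepP; rewrite ey ey'.
    have := ce a'; rewrite !ffunE => -[cv cu1 cu2 cu3]; rewrite /label; congr (_, _).
      by apply: (vlabel_code st0 w0 hu' r_step (lab_vlab el)).
    by apply: (ulabel_code st0 w0 hu' r_step (congr1 snd el) c); rewrite /ucode cu1 cu2 cu3.
  - by rewrite -eb in eb'.
  - by rewrite -eb in eb'.
  - by apply: frepP; rewrite ey ey'.
- move=> e _; rewrite /g; case: pickP => [y _|_]; last first.
    by rewrite big1 // mulr_ge0 ?(ltW eps0) // exprn_ge0.
  rewrite exchange_big /= card_ord.
  have cardE (P : pred {ffun 'I_n -> 'I_N}) : \sum_z (P z)%:R = #|[set z | P z]|%:R :> K.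
    by rewrite -sum1_card natr_sum [RHS]big_mkcond /=; apply: eq_bigr => z _; rewrite inE; case: (P z).
  (* Close to [h] walls the coarse choice supplies the bound, with [A] the set of phases of cutoff
     0; elsewhere the bounds for fixed coarse values suffice. *)
  have [/existsP[a a0]|/existsPn nA] := boolP [exists a, cut a y == 0%N].
    apply: (@le_trans _ _ (B1 * N%:R ^+ n)); last by rewrite ler_pM2r // le_max lexx.
    rewrite -ler_pdivrMr //; apply: le_trans (hx1 y); rewrite mulr_suml.
    have sub : region y \subset regionA y.
      apply/subsetP => kappa; rewrite !inE => /existsP[z /andP[/forallP lz az]].
      apply/existsP; exists z; rewrite az /=; apply/andP; split.
        by apply/forallP => b; apply/eqP; apply: lab_vlab; apply/eqP.
      by apply/existsP; exists a; have /eqP/lab_cut -> := lz a.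
    rewrite [leRHS](bigID (fun kappa => kappa \in region y)) /=.
    rewrite (eq_bigl (fun kappa => (kappa \in regionA y) && (kappa \in region y))); last first.
      by move=> kappa; case: (boolP (kappa \in region y)) => [/(subsetP sub) ->|_]; rewrite ?andbF.
    rewrite ler_wpDr //.
      by apply: sumr_ge0 => kappa _; apply: sumr_ge0 => A _; rewrite divr_ge0 // ltW.
    apply: ler_sum => kappa _; rewrite (bigD1 [set a | cut a y == 0%N]) //= ler_wpDr //.
      by apply: sumr_ge0 => A _; rewrite divr_ge0 // ltW.
    by rewrite ler_pM2r ?invr_gt0 // cardE.
  apply: (@le_trans _ _ (QB * PB * N%:R ^+ n)); last by rewrite ler_pM2r // le_max lexx orbT.
  apply: (@le_trans _ _ (\sum_(kappa in region y) (PB * N%:R ^+ n))).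
    apply: ler_sum => kappa _; rewrite cardE.
    rewrite (_ : [set z | hz y kappa z] = [set z : {ffun 'I_n -> 'I_N} | hit kappa (fun a => (x1 a (vrep a y)).1) (val_ z)]); first exact: hits_le.
    apply/setP => z; rewrite !inE /hz; congr (hit _ _ _); apply/funext => a.
    by rewrite inE (negbTE (nA a)).
  rewrite sumr_const -[_ *+ #|_|]mulr_natl -!mulrA ler_pM2r ?mulr_gt0 //.
  by apply: region_le => a; rewrite lt0n nA.
- move=> x2 hx2; exists x2 => y kappa kr.
  have ey : enc y \in [set enc y | y in point] by apply/imsetP; exists y.
  have := hx2 _ ey; rewrite /g; case: pickP => [y' /eqP e|/(_ y)]; last by rewrite eqxx.
  have labE := encP e.
  have epsD : eps * D2.+1%:R ^+ n < 1.
    by rewrite /eps; case: (leP B1 (QB * PB)).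
  (* With all values fixed the mean number of hits is an actual number of hits; being below 1 it is
     0. *)
  move=> /le_lt_trans/(_ epsD) lt1; apply/negP => hk.
  have kr' : kappa \in region y' by rewrite (regE _ _ labE).
  move: lt1; rewrite (bigD1 kappa) //=.
  have -> : hz y' kappa [ffun a => x2 a (enc y a)].
    rewrite /hz; move: hk; congr (is_true (hit _ _ _)); apply/funext => a.
      by rewrite (vrepE a y y').
    rewrite inE ffunE ffunE (vrepE a y y') // (lab_cut (labE a)).
    by case: eqP => // /eqP; rewrite -lt0n => ->.
  by rewrite ltNge lerDl sumr_ge0.
Qed.

Lemma locked_sets (zz : point) : exists I J : {set 'I_n},
  [/\ #|I| = k, #|J| = h, [disjoint I & J],
    forall a, a \in I -> forall y : point, nearby r (val_ zz) (val_ y) -> lab a y = lab a zz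
    & forall a, a \in I :|: J -> forall y : point, nearby r (val_ zz) (val_ y) -> vlab a y = vlab a zz].
Proof.
pose U := [set a | [exists y : point, nearby r (val_ zz) (val_ y) && (vlab a y != vlab a zz)]].
pose W := [set a | [exists y : point, nearby r (val_ zz) (val_ y) &&
  (ulabel j l h step w a (val_ y) != ulabel j l h step w a (val_ zz))]].
have Ucard : (#|U| <= n - l)%N.
  apply: (@leq_trans #|[set i : 'I_n | isv l i]|).
    apply: (card_vunlocked st0 w0 hu' r_step (y := val_ zz)) => a; rewrite inE.
    by move=> /existsP[y /andP[ny /eqP ne]]; exists (val_ y).
  rewrite -(card_ord_interval l (leqnn n)); apply/subset_leq_card/subsetP => i.
  by rewrite !inE /isv => ->; rewrite ltn_ord.
have Wcard : (#|W| <= h)%N.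
  apply: (card_uunlocked st0 w0 hu' r_step wn (y := val_ zz)) => a; rewrite inE.
  by move=> /existsP[y /andP[ny /eqP ne]]; exists (val_ y).
have UE a : a \notin U -> forall y : point, nearby r (val_ zz) (val_ y) -> vlab a y = vlab a zz.
  by rewrite inE => /existsPn nU y ny; have := nU y; rewrite ny /= negbK => /eqP.
have WE a : a \notin W -> forall y : point, nearby r (val_ zz) (val_ y) ->
    ulabel j l h step w a (val_ y) = ulabel j l h step w a (val_ zz).
  by rewrite inE => /existsPn nW y ny; have := nW y; rewrite ny /= negbK => /eqP.
have c1 : (k <= #|~: (U :|: W)|)%N.
  have := cardsC (U :|: W); rewrite card_ord; have [UW _] := leq_card_setU U W; lia.
have [I IUW Ik] := subset_of_card c1.
have c2 : (h <= #|~: U :\: I|)%N.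
  have := cardsD (~: U) I; have := cardsC U; rewrite card_ord.
  have : (#|~: U :&: I| <= #|I|)%N by apply/subset_leq_card/subsetIr.
  lia.
have [J JU Jh] := subset_of_card c2.
have IUW' a : a \in I -> a \notin U /\ a \notin W.
  by move=> /(subsetP IUW); rewrite !inE negb_or => /andP.
exists I, J; split=> //.
- by rewrite disjoint_sym; apply: disjointWl JU _; rewrite disjoints_subset; apply/subsetP => a; rewrite !inE => /andP[].
- by move=> a /IUW'[aU aW] y ny; rewrite /label UE // WE.
- move=> a; rewrite inE => /orP[/IUW'[aU _]|/(subsetP JU)]; first exact: UE.
  by rewrite 2!inE => /andP[_ aU]; apply: UE; move: aU; rewrite inE.
Qed.

Lemma assignment_contradiction : False.
Proof.
have [x1 /fine_assignment[x2 hx2]] := coarse_assignment.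
pose cval a (y : point) : nat := ((x1 a (vrep a y)).1 %% Nc a)%N.
pose fval a (y : point) : nat := if (cut a y == 0)%N then (x1 a (vrep a y)).2 else x2 a (true, lrep a y).
have fvalN a y : (fval a y < N)%N by rewrite /fval; case: ifP => _; apply: ltn_ord.
have cvalE a (y y' : point) : vlab a y = vlab a y' -> cval a y = cval a y'.
  move=> e; rewrite /cval (_ : vrep a y = vrep a y') //.
  by apply/eqP; rewrite eq_canonical; apply/eqP.
have fvalE a (y y' : point) : lab a y = lab a y' -> fval a y = fval a y'.
  move=> e; rewrite /fval (lab_cut e).
  have -> : lrep a y = lrep a y' by apply/eqP; rewrite eq_canonical; apply/eqP.
  suff -> : vrep a y = vrep a y' by [].
  by apply/eqP; rewrite eq_canonical; apply/eqP/lab_vlab.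
pose d (y y' : point) : nat := (\max_i ((y i - y' i) + (y' i - y i)))%N.
have d_le y y' m : (d y y' <= m)%N = nearby m (val_ y) (val_ y').
  apply/bigmax_leqP/forallP => hh i; first by have := hh i isT; lia.
  by move=> _; have := hh i; lia.
have d_refl y : d y y = 0%N by apply/eqP; rewrite -leqn0 d_le near_refl.
have d_tri x y z : (d x z <= d x y + d y z)%N.
  rewrite d_le; apply/forallP => i.
  have /forallP/(_ i)/andP[] : nearby (d x y) (val_ x) (val_ y) by rewrite -d_le.
  have /forallP/(_ i)/andP[] : nearby (d y z) (val_ y) (val_ z) by rewrite -d_le.
  by move: (d x y) (d y z); clear; lia.
(* Values are prescribed only at points near which the label does not change; elsewhere they are
   interpolated with slope the range divided by [r]. *)
pose Cv a := [set y : point | [forall y' : point, nearby r (val_ y) (val_ y') ==> (vlab a y' == vlab a y)]].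
pose Cl a := [set y : point | [forall y' : point, nearby r (val_ y) (val_ y') ==> (lab a y' == lab a y)]].
have extc a : exists f : point -> K, [/\ forall x, 0 <= f x <= (Nc a).-1%:R,
    forall x, x \in Cv a -> f x = (cval a x)%:R
    & forall x y, f x <= f y + (Nc a).-1%:R / r%:R * (d x y)%:R].
  apply: (lipschitz_extension r0 _ d_refl d_tri) => [||x y] //.
    by move=> x _; rewrite ler0n ler_nat -ltnS prednK // /cval ltn_mod Nc0.
  rewrite inE => /forallP/(_ y)/implyP hx _; rewrite d_le => /hx /eqP e.
  by rewrite (cvalE _ _ _ e).
have extf a : exists f : point -> K, [/\ forall x, 0 <= f x <= 1,
    forall x, x \in Cl a -> f x = (fval a x)%:R / N%:R
    & forall x y, f x <= f y + 1 / r%:R * (d x y)%:R].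
  apply: (lipschitz_extension r0 _ d_refl d_tri) => [||x y] //.
    move=> x _; rewrite divr_ge0 // ler_pdivrMr ?ltr0n // mul1r ler_nat ltnW //; exact: fvalN.
  rewrite inE => /forallP/(_ y)/implyP hx _; rewrite d_le => /hx /eqP e.
  by rewrite (fvalE _ _ _ e).
have [cext hc] := choice extc; have [fext hf] := choice extf.
(* In units of the piece length: the coarse part selects a piece, the fine part a position in it.
   The ranges add up to [Nc a], which keeps [xi] in the box. *)
pose xi (y : point) a := cext a y + fext a y.
have xi_box y : box (xi y).
  move=> a; have [h1 _ _] := hc a; have [h2 _ _] := hf a.
  have := h1 y; have := h2 y; rewrite /xi.
  have -> : (Nc a)%:R = (Nc a).-1%:R + 1 :> K by rewrite natr1 prednK.
  by move=> /andP[a1 a2] /andP[a3 a4]; rewrite addr_ge0 // lerD.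
have r0' : 0 < r%:R :> K by rewrite ltr0n.
have xi_lip (y y' : point) : nearby 1 (val_ y) (val_ y') -> forall a, `|xi y a - xi y' a| <= (Nc a)%:R / r%:R.
  move=> ny a; have [_ _ h1] := hc a; have [_ _ h2] := hf a.
  have ny' : nearby 1 (val_ y') (val_ y) by apply/forallP => i; have := forallP ny i; rewrite andbC.
  have step1 : forall u v : point, nearby 1 (val_ u) (val_ v) -> xi u a <= xi v a + (Nc a)%:R / r%:R.
    move=> u v; rewrite -d_le => duv; have := h1 u v; have := h2 u v.
    have du : (d u v)%:R <= 1 :> K by rewrite -(ler_nat K) in duv.
    have e : (Nc a)%:R / r%:R = (Nc a).-1%:R / r%:R + 1 / r%:R :> K.
      by rewrite -mulrDl natr1 prednK.
    have p1 : (Nc a).-1%:R / r%:R * (d u v)%:R <= (Nc a).-1%:R / r%:R :> K.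
      by rewrite ler_piMr // divr_ge0.
    have p2 : 1 / r%:R * (d u v)%:R <= 1 / r%:R :> K by rewrite ler_piMr // divr_ge0.
    rewrite /xi e; lra.
  by rewrite ler_distl; have := step1 _ _ ny; have := step1 _ _ ny'; lra.
pose pt (y : 'I_n -> nat) : point := [ffun i => inord (y i)].
(* In the first [j] directions the test merely meets the boundary conditions: nothing is asked of
   them. *)
pose c (i : 'I_n) (y : {ffun 'I_n -> nat}) : bool :=
  if (i < j)%N then (0 < y i)%N else Phi (xi (pt y)) i * step%:R < (y i)%:R.
have st0' : 0 < step%:R :> K by rewrite ltr0n.
have [z [zM hz]] : exists z : 'I_n -> nat, (forall i, z i <= M)%N /\
  forall i, exists y y' : {ffun 'I_n -> nat}, [/\ forall t, (z t <= y t <= (z t).+1)%N,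
    forall t, (z t <= y' t <= (z t).+1)%N, c i y & ~~ c i y'].
  apply: discrete_miranda => i y yi; rewrite /c yi; case: ifP => // _.
    by rewrite -leNgt mulr_ge0 // ltW // Phi_gt0.
  exact: Phi_lt.
pose zz := pt z.
have ptE (y : 'I_n -> nat) t : (z t <= y t <= (z t).+1)%N -> pt y t = y t :> nat.
  by move=> /andP[_ yt]; rewrite ffunE inordK // ltnS (leq_trans yt) // ltnS.
have zzE t : zz t = z t :> nat by apply: ptE; rewrite leqnn leqnSn.
have close i (y : {ffun 'I_n -> nat}) : (forall t, z t <= y t <= (z t).+1)%N ->
    `|Phi (xi (pt y)) i - Phi (xi zz) i| <= 4^-1.
  move=> hy; apply: Phi_cont => //; apply: xi_lip; apply/forallP => t.
  by rewrite zzE ptE //; have /andP[q1 q2] := hy t; apply/andP; split; move: q1 q2; clear; lia.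
have PhiB (i : 'I_n) : (j <= i)%N -> (z i)%:R - step%:R / 4 <= Phi (xi zz) i * step%:R <
    (z i)%:R + 1 + step%:R / 4.
  move=> ji; have [y [y' [hy hy' cy cy']]] := hz i.
  move: cy cy'; rewrite /c ltnNge ji /= -leNgt => b1 b2.
  have y1 : (y i)%:R <= (z i)%:R + 1 :> K by rewrite natr1 ler_nat; have /andP[] := hy i.
  have y2 : (z i)%:R <= (y' i)%:R :> K by rewrite ler_nat; have /andP[] := hy' i.
  exact: cell_window st0' (close i _ hy) (close i _ hy') y1 y2 b1 b2.
(* The cell that contains the image of [xi zz]. By [PhiB] it is adjacent to the cell of [zz], so the
   choice of values excludes a hit, and yet [xi zz] is one. *)
pose kap i := Num.truncn (Phi (xi zz) i).
have kapP i : (kap i)%:R <= Phi (xi zz) i < (kap i).+1%:R.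
  by apply: truncn_itv; rewrite ltW // Phi_gt0.
have kapM i : (kap i < M.+2)%N.
  rewrite -(ltr_nat K); have /andP[k1 _] := kapP i; apply: le_lt_trans k1 _.
  apply: (@le_lt_trans _ _ (Phi (xi zz) i * step%:R)).
    by rewrite ler_peMr ?(ltW (Phi_gt0 _ _)) // ler1n.
  by apply: lt_trans (Phi_lt _ (xi_box zz)) _; rewrite ltr_nat.
pose kappa : point := [ffun i => Ordinal (kapM i)].
have kE i : kappa i = kap i :> nat by rewrite ffunE.
have adm : admissible kappa zz.
  apply/asboolP; split=> [i ji|i]; last first.
    rewrite kE -ltnS -(ltr_nat K); have /andP[k1 _] := kapP i.
    exact: le_lt_trans k1 (Phi_max _ (xi_box zz)).
  rewrite kE zzE; have /andP[k1 k2] := kapP i; have /andP[p1 p2] := PhiB i ji.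
  have e := divn_eq (z i) step; have lt := ltn_pmod (z i) st0.
  move: e lt; set t := (z i %/ step)%N => e lt.
  have s4 : 4 <= step%:R :> K by rewrite ler_nat.
  have z1 : (z i)%:R + 1 <= (t%:R + 1) * step%:R :> K.
    by rewrite !natr1 -natrM ler_nat; move: e lt; clear; lia.
  have z2 : t%:R * step%:R <= (z i)%:R :> K by rewrite -natrM ler_nat e leq_addr.
  split.
    rewrite -ltnS -(ltr_nat K) -(ltr_pM2r st0') addn1 -addn2 natrD.
    apply: le_lt_trans (_ : Phi (xi zz) i * step%:R < _); first by rewrite ler_pM2r.
    exact: cell_window_upper st0' z1 p2.
  rewrite -ltnS -(ltr_nat K) -(ltr_pM2r st0') addn1 -addn2 natrD.
  have k3 : Phi (xi zz) i * step%:R < ((kap i)%:R + 1) * step%:R by rewrite natr1 ltr_pM2r.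
  exact: cell_window_lower st0' z2 p1 k3.
have reg : kappa \in region zz.
  by rewrite inE; apply/existsP; exists zz; rewrite adm andbT; apply/forallP.
have [I [J [Ik Jh dIJ hI hJ]]] := locked_sets zz.
apply: (negP (hx2 zz kappa reg)); apply/asboolP; exists I, J; split=> //.
have cE (a : 'I_n) : a \in I :|: J -> cext a zz = (cval a zz)%:R.
  move=> aIJ; have [_ hca _] := hc a; rewrite hca //; rewrite inE; apply/forallP => y; apply/implyP => ny.
  by apply/eqP/hJ.
exists (xi zz); split=> // [i|a aI|a aJ].
- by rewrite kE.
- have -> : xi zz a = cext a zz + fext a zz by [].
  rewrite cE ?in_setU ?aI //; congr (_ + _); have [_ hfa _] := hf a; rewrite hfa /fval; first by case: ifP.
  rewrite in_set; apply/forallP => y; apply/implyP => ny.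
  by apply/eqP/hI.
- have -> : xi zz a = cext a zz + fext a zz by [].
  rewrite cE ?in_setU ?aJ ?orbT //; have [/(_ zz)/andP[f1 f2] _ _] := hf a.
  by rewrite lerDl f1 lerD2l f2.
Qed.

End Assignment.

(** * Counting cells *)

Section Counting.
Local Open Scope nat_scope.

Lemma card_family_prod (I T : finType) (F : I -> pred T) : #|family F| = \prod_i #|F i|.
Proof. by rewrite card_family foldrE big_map big_enum. Qed.

(** A union bound over the at most [2 ^ n] sets [X]. The factor [c] stands for a denominator, the
    counts being natural numbers. *)
Lemma card_windows_le (n m c b : nat) (A : {set {ffun 'I_n -> 'I_m}}) (T : pred {set 'I_n})
    (W : {set 'I_n} -> 'I_n -> {set 'I_m}) :
  (forall kappa, kappa \in A -> exists2 X, T X & forall i, kappa i \in W X i) ->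
  (forall X, T X -> (\prod_i #|W X i|) * c <= b) -> #|A| * c <= 2 ^ n * b.
Proof.
move=> hA hb.
have cardW X : #|[set kappa : {ffun 'I_n -> 'I_m} | [forall i, kappa i \in W X i]]| = \prod_i #|W X i|.
  by rewrite -card_family_prod; apply: eq_card => kappa; rewrite inE.
have sub : A \subset \bigcup_(X : {set 'I_n} | T X) [set kappa : {ffun 'I_n -> 'I_m} | [forall i, kappa i \in W X i]].
  apply/fintype.subsetP => kappa /hA[X TX h]; apply/finset.bigcupP; exists X => //.
  by rewrite inE; apply/forallP.
apply: (@leq_trans (\sum_(X : {set 'I_n} | T X) b)).
  apply: leq_trans (leq_mul (subset_leq_card sub) (leqnn c)) _.
  elim/big_rec2: _ => [|X s B TX IH]; first by rewrite cards0.
  apply: leq_trans (leq_mul (leq_card_setU _ _).1 (leqnn c)) _.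
  by rewrite mulnDl leq_add // cardW hb.
rewrite sum_nat_const leq_mul2r; apply/orP; right.
apply: leq_trans (max_card _) _.
by rewrite card_set_ord.
Qed.

Lemma card_window m a c : #|[set x : 'I_m | a <= x + c & x <= a + c]| <= 2 * c + 1.
Proof.
rewrite addn1 -[X in _ <= X]card_ord.
rewrite -(card_in_imset (f := fun x : 'I_m => inord (x + c - a) : 'I_(2 * c).+1)) ?max_card //.
move=> x y; rewrite !inE => /andP[x1 x2] /andP[y1 y2] /(congr1 val) /=.
by rewrite !inordK; [move=> e; apply: val_inj => /=; lia|lia|lia].
Qed.

Lemma card_below m a : #|[set x : 'I_m | x <= a]| <= a.+1.
Proof.
rewrite -[X in _ <= X]card_ord.
rewrite -(card_in_imset (f := fun x : 'I_m => inord x : 'I_a.+1)) ?max_card //.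
by move=> x y; rewrite !inE => xa ya /(congr1 val); rewrite /= !inordK // => e; apply: val_inj.
Qed.

(** About [a / (2 * w)] walls lie below [a], each with a strip of [2 * B + 1] positions. If
    [a + B < w] no wall is within reach; otherwise [w <= 2 * a], which absorbs the one extra
    wall. *)
Lemma card_gap_below m w B a : 2 * B <= w ->
  #|[set x : 'I_m | (gap (2 * w) w x <= B) && (x <= a)]| * w <= 3 * (2 * B + 1) * a.
Proof.
move=> Bw; have [->|w0] := posnP w; first by rewrite muln0.
set A := [set _ | _].
have tight (x : 'I_m) : x \in A -> [/\ x <= a, x %% (2 * w) <= w + B & w <= x %% (2 * w) + B].
  by rewrite inE /gap => /andP[h1 h2]; split=> //; move: h1; clear; lia.
have [small|large] := ltnP (a + B) w.
  rewrite (_ : A = set0) ?cards0 //; apply/setP => x; rewrite [RHS]inE; apply/negP => /tight[h1 _ h3].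
  have := leq_mod x (2 * w); lia.
pose P := (a + B - w) %/ (2 * w).
have le : #|A| <= P.+1 * (2 * B).+1.
  rewrite -[P.+1]card_ord -[(2 * B).+1]card_ord -card_prod.
  pose f (x : 'I_m) := (inord (x %/ (2 * w)), inord (x %% (2 * w) + B - w)) : 'I_P.+1 * 'I_(2 * B).+1.
  rewrite -(card_in_imset (f := f)) ?max_card // => x y /tight[x1 x2 x3] /tight[y1 y2 y3] [].
  have qP (z : 'I_m) : z <= a -> w <= z %% (2 * w) + B -> z %/ (2 * w) < P.+1.
    move=> h1 h2; rewrite ltnS leq_divRL ?muln_gt0 //.
    have := divn_eq z (2 * w); move: (z %/ _ * _) (z %% _) h2 => u v h2 e; move: h1 h2 e; clear; lia.
  move=> /(congr1 val) /= e1 /(congr1 val) /= e2; apply: val_inj => /=.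
  rewrite (divn_eq x (2 * w)) (divn_eq y (2 * w)).
  rewrite !inordK in e1; [|by apply: qP..].
  rewrite !inordK in e2; [|move: y2 y3; clear; lia|move: x2 x3; clear; lia].
  by rewrite e1; congr (_ + _); move: e2 x3 y3; clear; lia.
have : P * (2 * w) <= a + B - w by apply: leq_trunc_div.
move: le; rewrite addn1; move: (2 * B).+1 #|A| => b c le; nia.
Qed.

(** The window meets at most 4 blocks of length [2 * w], and in each block at most [2 * B + 1]
    positions on either side of the wall: this is the 8. *)
Lemma card_gap_window m w B g a : 3 <= w ->
  #|[set x : 'I_m | [&& gap (2 * w) w x <= g + B, g <= gap (2 * w) w x + B,
     a <= x + (2 * w + 3) & x <= a + (2 * w + 3)]]| <= 8 * (2 * B + 1).
Proof.
move=> w3; pose base := (a - (2 * w + 3)) %/ (2 * w).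
have w0 : 0 < 2 * w by lia.
rewrite (_ : 8 * (2 * B + 1) = #|{: 'I_4 * bool * 'I_(2 * B).+1}|); last first.
  by rewrite !card_prod !card_ord card_bool; lia.
pose f (x : 'I_m) := (inord (x %/ (2 * w) - base), x %% (2 * w) < w,
  inord (gap (2 * w) w x + B - g)) : 'I_4 * bool * 'I_(2 * B).+1.
rewrite -(card_in_imset (f := f)) ?max_card // => x y.
have qP (z : 'I_m) : a <= z + (2 * w + 3) -> z <= a + (2 * w + 3) -> base <= z %/ (2 * w) < base + 4.
  move=> h1 h2; rewrite /base; apply/andP; split; first by apply: leq_div2r; move: h1; clear; lia.
  rewrite addnS ltnS.
  apply: (@leq_trans ((a - (2 * w + 3) + 3 * (2 * w)) %/ (2 * w))).
    by apply: leq_div2r; move: h2 w3; clear; lia.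
  by rewrite divnDMl.
rewrite !inE => /and4P[x1 x2 x3 x4] /and4P[y1 y2 y3 y4] [] /(congr1 val) /= e1 e2 /(congr1 val) /= e3.
have /andP[qx1 qx2] := qP _ x3 x4; have /andP[qy1 qy2] := qP _ y3 y4.
rewrite !inordK in e1; [|by move: qy1 qy2; clear; lia|by move: qx1 qx2; clear; lia].
rewrite !inordK in e3; [|by move: y1 y2; clear; lia|by move: x1 x2; clear; lia].
apply: val_inj => /=.
rewrite (divn_eq x (2 * w)) (divn_eq y (2 * w)).
have -> : x %/ (2 * w) = y %/ (2 * w).
  have base_inj (u v : nat) : base <= u -> base <= v -> u - base = v - base -> u = v by clear; lia.
  exact: base_inj e1.
congr (_ + _); move: e2 e3 x2 y2; rewrite /gap; move: (x %% _) (y %% _) => u v; clear; lia.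
Qed.

Section Regions.
Variables (n' j l h step w M : nat) (Kmax : 'I_n'.+1 -> nat).
Local Notation n := n'.+1.
Local Notation val_ y := (fun t => nat_of_ord (y t)).
Hypotheses (jl : j <= l) (ln : l <= n) (step0 : 0 < step) (wn : 2 * (n + 2) <= w).
Hypothesis hu : h <= #|[set i : 'I_n | isu j l i]|.

Let w0 : 0 < w. Proof. lia. Qed.

(** Coordinates from [l] on are known up to a constant from the coarse label, and [h] of the others
    are confined to strips about the walls; each of these saves a factor [w]. *)
Lemma card_regionA (y0 : {ffun 'I_n -> 'I_M.+2}) :
  #|regionA j l h step w Kmax y0| * w ^ h <=
  2 ^ n * \prod_(i < n) (3 * (2 * (n + 2) + 1) * (if i < l then (Kmax i).+1 else 1)).
Proof.
pose W (X : {set 'I_n}) (i : 'I_n) : {set 'I_M.+2} :=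
  if isv l i then [set x : 'I_M.+2 | n * phased l step w ord0 i (val_ y0) <= x + (n + 2)
    & x <= n * phased l step w ord0 i (val_ y0) + (n + 2)]
  else if i \in X then [set x : 'I_M.+2 | (gap (2 * w) w x <= n + 2) && (x <= Kmax i)]
  else [set x : 'I_M.+2 | x <= Kmax i].
apply: (card_windows_le (T := fun X => (X \subset [set i | isu j l i]) && (#|X| == h)) (W := W)).
  move=> kappa; rewrite inE => /existsP[y /and3P[/forallP vy /asboolP[adj km] /existsP[a /eqP a0]]].
  have cr := crowded_cutoff step0 w0 hu a (val_ y).
  have [X Xs Xh] := subset_of_card cr.
  exists X; first by rewrite Xh eqxx andbT; apply: subset_trans Xs _; apply/fintype.subsetP => i; rewrite !inE => /andP[].
  move=> i; rewrite /W; case: ifP => vi.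
    have /eqP/ffunP/(_ i) := vy ord0; rewrite !ffunE vi => e.
    have [] := cell_v step0 w0 hu (r := 0) step0 ord0 adj vi jl; rewrite e => h1 h2.
    by rewrite inE h1 h2.
  case: ifP => iX; last by rewrite inE km.
  rewrite inE km andbT; move/fintype.subsetP: Xs => /(_ i iX); rewrite inE a0 leqn0 => /andP[ui /eqP p0].
  have [] := cell_tight step0 w0 hu (r := 0) step0 a adj ui.
  by rewrite p0 muln0 add0n.
move=> X /andP[/fintype.subsetP Xu /eqP <-].
rewrite -prod_nat_const [X in _ * X]big_mkcond -big_split /=.
apply: leq_prod => i _; rewrite /W /isv; case: (ltnP i l) => il.
  case: (boolP (i \in X)) => iX; last first.
    rewrite muln1; apply: leq_trans (card_below _ _) _; rewrite leq_pmull //; lia.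
  by apply: leq_trans (card_gap_below _ _ wn) _; rewrite leq_mul2l leqnSn orbT.
case: (boolP (i \in X)) => iX.
  by have := Xu _ iX; rewrite inE /isu ltnNge il andbF.
rewrite !muln1; apply: leq_trans (card_window _ _ _) _; lia.
Qed.

(** The [h] coordinates closest to the walls are known up to a constant, the other [l - j - h] of
    their kind only up to a block, whence a factor [w] for each; the first [j] are free. *)
Lemma card_region (y0 : {ffun 'I_n -> 'I_M.+2}) :
  (forall a : 'I_n, 0 < cutoff j l h step w a (val_ y0)) ->
  #|region j l h step w Kmax y0| <=
  2 ^ n * (w ^ (l - j - h) * \prod_(i < n) (11 * (2 * (n + 2) + 1) * (if i < j then (Kmax i).+1 else 1))).
Proof.
move=> cpos; rewrite -[X in X <= _]muln1.
(* Any cell of the region serves as the reference point of the blocks. *)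
have [->|[kap0 k0]] := set_0Vmem (region j l h step w Kmax y0); first by rewrite cards0.
pose s := cutoff j l h step w ord0 (val_ y0).
pose m i := ulabel1 j l h step w ord0 (val_ y0) i.
pose W (X : {set 'I_n}) (i : 'I_n) : {set 'I_M.+2} :=
  if isv l i then [set x : 'I_M.+2 | n * phased l step w ord0 i (val_ y0) <= x + (n + 2)
    & x <= n * phased l step w ord0 i (val_ y0) + (n + 2)]
  else if i < j then [set x : 'I_M.+2 | x <= Kmax i]
  else if i \in X then [set x : 'I_M.+2 | [&& gap (2 * w) w x <= n * m i + (n + 2),
     n * m i <= gap (2 * w) w x + (n + 2),
     kap0 i <= x + (2 * w + 3) & x <= kap0 i + (2 * w + 3)]]
  else [set x : 'I_M.+2 | kap0 i <= x + (2 * w + 3) & x <= kap0 i + (2 * w + 3)].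
apply: (card_windows_le (T := fun X => (X \subset [set i | isu j l i]) && (#|X| == h)) (W := W)).
  move=> kappa; rewrite inE => /existsP[y /andP[/forallP ly /asboolP[adj km]]].
  move: k0; rewrite inE => /existsP[y1 /andP[/forallP ly1 /asboolP[adj1 km1]]].
  have /eqP[vE uE1 uE2 sE] := ly ord0; have /eqP e1 := ly1 ord0.
  have cr := crowded_cutoff step0 w0 hu ord0 (val_ y).
  have [X Xs Xh] := subset_of_card cr.
  exists X; first by rewrite Xh eqxx andbT; apply: subset_trans Xs _; apply/fintype.subsetP => i; rewrite !inE => /andP[].
  move=> i; rewrite /W; case: ifP => vi.
    move/ffunP/(_ i): vE; rewrite !ffunE vi => e.
    have [] := cell_v step0 w0 hu (r := 0) step0 ord0 adj vi jl; rewrite e => h1 h2.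
    by rewrite inE h1 h2.
  case: ltnP => ij; first by rewrite inE km.
  have ui : isu j l i by rewrite /isu ij ltnNge -/(isv l i) vi.
  have eu : ulabel j l h step w ord0 (val_ y) = ulabel j l h step w ord0 (val_ y1).
    by have /eqP/(congr1 snd) /= -> := ly ord0; move/(congr1 snd): (e1) => /= ->.
  have c1 : 0 < cutoff j l h step w ord0 (val_ y) by rewrite sE cpos.
  have c2 : 0 < cutoff j l h step w ord0 (val_ y1) by case: e1 => _ _ _ ->.
  have l1 := cell_loose step0 w0 hu (r := 0) step0 adj adj1 ui eu c1.
  have l2 := cell_loose step0 w0 hu (r := 0) step0 adj1 adj ui (esym eu) c2.
  case: ifP => iX; last by rewrite inE l1 l2.
  rewrite inE l1 l2 !andbT; move/fintype.subsetP: Xs => /(_ i iX); rewrite inE => /andP[_ ps].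
  have [] := cell_tight step0 w0 hu (r := 0) step0 ord0 adj ui.
  have -> : phased l step w ord0 i (val_ y) = m i.
    by rewrite /m -uE1 ffunE ui; apply/esym/minn_idPl.
  by move=> -> ->.
move=> X /andP[/fintype.subsetP Xu /eqP Xh].
rewrite muln1.
have Xq : #|[set i | isu j l i] :\: X| = l - j - h.
  rewrite cardsD (setIidPr _); last by apply/fintype.subsetP.
  by rewrite Xh (card_ord_interval j ln : #|[set i : 'I_n | isu j l i]| = _).
rewrite -Xq -prod_nat_const [X in _ <= X * _]big_mkcond -big_split /=.
apply: leq_prod => i _; rewrite /W /isv !inE /isu.
have [li|il] := leqP l i.
  rewrite (_ : (i < j) = false) ?andbF; last by lia.
  rewrite muln1; apply: leq_trans (card_window _ _ _) _; lia.
case: (ltnP i j) => ij /=.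
  rewrite andbF mul1n; apply: leq_trans (card_below _ _) _; rewrite leq_pmull //; lia.
case: (boolP (i \in X)) => iX /=.
  rewrite mul1n muln1; apply: leq_trans (card_gap_window _ _ _ _ _) _; lia.
rewrite muln1; apply: leq_trans (card_window _ _ _) _; nia.
Qed.

End Regions.

End Counting.

Lemma card_mod_window (Mc q base : nat) : (0 < q)%N -> (q %| Mc)%N ->
  (#|[set c : 'I_Mc | base <= c %% q < base + 4]| * q <= 4 * Mc)%N.
Proof.
move=> q0 /dvdnP[[|p] ->].
  by rewrite mul0n (eq_card0 (A := [set _ | _])) // => -[].
have le : (#|[set c : 'I_(p.+1 * q) | base <= c %% q < base + 4]| <= p.+1 * 4)%N.
  rewrite (_ : (p.+1 * 4)%N = #|{: 'I_p.+1 * 'I_4}|); last by rewrite card_prod !card_ord.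
  pose f (c : 'I_(p.+1 * q)) := (inord (c %/ q), inord (c %% q - base)) : 'I_p.+1 * 'I_4.
  rewrite -(card_in_imset (f := f)) ?max_card // => x y; rewrite !inE => /andP[x1 x2] /andP[y1 y2] [].
  move=> /(congr1 val) /= e1 /(congr1 val) /= e2; apply: val_inj => /=.
  rewrite (divn_eq x q) (divn_eq y q).
  rewrite !inordK ?ltn_divLR ?ltn_ord // in e1.
  rewrite !inordK in e2; [|lia|lia].
  by rewrite e1; congr (_ + _)%N; lia.
by apply: leq_trans (leq_mul le (leqnn q)) _; rewrite [(p.+1 * 4)%N]mulnC mulnA.
Qed.

Lemma card_comp_preim (I J V : finType) (phi : J -> I) (B : {set {ffun J -> V}}) :
  injective phi ->
  (#|[set z : {ffun I -> V} | [ffun t => z (phi t)] \in B]| * #|V| ^ #|J| <= #|B| * #|V| ^ #|I|)%N.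
Proof.
move=> phiI; set A := [set _ | _].
rewrite -!card_ffun -cardsT -[X in (_ <= _ * X)%N]cardsT -!cardsX.
pose f (p : {ffun I -> V} * {ffun J -> V}) : {ffun J -> V} * {ffun I -> V} :=
  ([ffun t => p.1 (phi t)], [ffun a => if [pick t | phi t == a] is Some t then p.2 t else p.1 a]).
have pickE t : [pick t' | phi t' == phi t] = Some t.
  by case: pickP => [t' /eqP/phiI -> //|/(_ t)]; rewrite eqxx.
rewrite -(card_in_imset (f := f) (D := setX A setT)).
  apply/subset_leq_card/subsetP => _ /imsetP[[z b] + ->]; rewrite !inE /= andbT => zA.
  by rewrite zA.
move=> [z b] [z' b'] _ _ [] /ffunP e1 /ffunP e2; congr (_, _); apply/ffunP => x.
  have := e2 x; rewrite !ffunE; case: pickP => // t /eqP <- _.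
  by have := e1 t; rewrite !ffunE.
by have := e2 (phi x); rewrite !ffunE pickE.
Qed.

(** After cancelling the common factors, the value of [g] at index [m] separates the remaining ones
    of the two products. *)
Lemma prod_initial_le (K : realFieldType) (n m : nat) (g : 'I_n -> K) (Q : {set 'I_n}) :
  (forall a, 0 < g a) -> (forall a b : 'I_n, (a <= b)%N -> g a <= g b) -> #|Q| = m ->
  \prod_(a < n | (a < m)%N) g a <= \prod_(a in Q) g a.
Proof.
move=> g0 mono Qm.
have mn : (m <= n)%N by rewrite -Qm -[X in (_ <= X)%N]card_ord max_card.
pose P := [set a : 'I_n | (a < m)%N].
have Pm : #|P| = m.
  by rewrite -[RHS]subn0 -(card_ord_interval 0 mn).
have -> : \prod_(a < n | (a < m)%N) g a = \prod_(a in P) g a.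
  by apply: eq_bigl => a; rewrite inE.
have e : #|P :\: Q| = #|Q :\: P|.
  by apply/eqP; rewrite -(eqn_add2l #|P :&: Q|) cardsID setIC cardsID Pm Qm.
rewrite (big_setID Q) [leRHS](big_setID P) /= setIC ler_wpM2l ?prodr_ge0 // => [a _|]; first exact: ltW.
have [r0|r0] := posnP #|P :\: Q|.
  have r0' := esym e; rewrite r0 in r0'.
  by rewrite (cards0_eq r0) (cards0_eq r0') !big_set0.
have [a0 /setDP[aQ aP]] : exists a0, a0 \in Q :\: P by apply/card_gt0P; rewrite -e.
have lt : (m < n)%N by apply: leq_ltn_trans (ltn_ord a0); move: aP; rewrite inE -leqNgt.
pose G := g (Ordinal lt).
apply: le_trans (_ : \prod_(a in P :\: Q) G <= _).
  apply: ler_prod => a /setDP[aP' _]; rewrite ltW //= mono //=.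
  by move: aP'; rewrite inE => /ltnW.
rewrite prodr_const e -prodr_const.
apply: ler_prod => a /setDP[_ aP']; rewrite ltW ?g0 //= mono //=.
by move: aP'; rewrite inE -leqNgt.
Qed.

From mathcomp Require Import all_classical all_reals all_analysis.
Import numFieldNormedType.Exports.

(** * Lattice points in parallelepipeds *)

Lemma card_interval (K : realFieldType) (N : nat) (P : {set 'I_N}) (a b : K) :
  a <= b -> (forall z, z \in P -> a <= z%:R <= b) -> #|P|%:R <= b - a + 1.
Proof.
move=> ab h; have [->|[z0 z0P]] := set_0Vmem P; first by rewrite cards0; lra.
case: (@arg_minnP _ z0 (mem P) val z0P) => z1 z1P min1.
case: (@arg_maxnP _ z0 (mem P) val z0P) => z2 z2P max2.
have z12 : (z1 <= z2)%N := min1 _ z2P.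
have : (#|P| <= z2 - z1 + 1)%N.
  rewrite cardE -(size_map val) -(size_iota z1 (z2 - z1 + 1)).
  apply: uniq_leq_size; first by rewrite (map_inj_uniq val_inj) enum_uniq.
  move=> y /mapP[z]; rewrite mem_enum => zP ->; rewrite mem_iota.
  by have := min1 z zP; have := max2 z zP; move=> /= ? ?; apply/andP; split; lia.
rewrite -(ler_nat K) natrD natrB // => /le_trans -> //.
by have /andP[? ?] := h _ z1P; have /andP[? ?] := h _ z2P; lra.
Qed.

(** Gaussian elimination on the columns of [A]. The first coordinate ranges over an interval of
    half-width [m%:R] times the pivot, and each slice is a set of the same kind whose minors are
    smaller by the factor of the pivot, so that the pivots cancel. *)
Lemma lattice_count (K : realType) (m k : nat) (A : 'M[K]_(m, k)) (C : K) :
  (forall w : 'cV_k, A *m w = 0 -> w = 0) ->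
  (forall f : 'I_k -> 'I_m, `|\det (rowsub f A)| <= C) ->
  exists N0, forall N, (N0 <= N)%N -> forall t : 'rV[K]_k,
    #|[set z : {ffun 'I_k -> 'I_N} | `[< exists c : 'rV[K]_m,
        (forall i, `|c 0 i| <= 1) /\ \row_i ((z i)%:R / N%:R) = t + c *m A >]]|%:R
    <= (3 * m%:R) ^+ k * C * N%:R ^+ k.
Proof.
elim: k A C => [|k IH] A C inj minor.
  have C1 : 1 <= C.
    have := minor (fun i : 'I_0 => match i with Ordinal _ p => False_rect _ (notF p) end).
    by rewrite det_mx00 normr1.
  exists 0%N => N _ t; rewrite !expr0 mul1r mulr1 (le_trans _ C1) // lern1.
  apply: leq_trans (max_card _) _.
  by rewrite card_ffun !card_ord expn0.
rewrite -[k.+1]/(1 + k)%N in A inj minor *.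
pose a := lsubmx A; pose A' := rsubmx A.
have AE : A = row_mx a A' by rewrite hsubmxK.
have [i0 i0P] : exists i0, a i0 0 != 0.
  apply/existsP; rewrite -[X in is_true X]negbK; apply/negP => /existsPn a0.
  have /(congr1 (fun w : 'cV_(1 + k) => w (lshift k 0) 0)) : (col_mx 1%:M 0 : 'cV[K]_(1 + k)) = 0.
    apply: inj; rewrite AE mul_row_col mulmx0 addr0 mulmx1; apply/matrixP => i j.
    by rewrite ord1 [RHS]mxE; apply/eqP; have := a0 i; rewrite negbK.
  by rewrite col_mxEu !mxE /=; apply/eqP; rewrite oner_eq0.
(* The largest entry is the pivot, so that it bounds the contribution of every row to the first
   coordinate. *)
case: (@arg_maxP _ _ _ i0 xpredT (fun i => `|a i 0|) isT) => i1 _ max1.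
pose p := a i1 0.
have p0 : 0 < `|p| by apply: lt_le_trans (max1 i0 isT); rewrite normr_gt0.
have pn0 : p != 0 by rewrite -normr_gt0.
have m0 : (0 < m)%N by apply: leq_ltn_trans (ltn_ord i1).
pose B : 'M[K]_(m, k) := A' - (p^-1 *: a) *m row i1 A'.
have minorB (f : 'I_k -> 'I_m) : `|\det (rowsub f B)| <= C / `|p|.
  rewrite ler_pdivlMr // mulrC -normrM.
  pose g (i : 'I_(1 + k)) := match fintype.split i with inl _ => i1 | inr j => f j end.
  have -> : p * \det (rowsub f B) = \det (rowsub g A); last exact: minor.
  have -> : rowsub g A = block_mx 1%:M 0 (p^-1 *: rowsub f a) 1%:M *m
      block_mx p%:M (row i1 A') 0 (rowsub f B).
    rewrite mulmx_block !mul1mx !mul0mx !addr0 mul_mx_scalar scalerA mulfV // scale1r.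
    apply/matrixP => i j; rewrite mxE AE /g.
    case: (splitP i) => [i' ei|i' ei]; case: (splitP j) => [j' ej|j' ej].
    - have -> : i = lshift k i' by apply: val_inj.
      have -> : j = lshift k j' by apply: val_inj.
      by rewrite row_mxEl block_mxEul !ord1 [RHS]mxE eqxx.
    - have -> : i = lshift k i' by apply: val_inj.
      have -> : j = rshift 1 j' by apply: val_inj.
      by rewrite row_mxEr block_mxEur ord1 [RHS]mxE.
    - have -> : i = rshift 1 i' by apply: val_inj.
      have -> : j = lshift k j' by apply: val_inj.
      by rewrite row_mxEl block_mxEdl [RHS]mxE.
    - have -> : i = rshift 1 i' by apply: val_inj.
      have -> : j = rshift 1 j' by apply: val_inj.
      rewrite row_mxEr block_mxEdr /B !mxE !big_ord1 !mxE; ring.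
  by rewrite det_mulmx det_lblock det_ublock !det1 !mul1r det_scalar1.
have injB (w : 'cV_k) : B *m w = 0 -> w = 0.
  move=> Bw; pose w0 : 'M[K]_1 := - p^-1 *: (row i1 A' *m w).
  have /inj : A *m col_mx w0 w = 0.
    rewrite AE mul_row_col -[RHS]Bw /B mulmxBl addrC; congr (_ + _).
    by rewrite /w0 -scalemxAr scaleNr -!scalemxAl mulmxA.
  by rewrite -(col_mx0 _ 1 k 1) => /eq_col_mx[].
have [N1 hN1] := IH B (C / `|p|) injB minorB.
(* Beyond [N2] the interval of first coordinates contains at least one grid step per unit bound, so
   the [+ 1] of [card_interval] is absorbed by turning 2 into 3. *)
have [N2 hN2] : exists N2 : nat, (m%:R * `|p|)^-1 <= N2%:R.
  by exists (Num.truncn (m%:R * `|p|)^-1).+1; apply/ltW/truncnS_gt.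
have mp0 : 0 < m%:R * `|p| :> K by rewrite mulr_gt0 // ltr0n.
exists (maxn N1 (maxn N2 1)) => N; rewrite !geq_max => /and3P[leN1 leN2 N0] t.
set Z := [set _ | _].
pose t0 := t 0 (lshift k 0); pose t' := rsubmx t.
pose tt (z0 : 'I_N) := t' + ((z0%:R / N%:R - t0) / p) *: row i1 A'.
pose Q (z0 : 'I_N) := [set z : {ffun 'I_k -> 'I_N} | `[< exists c : 'rV[K]_m,
        (forall i, `|c 0 i| <= 1) /\ \row_i ((z i)%:R / N%:R) = tt z0 + c *m B >]].
pose I := [set z0 : 'I_N | N%:R * (t0 - m%:R * `|p|) <= z0%:R <= N%:R * (t0 + m%:R * `|p|)].
have Nr : 0 < N%:R :> K by rewrite ltr0n.
pose phi (z : {ffun 'I_(1 + k) -> 'I_N}) := (z (lshift k 0), [ffun i => z (rshift 1 i)]).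
have phi_inj : injective phi.
  move=> z y [e1 /ffunP e2]; apply/ffunP => i; case: (splitP i) => j ej.
    by have -> : i = lshift k 0 by apply: val_inj; rewrite /= ej ord1.
  have -> : i = rshift 1 j by apply: val_inj.
  by have := e2 j; rewrite !ffunE.
have sub : phi @: Z \subset [set q | (q.1 \in I) && (q.2 \in Q q.1)].
  apply/fintype.subsetP => _ /imsetP[z zZ ->]; rewrite inE /=.
  move: zZ; rewrite inE => /asboolP[c [c1 ce]].
  have ce0 : (z (lshift k 0))%:R / N%:R = t0 + (c *m a) 0 0.
    have := congr1 (fun w : 'rV_(1 + k) => w 0 (lshift k 0)) ce.
    by rewrite /= AE mul_mx_row [LHS]mxE [RHS]mxE row_mxEl.
  have ce' : \row_i (((phi z).2 i)%:R / N%:R) = t' + c *m A' :> 'rV_k.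
    apply/rowP => i; have := congr1 (fun w : 'rV_(1 + k) => w 0 (rshift 1 i)) ce.
    by rewrite /= AE mul_mx_row [LHS]mxE [RHS]mxE row_mxEr => e; rewrite [LHS]mxE ffunE e [RHS]mxE [X in _ = X + _]mxE.
  apply/andP; split.
    have bnd : `|(c *m a) 0 0| <= m%:R * `|p|.
      rewrite mxE (le_trans (ler_norm_sum _ _ _)) //.
      rewrite -[m in leRHS]card_ord mulr_natl -sumr_const; apply: ler_sum => i _.
      by rewrite normrM -[leRHS]mul1r ler_pM //; apply: max1.
    move: bnd; rewrite ler_norml => /andP[b1 b2].
    have -> : ((phi z).1 \in I) = (N%:R * (t0 - m%:R * `|p|) <= (z (lshift k 0))%:R <= N%:R * (t0 + m%:R * `|p|)).
      by rewrite inE.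
    have -> : (z (lshift k 0))%:R = N%:R * (t0 + (c *m a) 0 0).
      by rewrite -ce0 mulrC divfK // gt_eqF.
    by rewrite !ler_pM2l //; apply/andP; split; lra.
  rewrite inE; apply/asboolP; exists c; split=> //.
  rewrite ce' /tt /B ce0 -addrA; congr (_ + _).
  rewrite mulmxBr mulmxA -scalemxAr addrCA.
  have -> : (c *m a) = ((c *m a) 0 0)%:M by rewrite [LHS]mx11_scalar.
  rewrite -scalemxAl mul_scalar_mx mxE eqxx mulr1n [t0 + _]addrC addrK scalerA.
  by rewrite [p^-1 * _]mulrC subrr addr0.
have leZ : (#|Z| <= \sum_(z0 in I) #|Q z0|)%N.
  rewrite -(card_imset _ phi_inj); apply: leq_trans (subset_leq_card sub) _.
  rewrite -sum1_card (eq_bigl (fun q : 'I_N * _ => (q.1 \in I) && (q.2 \in Q q.1))); last first.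
    by move=> q; rewrite inE.
  rewrite -(pair_big_dep (mem I) (fun z0 z => z \in Q z0) (fun _ _ => 1%N)) /=.
  by apply: leq_sum => z0 _; rewrite sum1_card.
have cI : #|I|%:R <= 3 * m%:R * `|p| * N%:R.
  have ab : N%:R * (t0 - m%:R * `|p|) <= N%:R * (t0 + m%:R * `|p|).
    by rewrite ler_pM2l //; lra.
  have := @card_interval K N I _ _ ab; move=> /(_ _)/le_trans; apply.
    by move=> z; rewrite inE.
  have : 1 <= m%:R * `|p| * N%:R.
    rewrite -ler_pdivrMl // mulr1; apply: le_trans hN2 _; by rewrite ler_nat.
  by move=> ?; lra.
rewrite -(ler_nat K) in leZ; apply: le_trans leZ _.
rewrite natr_sum; apply: le_trans (_ : \sum_(z0 in I) ((3 * m%:R) ^+ k * (C / `|p|) * N%:R ^+ k) <= _).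
  by apply: ler_sum => z0 _; apply: hN1.
have C0 : 0 <= C / `|p|.
  have [f] : exists f : 'I_k -> 'I_m, True by exists (fun=> i1).
  by move=> _; apply: le_trans (minorB f).
rewrite sumr_const -[_ *+ #|_|]mulr_natl.
apply: le_trans (_ : (3 * m%:R * `|p| * N%:R) * ((3 * m%:R) ^+ k * (C / `|p|) * N%:R ^+ k) <= _).
  by rewrite ler_wpM2r // mulr_ge0 ?exprn_ge0 // mulr_ge0 // exprn_ge0 // mulr_ge0.
rewrite !add1n !exprS le_eqVlt; apply/orP; left; apply/eqP.
have pn : `|p| != 0 by rewrite normr_eq0.
by field.
Qed.

Local Open Scope classical_set_scope.
Local Open Scope ring_scope.

(** * Strict differentiability and flat surfaces *)

Section Smooth.
Variable K : realType.

Lemma normrV_le n (x : 'rV[K]_n) e : 0 <= e -> (`|x| <= e) <-> (forall i, `|x 0 i| <= e).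
Proof.
move=> e0; rewrite {1}/Num.Def.normr /= mx_normrE; split=> [h i|h].
  by apply: le_trans h; apply: (le_bigmax _ (fun i : 'I_1 * 'I_n => `|x i.1 i.2|) (0, i)).
by apply/bigmax_leP; split=> // -[i j] _ /=; rewrite ord1.
Qed.

Lemma coord_le_norm n (x : 'rV[K]_n) i : `|x 0 i| <= `|x|.
Proof. by have := (normrV_le x (normr_ge0 x)).1 (lexx _); apply. Qed.

Lemma is_derive_line m n (f : 'rV[K]_m -> 'rV[K]_n) (x v : 'rV[K]_m) (a : 'I_n) (t : K) :
  derivable f (x + t *: v) v ->
  is_derive t 1 (fun s : K => f (x + s *: v) 0 a) ('D_v f (x + t *: v) 0 a).
Proof.
move=> df.
have lim : (fun h : K => h^-1 *: ((fun s : K => f (x + s *: v) 0 a) \o shift t) (h *: 1 : K)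
    - h^-1 *: (f (x + t *: v) 0 a : K)) @ 0^' --> ('D_v f (x + t *: v) 0 a : K).
  have D : (fun h : K => h^-1 *: ((f \o shift (x + t *: v)) (h *: v) - f (x + t *: v))) @ 0^' -->
      'D_v f (x + t *: v) by exact: df.
  have := cvg_comp _ _ D (@coord_continuous K 1 n 0 a _).
  apply: cvg_trans; apply: near_eq_cvg; near=> h => /=.
  rewrite !mxE -scalerBr; congr (_ *: (f _ 0 a - _)).
  by apply/rowP => i; rewrite /shift !mxE /GRing.scale /=; ring.
have lim' : (fun h : K => h^-1 *: (((fun s : K => f (x + s *: v) 0 a) \o shift t) (h *: 1 : K)
    - (f (x + t *: v) 0 a : K))) @ 0^' --> ('D_v f (x + t *: v) 0 a : K).
  by move: lim; under eq_fun do rewrite -scalerBr.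
split; first by apply/cvg_ex; eexists; exact: lim'.
exact: cvg_lim lim'.
Unshelve. all: by end_near.
Qed.

(** The partial derivatives are differentiable, hence continuous; the mean value theorem on the
    segment is applied to each coordinate of [f]. *)
Lemma strict_differentiability m n (U : set 'rV[K]_m) (f : 'rV[K]_m -> 'rV[K]_n) (x0 : 'rV[K]_m) :
  open U -> U x0 -> smooth_on U f -> forall w : K, 0 < w ->
  exists2 rho : K, 0 < rho & forall x x', `|x - x0| < rho -> `|x' - x0| < rho ->
    [/\ U x, U x' & `|f x' - f x - (x' - x) *m jacobian f x0| <= w * `|x' - x|].
Proof.
move=> oU Ux0 sf w w0.
pose e (b : 'I_m) : 'rV[K]_m := delta_mx 0 b.
have df x : U x -> differentiable f x by exact: (sf [::]).
have ce b : {for x0, continuous ('D_(e b) f)}.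
  by apply: differentiable_continuous; exact: (sf [:: e b]).
pose w' := w / m.+1%:R.
have w'0 : 0 < w' by rewrite divr_gt0.
have near_e b : \forall x \near x0, `|'D_(e b) f x - 'D_(e b) f x0| < w'.
  by have /cvgr_distC_lt := ce b; apply.
have nearU : \forall x \near x0, U x by apply: open_nbhs_nbhs.
have /nbhs_ballP[rho /= rho0 hrho] : \forall x \near x0,
    U x /\ forall b, `|'D_(e b) f x - 'D_(e b) f x0| < w'.
  near=> x; split; first by near: x.
  by near: x; apply: filter_forall.
exists rho => // x x' xr x'r.
have ballP z : `|z - x0| < rho -> ball x0 rho z.
  by rewrite -ball_normE /= distrC.
have [Ux _] := hrho x (ballP _ xr); have [Ux' _] := hrho x' (ballP _ x'r).
split=> //; apply/normrV_le; first by rewrite mulr_ge0 // ltW.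
move=> a; pose v := x' - x.
have seg t : t \in `[0, 1] -> `|x + t *: v - x0| < rho.
  rewrite in_itv /= => /andP[t0 t1].
  have -> : x + t *: v - x0 = (1 - t) *: (x - x0) + t *: (x' - x0).
    rewrite /v scalerBl scale1r !scalerBr; apply/rowP => i; rewrite !mxE; ring.
  apply: le_lt_trans (ler_normD _ _) _; rewrite !normrZ !ger0_norm ?subr_ge0 //.
  apply: (@le_lt_trans _ _ (Num.max `|x - x0| `|x' - x0|)); last by rewrite gt_max xr x'r.
  have le1 : `|x - x0| <= Num.max `|x - x0| `|x' - x0| by rewrite le_max lexx.
  have le2 : `|x' - x0| <= Num.max `|x - x0| `|x' - x0| by rewrite le_max lexx orbT.
  by nra.
have [||c c01 ] := @MVT_segment K (fun s => f (x + s *: v) 0 a) (fun s => 'D_v f (x + s *: v) 0 a) 0 1 ler01.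
- move=> t t01; apply: is_derive_line; apply: diff_derivable; apply: df.
  have [] // := hrho _ (ballP _ (seg t _)).
  by move: t01; rewrite !in_itv /= => /andP[/ltW -> /ltW ->].
- apply: derivable_within_continuous => t t01.
  apply: ex_derive; apply: is_derive_line; apply: diff_derivable; apply: df.
  by have [] := hrho _ (ballP _ (seg t t01)).
have xv : x + v = x' by rewrite /v addrC subrK.
rewrite scale1r scale0r addr0 subr0 mulr1 xv => E.
have [Uc hc] := hrho _ (ballP _ (seg c c01)).
have -> : (f x' - f x - (x' - x) *m jacobian f x0) 0 a = (f x' 0 a - f x 0 a) - (v *m jacobian f x0) 0 a.
  by rewrite !mxE.
rewrite E -deriveEjacobian; last exact: df.
have Dlin z : U z -> 'D_v f z 0 a = \sum_b v 0 b * 'D_(e b) f z 0 a.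
  move=> Uz; rewrite deriveEjacobian; last exact: df.
  rewrite mxE; apply: eq_bigr => b _; congr (_ * _).
  rewrite deriveEjacobian; last exact: df.
  by rewrite /e -rowE [RHS]mxE.
rewrite (Dlin _ Uc) (Dlin _ Ux0) -sumrB.
apply: le_trans (ler_norm_sum _ _ _) _.
apply: le_trans (_ : \sum_(b < m) w' * `|x' - x| <= _).
  apply: ler_sum => b _; rewrite -mulrBr normrM mulrC ler_pM ?normr_ge0 //; last exact: coord_le_norm.
  apply: le_trans (ltW (hc b)); have := coord_le_norm ('D_(e b) f (x + c *: v) - 'D_(e b) f x0) a.
  by rewrite !mxE.
rewrite sumr_const card_ord -mulr_natl mulrA ler_wpM2r // /w' mulrCA ler_piMr ?(ltW w0) //.
by rewrite ler_pdivrMr // mul1r ler_nat.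
Unshelve. all: by end_near.
Qed.

End Smooth.

Section Affine.
Variable K : realType.

Lemma norm_mulmx_le m n (A : 'M[K]_(m, n)) (a : K) (c : 'rV[K]_m) : 0 <= a ->
  (forall i j, `|A i j| <= a) -> `|c *m A| <= m%:R * a * `|c|.
Proof.
move=> a0 hA; apply/normrV_le; first by rewrite !mulr_ge0.
move=> j; rewrite mxE (le_trans (ler_norm_sum _ _ _)) //.
apply: le_trans (_ : \sum_(i < m) a * `|c| <= _).
  by apply: ler_sum => i _; rewrite normrM mulrC ler_pM // coord_le_norm.
by rewrite sumr_const card_ord -[_ *+ m]mulr_natl mulrA.
Qed.

Lemma mx_bounded m n (A : 'M[K]_(m, n)) : exists2 a : K, 0 < a & forall i j, `|A i j| <= a.
Proof.
exists (1 + \sum_i \sum_j `|A i j|).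
  by rewrite ltr_pwDl // sumr_ge0 // => i _; apply: sumr_ge0.
move=> i j; rewrite (bigD1 i) //= (bigD1 j) //=.
have : 0 <= \sum_(j' < n | j' != j) `|A i j'| by apply: sumr_ge0.
have : 0 <= \sum_(i' < m | i' != i) \sum_j `|A i' j| by apply: sumr_ge0 => *; apply: sumr_ge0.
by move=> ? ?; lra.
Qed.

Lemma mulmx_continuous m n (A : 'M[K]_(m, n)) : continuous (fun c : 'rV[K]_m => c *m A).
Proof.
have [a a0 hA] := mx_bounded A.
apply: (@bounded_linear_continuous _ _ _ (mulmxr A)).
apply/linear_boundedP; exists (m%:R * a); split; first exact: num_real.
move=> r /ltW le c /=; apply: le_trans (norm_mulmx_le c (ltW a0) hA) _; by rewrite ler_wpM2r.
Qed.

Lemma affine_differentiable m n (x0 : 'rV[K]_n) (A : 'M[K]_(m, n)) (c : 'rV[K]_m) :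
  differentiable (fun c => x0 + c *m A) c.
Proof.
apply: differentiableD; first exact: differentiable_cst.
by apply: (@linear_differentiable _ _ _ (mulmxr A)); apply: mulmx_continuous.
Qed.

Lemma affine_continuous m n (x0 : 'rV[K]_n) (A : 'M[K]_(m, n)) :
  continuous (fun c : 'rV[K]_m => x0 + c *m A).
Proof. by move=> c; apply: differentiable_continuous; apply: affine_differentiable. Qed.

Lemma derive_affine m n (x0 : 'rV[K]_n) (A : 'M[K]_(m, n)) (v c : 'rV[K]_m) :
  'D_v (fun c => x0 + c *m A) c = v *m A.
Proof.
have dA : differentiable (mulmxr A : 'rV[K]_m -> 'rV[K]_n) c.
  by apply: linear_differentiable; apply: mulmx_continuous.
have -> : (fun c : 'rV[K]_m => x0 + c *m A) = cst x0 + (mulmxr A : 'rV[K]_m -> 'rV[K]_n) by [].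
rewrite deriveD; [|exact: derivable_cst|exact: diff_derivable].
rewrite (derive_cst x0 c v) add0r (deriveE v dA).
by rewrite (diff_lin c (@mulmx_continuous _ _ A : continuous (mulmxr A))).
Qed.

Lemma jacobian_affine m n (x0 : 'rV[K]_n) (A : 'M[K]_(m, n)) (c : 'rV[K]_m) :
  jacobian (fun c => x0 + c *m A) c = A.
Proof.
apply/row_matrixP => i; rewrite rowE -deriveEjacobian; last exact: affine_differentiable.
by rewrite derive_affine rowE.
Qed.

Lemma affine_smooth m n (U : set 'rV[K]_m) (x0 : 'rV[K]_n) (A : 'M[K]_(m, n)) :
  smooth_on U (fun c => x0 + c *m A).
Proof.
move=> vs c _; case: vs => [|v vs]; first exact: affine_differentiable.
suff [w ->] : exists w, iter_derive (v :: vs) (fun c => x0 + c *m A) = cst w.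
  exact: differentiable_cst.
elim: vs v => [|v' vs IH] v.
  by exists (v *m A); apply/funext => d; apply: derive_affine.
have [w ew] := IH v'; exists 0; apply/funext => d; rewrite /= -/(iter_derive (v' :: vs) _) ew.
exact: derive_cst.
Qed.

Lemma affine_surface k n (U : set 'rV[K]_k) (x0 : 'rV[K]_n) (A : 'M[K]_(k, n)) :
  open U -> row_free A -> surface k ((fun c => x0 + c *m A) @` U).
Proof.
move=> oU fA p Sp; exists setT, U, (fun c => x0 + c *m A); split=> //; first exact: openT.
  split; [exact: affine_smooth|by move=> c _; rewrite jacobian_affine|].
  exists (fun y => - x0 *m pinvmx A + y *m pinvmx A); last first.
    by apply: continuous_subspaceT; apply: affine_continuous.
  move=> c _; rewrite mulmxDl addrA -mulmxDl addNr mul0mx add0r -mulmxA.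
  by rewrite mulmxVp // mulmx1.
by rewrite setIT.
Qed.

End Affine.

(** * Hausdorff content and minors of the inverse Jacobian *)

Section Content.
Variable K : realType.

Lemma edist_le n (x y : 'rV[K]_n) (s : K) : `|x - y| <= s -> Defs.edist x y <= n%:R * s.
Proof.
move=> h; have s0 : 0 <= s by apply: le_trans h.
have hi i : (x ord0 i - y ord0 i) ^+ 2 <= s ^+ 2.
  have := coord_le_norm (x - y) i; rewrite !mxE => hc.
  by rewrite -[leLHS]real_normK ?num_real // lerXn2r ?nnegrE // (le_trans hc).
rewrite /Defs.edist; apply: le_trans (_ : Num.sqrt ((n%:R * s) ^+ 2) <= _); last first.
  by rewrite sqrtr_sqr ger0_norm // mulr_ge0.
apply: ler_wsqrtr; apply: le_trans (ler_sum _ (fun i _ => hi i)) _.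
rewrite sumr_const card_ord -[_ *+ n]mulr_natl exprMn ler_wpM2r ?exprn_ge0 //.
by rewrite -natrX ler_nat; case: n {x y h hi} => // n; rewrite expnS expn1 leq_pmulr.
Qed.

Lemma coord_le_edist n (x y : 'rV[K]_n) i : `|x 0 i - y 0 i| <= Defs.edist x y.
Proof.
rewrite -sqrtr_sqr; apply: ler_wsqrtr.
by rewrite (bigD1 i) //= lerDl; apply: sumr_ge0 => j _; apply: sqr_ge0.
Qed.

Lemma ediam_ge0 n (E : set 'rV[K]_n) : (0 <= ediam E)%E.
Proof. by rewrite /ediam le_max lexx. Qed.

Lemma ediam_le n (E : set 'rV[K]_n) (d : K) : 0 <= d ->
  (forall x y, E x -> E y -> Defs.edist x y <= d) -> (ediam E <= d%:E)%E.
Proof.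
move=> d0 h; rewrite /ediam ge_max lee_fin d0 /=.
by apply: ge_ereal_sup => _ [x Ex [y Ey <-]]; rewrite lee_fin h.
Qed.

Lemma edist_le_ediam n (E : set 'rV[K]_n) x y : E x -> E y -> ((Defs.edist x y)%:E <= ediam E)%E.
Proof.
move=> Ex Ey; rewrite /ediam le_max; apply/orP; right.
by apply: ereal_sup_ubound; exists x => //; exists y.
Qed.

Lemma ediam_exp_le n (E : set 'rV[K]_n) (d : K) k : 0 <= d ->
  (ediam E <= d%:E)%E -> (ediam E ^+ k <= (d ^+ k)%:E)%E.
Proof.
move=> d0 le; have := ediam_ge0 E; case: (ediam E) le => [r| |] //.
by rewrite !lee_fin => rd r0; rewrite -EFin_expe lee_fin lerXn2r.
Qed.

(** Cutting the cube into [N ^ k] small cubes gives images of diameter at most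
    [2 * n%:R * rho / N%:R]. The sum of the powers is independent of [N], so every [delta] is
    reached. *)
Lemma content_cube_le n k (F : 'rV[K]_k -> 'rV[K]_n) (rho delta : K) :
  (0 < k)%N -> 0 < rho -> 0 < delta ->
  (forall c c' : 'rV[K]_k, (forall a, 0 < c 0 a < rho) -> (forall a, 0 < c' 0 a < rho) ->
     `|F c - F c'| <= 2 * `|c - c'|) ->
  (hausdorff_content k delta (F @` [set c : 'rV[K]_k | forall a, (0 < c 0 a < rho)%R])
     <= ((2 * n%:R * rho) ^+ k)%:E)%E.
Proof.
move=> k0 rho0 delta0 lip.
pose N := (Num.truncn (2 * n%:R * rho / delta)).+1.
have N0 : 0 < N%:R :> K by [].
pose d := 2 * n%:R * rho / N%:R.
have d0 : 0 <= d by rewrite /d !mulr_ge0 ?invr_ge0 // ltW.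
have dd : d <= delta.
  by rewrite /d ler_pdivrMr // [delta * _]mulrC -ler_pdivrMr //; apply/ltW; rewrite /N truncnS_gt.
pose sub (z : {ffun 'I_k -> 'I_N}) := [set c : 'rV[K]_k | (forall a, 0 < c 0 a < rho) /\
  forall a, (z a)%:R * (rho / N%:R) <= c 0 a <= ((z a)%:R + 1) * (rho / N%:R)].
pose s := enum {ffun 'I_k -> 'I_N}.
pose z0 : {ffun 'I_k -> 'I_N} := [ffun=> ord0].
pose E i := if (i < size s)%N then F @` sub (nth z0 s i) else set0.
have dE i : (ediam (E i) <= d%:E)%E.
  apply: ediam_le => // x y; rewrite /E; case: ifP => // _ [c [c1 c2] <-] [c' [c1' c2'] <-].
  have -> : d = n%:R * (2 * (rho / N%:R)) by rewrite /d; field; rewrite gt_eqF.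
  apply: edist_le; apply: le_trans (lip _ _ c1 c1') _; rewrite ler_wpM2l //.
  apply/normrV_le; first by rewrite divr_ge0 // ltW.
  move=> a; rewrite !mxE ler_norml; have /andP[? ?] := c2 a; have /andP[? ?] := c2' a.
  by apply/andP; split; lra.
have E0 i : (0 <= ediam (E i) ^+ k)%E by rewrite expe_ge0 // ediam_ge0.
apply: le_trans (ereal_inf_lbound _) _.
  exists E; last exact: erefl.
  split; last by move=> i; apply: le_trans (dE i) _; rewrite lee_fin.
  move=> _ [c c1 <-].
  have hz (a : 'I_k) : (Num.truncn (c 0 a / (rho / N%:R))%R < N)%N.
    have /andP[ca0 ca] := c1 a; rewrite truncn_lt_nat; last by rewrite divr_ge0 // ?divr_ge0 // ltW.
    by rewrite invf_div mulrA ltr_pdivrMr // mulrC ltr_pM2l.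
  pose z : {ffun 'I_k -> 'I_N} := [ffun a => Ordinal (hz a)].
  have zs : z \in s by rewrite mem_enum.
  exists (index z s) => //; rewrite /E index_mem zs nth_index //.
  exists c => //; split=> // a; rewrite ffunE /=.
  have p0 : 0 < rho / N%:R by rewrite divr_gt0.
  have /andP[ca0 ca] := c1 a.
  have /andP[] := truncn_itv (divr_ge0 (ltW ca0) (ltW p0)).
  rewrite ler_pdivlMr // ltr_pdivrMr // => -> /ltW; by rewrite -natr1.
rewrite (nneseries_split 0 (size s)) // add0n.
rewrite [X in (_ + X)%E]eseries0; last first.
  move=> i si _; rewrite /E ltnNge si /=.
  (* Past the list the cover is empty; the [maxe 0] in [ediam] makes these diameters 0, and [0 ^+ k]
     is 0 as [k] is positive. *)
  have -> : ediam (set0 : set 'rV[K]_n) = 0%E.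
    by apply/le_anti; rewrite ediam_ge0 andbT; apply: ediam_le.
  by rewrite -(prednK k0) expeS mul0e.
rewrite adde0; apply: le_trans (_ : (\sum_(0 <= i < size s) (d ^+ k)%:E <= _)%E).
  by apply: lee_sum => i _; apply: ediam_exp_le.
rewrite sumEFin lee_fin big_const_nat subn0 iter_addr addr0 -[_ *+ _]mulr_natl.
rewrite -cardE card_ffun !card_ord natrX -exprMn.
rewrite le_eqVlt; apply/orP; left; apply/eqP; congr (_ ^+ _).
by rewrite /d; field; rewrite gt_eqF.
Qed.

End Content.

Lemma norm_det_rowsub_le (K : realDomainType) k (A : 'M[K]_k) (f : 'I_k -> 'I_k) :
  `|\det (rowsub f A)| <= `|\det A|.
Proof.
have -> : rowsub f A = rowsub f 1%:M *m A by rewrite mul_rowsub_mx mul1mx.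
rewrite det_mulmx normrM ler_piMl //.
case: (boolP (injectiveb f)) => [/injectiveP fi|/injectivePn[i1 [i2 i12 f12]]].
  have -> : rowsub f 1%:M = perm_mx (perm fi) :> 'M[K]_k.
    by apply/matrixP => i j; rewrite !mxE permE.
  by rewrite det_perm normrX normrN1 expr1n.
rewrite (determinant_alternate i12) ?normr0 // => j.
by rewrite !mxE f12.
Qed.

Section Minor.
Variable K : realType.

(** Volumes are compared on the [N ^ k] points of a grid in the middle cube: the preimage of a box
    under [G] is a parallelepiped, to which [lattice_count] applies. Rescaling the middle cube, of
    side [rho / 2], to the unit cube turns 3 into 6. *)
Lemma parallelepiped_cover k (G : 'M[K]_k) (rho : K) (y0 : 'rV[K]_k) (e : nat -> 'rV[K]_k)
    (h : nat -> K) (m : nat) :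
  \det G != 0 -> 0 < rho -> (forall i, 0 < h i) ->
  (forall c : 'rV[K]_k, (forall a, rho / 4 <= c 0 a <= 3 * rho / 4) ->
    exists2 i, (i < m)%N & forall a, `|(y0 + c *m G) 0 a - e i 0 a| <= h i) ->
  `|\det G| * rho ^+ k <= (6 * k%:R) ^+ k * \sum_(i < m) h i ^+ k.
Proof.
move=> G0 rho0 h0 cov.
have uG : G \in unitmx by rewrite unitmxE unitfE.
have nG : 0 < `|\det G| by rewrite normr_gt0.
pose A i := (2 * h i / rho) *: invmx G.
have r0 i : 0 < 2 * h i / rho by rewrite divr_gt0 // mulr_gt0.
have injA i (w : 'cV_k) : A i *m w = 0 -> w = 0.
  move=> /eqP; rewrite -scalemxAl scaler_eq0 gt_eqF //= => /eqP e0.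
  by rewrite -[w](mulKVmx uG) e0 mulmx0.
pose C i := (2 * h i / rho) ^+ k / `|\det G|.
have minorA i (f : 'I_k -> 'I_k) : `|\det (rowsub f (A i))| <= C i.
  apply: le_trans (norm_det_rowsub_le _ _) _.
  by rewrite detZ det_inv normrM normrV ?unitfE // normrX ger0_norm // ltW.
have [N0 hN0] := choice (fun i => lattice_count (injA i) (minorA i)).
pose N := (\max_(i < m) N0 i).+1.
have NN (i : 'I_m) : (N0 i <= N)%N by apply: leqW; apply: (leq_bigmax i).
have Np : 0 < N%:R :> K by [].
pose t i : 'rV[K]_k := (2 / rho) *: ((e i - y0) *m invmx G - const_mx (rho / 4)).
pose P i := [set z : {ffun 'I_k -> 'I_N} | `[< exists c : 'rV[K]_k,
        (forall a, `|c 0 a| <= 1) /\ \row_a ((z a)%:R / N%:R) = t i + c *m A i >]]%SET.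
have PP i : (i < m)%N -> #|P i|%:R <= (3 * k%:R) ^+ k * C i * N%:R ^+ k.
  by move=> im; apply: (hN0 i N (NN (Ordinal im))).
have zP (z : {ffun 'I_k -> 'I_N}) : exists i : 'I_m, z \in P i.
  pose c : 'rV[K]_k := \row_a (rho / 4 + rho / 2 * ((z a)%:R / N%:R)).
  have [a|i im hi] := cov c.
    have : 0 <= (z a)%:R / N%:R :> K by rewrite divr_ge0.
    have : (z a)%:R / N%:R <= 1 :> K by rewrite ler_pdivrMr // mul1r ler_nat ltnW.
    by rewrite mxE => ? ?; apply/andP; split; nra.
  exists (Ordinal im); rewrite inE; apply/asboolP => /=.
  pose v := y0 + c *m G - e i.
  exists ((h i)^-1 *: v); split=> [a|].
    rewrite mxE normrM normfV (gtr0_norm (h0 i)) ler_pdivrMl // mulr1.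
    by have := hi a; rewrite !mxE.
  rewrite /A -scalemxAr -scalemxAl scalerA /t.
  have -> : 2 * h i / rho * (h i)^-1 = 2 / rho by field; rewrite !gt_eqF.
  rewrite -scalerDr /v !mulmxDl !mulNmx -mulmxA mulmxV // mulmx1.
  apply/rowP => a; rewrite !mxE; field; rewrite !gt_eqF //.
have : N%:R ^+ k <= \sum_(i < m) (#|P i|%:R : K).
  rewrite -natrX -natr_sum ler_nat -[k in (_ ^ k)%N]card_ord -[N in (N ^ _)%N]card_ord -card_ffun.
  rewrite -cardsT; apply: leq_trans (_ : #|\bigcup_(i < m) P i|%SET <= _)%N.
    by apply/subset_leq_card/fintype.subsetP => z _; have [i zi] := zP z; apply/finset.bigcupP; exists i.
  elim/big_rec2: _ => [|i u B _ le]; first by rewrite cards0.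
  by rewrite (leq_trans (leq_card_setU _ _)) // leq_add.
move=> /le_trans/(_ (ler_sum _ (fun (i : 'I_m) _ => PP i (ltn_ord i)))).
rewrite -mulr_suml -mulr_sumr -[leLHS]mul1r ler_pM2r ?exprn_gt0 //.
rewrite /C -mulr_suml.
under eq_bigr => i _ do rewrite exprMn exprVn exprMn.
rewrite -mulr_suml -mulr_sumr => le.
have rk : 0 < rho ^+ k by rewrite exprn_gt0.
have -> : (6 * k%:R) ^+ k = (3 * k%:R) ^+ k * 2 ^+ k :> K.
  by rewrite -exprMn; congr (_ ^+ _); ring.
rewrite -ler_pdivlMr // -[leLHS]mulr1 -[leRHS]mulrA.
rewrite -ler_pdivlMl //; apply: le_trans le _.
rewrite le_eqVlt; apply/orP; left; apply/eqP; field.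
by rewrite !gt_eqF.
Qed.

End Minor.

Section Minor.
Variable K : realType.

Lemma sum_geometric_le (rho : K) k m : (0 < k)%N -> 0 < rho ->
  \sum_(i < m) (rho / 2 ^+ i.+1) ^+ k <= rho ^+ k.
Proof.
move=> k0 rho0; apply: le_trans (_ : \sum_(i < m) rho ^+ k / 2 ^+ i.+1 <= _).
  apply: ler_sum => i _; rewrite exprMn ler_pM2l ?exprn_gt0 // exprVn lef_pV2 ?posrE ?exprn_gt0 //.
  by rewrite -exprM ler_weXn2l ?ler1n // leq_pmulr.
rewrite -mulr_sumr ler_piMr ?(ltW (exprn_gt0 _ rho0)) //.
suff -> : \sum_(i < m) (2 ^+ i.+1)^-1 = 1 - (2 ^+ m)^-1 :> K.
  by have : 0 <= (2 ^+ m)^-1 :> K; [rewrite invr_ge0 exprn_ge0|lra].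
elim: m => [|m IH]; first by rewrite big_ord0 expr0 invr1 subrr.
rewrite big_ord_recr /= IH exprS; field.
by rewrite expf_neq0.
Qed.

Lemma exprD_le (x y : K) k : 0 <= x -> 0 <= y -> (x + y) ^+ k <= 2 ^+ k * (x ^+ k + y ^+ k).
Proof.
move=> x0 y0; wlog xy : x y x0 y0 / x <= y.
  by move=> wl; case: (leP x y) => [|/ltW]; [exact: wl|rewrite addrC [_ ^+ _ + _]addrC; exact: wl].
apply: le_trans (_ : (2 * y) ^+ k <= _).
  by rewrite lerXn2r ?nnegrE ?addr_ge0 ?mulr_ge0 //; lra.
by rewrite exprMn ler_wpM2l ?exprn_ge0 // lerDr exprn_ge0.
Qed.

(** An almost optimal cover is projected to the coordinates [g] and replaced by slightly larger open
    boxes; compactness of the middle cube leaves finitely many. In [M + 2], near-optimality costs 1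
    and the enlargement 1. *)
Lemma det_le_content k n (A : 'M[K]_(k, n)) (g : 'I_k -> 'I_n) (x0 : 'rV[K]_n) (rho M : K) :
  (0 < k)%N -> 0 < rho -> 0 <= M -> \det (colsub g A) != 0 ->
  (hausdorff_content k 1 ((fun c => x0 + c *m A)%R @` [set c : 'rV[K]_k | forall a, (0 < c 0 a < rho)%R])
     <= (M * rho ^+ k)%:E)%E ->
  `|\det (colsub g A)| <= (12 * k%:R) ^+ k * (M + 2).
Proof.
move=> k0 rho0 M0 G0; set G := colsub g A in G0 *; set Sig := _ @` _ => hc.
have rk : 0 < rho ^+ k by rewrite exprn_gt0.
have [_ [E [covE E1] <-] sumE] : exists2 y, [set (\sum_(0 <= i <oo) (ediam (E i) ^+ k))%E
            | E in [set E : nat -> set 'rV[K]_n |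
                     Sig `<=` \bigcup_i E i /\
                     forall i, (ediam (E i) <= 1%:E)%E]] y & (y < ((M + 1) * rho ^+ k)%:E)%E.
  apply: ereal_inf_lt; apply: le_lt_trans hc _; rewrite lte_fin ltr_pM2r //; lra.
have fin i : ediam (E i) \is a fin_num.
  by rewrite ge0_fin_numE ?ediam_ge0 // (le_lt_trans (E1 i)) // ltry.
pose d i := fine (ediam (E i)).
have dE i : ediam (E i) = (d i)%:E by rewrite fineK.
have d0 i : 0 <= d i by rewrite -lee_fin -dE ediam_ge0.
have sumd m : \sum_(i < m) d i ^+ k <= (M + 1) * rho ^+ k.
  rewrite -lee_fin; apply: le_trans (ltW sumE).
  apply: le_trans (nneseries_lim_ge m _); last by move=> i _ _; rewrite expe_ge0 // ediam_ge0.
  rewrite -sumEFin big_mkord; apply: lee_sum => i _.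
  by rewrite dE -EFin_expe.
pose h i := d i + rho / 2 ^+ i.+1.
have eta0 i : 0 < rho / 2 ^+ i.+1 by rewrite divr_gt0 // exprn_gt0.
have h0 i : 0 < h i by rewrite ltr_wpDl.
pose e i : 'rV[K]_k := \row_a (get (E i)) 0 (g a).
pose O i : set 'rV[K]_k := [set c | forall a, `|((\row_a x0 0 (g a) + c *m G) - e i) 0 a| < h i].
have GE (c : 'rV[K]_k) a : (\row_a x0 0 (g a) + c *m G) 0 a = (x0 + c *m A) 0 (g a).
  by rewrite !mxE; congr (_ + _); apply: eq_bigr => b _; rewrite mxE.
pose Q := [set c : 'rV[K]_k | forall a, c 0 a \in `[rho / 4, 3 * rho / 4]].
have cQ : compact Q.
  by apply: (@rV_compact _ _ (fun=> `[rho / 4, 3 * rho / 4]%classic)) => _; apply: segment_compact.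
have [m covm] : exists m, forall c, Q c -> exists2 i, (i < m)%N & O i c.
  move: cQ; rewrite compact_cover => /(_ nat setT O)[].
  - move=> i _; rewrite openE => c Oc.
    pose u a (c' : 'rV[K]_k) : K := `|((\row_a x0 0 (g a) + c' *m G) - e i) 0 a|.
    suff : \forall c' \near nbhs c, forall a, u a c' < h i by [].
    apply: filter_forall => a.
    have cont : {for c, continuous (u a)}.
      apply: (@continuous_comp _ _ _ (fun c' : 'rV[K]_k => ((\row_a x0 0 (g a) + c' *m G) - e i) 0 a : K) (fun x : K => `|x|)).
        apply: (@continuous_comp _ _ _ (fun c' : 'rV[K]_k => (\row_a x0 0 (g a) + c' *m G) - e i) (fun M : 'rV[K]_k => M 0 a : K)).
          by apply: continuousB; [exact: affine_continuous|exact: cst_continuous].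
        exact: coord_continuous.
      exact: norm_continuous.
    by apply: (cvgr_lt _ cont); exact: Oc.
  - move=> c Qc; have [|i _ Ei] := covE (x0 + c *m A).
      exists c => // a; have := Qc a; rewrite in_itv /= => /andP[? ?]; apply/andP; split; lra.
    exists i => // a.
    have -> : ((\row_a x0 0 (g a) + c *m G) - e i) 0 a = (x0 + c *m A) 0 (g a) - (get (E i)) 0 (g a).
      by rewrite -GE !mxE.
    have Eg : E i (get (E i)) by apply: (getI Ei).
    apply: le_lt_trans (coord_le_edist _ _ _) _.
    apply: (@le_lt_trans _ _ (d i)); last by rewrite ltrDl.
    by rewrite -lee_fin -dE; apply: edist_le_ediam.
  move=> D _ covD; exists (\max_(i <- finmap.enum_fset D) i).+1 => c /covD[i iD Oi].
  by exists i => //; rewrite ltnS; apply: leq_bigmax_seq.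
have := @parallelepiped_cover K k G rho (\row_a x0 0 (g a)) e h m G0 rho0 h0.
move=> H; have {}H : `|\det G| * rho ^+ k <= (6 * k%:R) ^+ k * \sum_(i < m) h i ^+ k.
  apply: H => c hcc; have [i im Oi] := covm c hcc; exists i => // a; apply/ltW.
  by have := Oi a; rewrite [X in `|X| < _]mxE [X in _ + X]mxE.
rewrite -(ler_pM2r rk); apply: le_trans H _.
have -> : (12 * k%:R) ^+ k = (6 * k%:R) ^+ k * 2 ^+ k :> K.
  by rewrite -exprMn; congr (_ ^+ _); ring.
rewrite -!mulrA ler_wpM2l ?exprn_ge0 ?mulr_ge0 //.
apply: le_trans (_ : \sum_(i < m) 2 ^+ k * (d i ^+ k + (rho / 2 ^+ i.+1) ^+ k) <= _).
  by apply: ler_sum => i _; apply: exprD_le => //; apply: ltW.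
rewrite -mulr_sumr ler_wpM2l ?exprn_ge0 // big_split /=.
have := sumd m; have := sum_geometric_le m k0 rho0; lra.
Qed.

Lemma unit_ball_volume_gt0 k : 0 < unit_ball_volume K k.
Proof.
have [N] := ubnP k; elim: N k => // N IH [|[|k]] //= kN.
by rewrite mulr_gt0 ?divr_gt0 ?mulr_gt0 ?pi_gt0 // IH // -ltnS ltnW.
Qed.

(** The bound of [det_le_content] for the content constant [(2 * n%:R) ^+ k] of
    [content_cube_le]. *)
Definition minor_bound (n k : nat) : K := (12 * k%:R) ^+ k * ((2 * n%:R) ^+ k + 2).

(** The surface to test is a small flat parallelepiped at [x0] spanned by rows of the inverse
    Jacobian: [f] maps it almost onto a coordinate cube of side [rho], whose content is at most a
    constant times [rho ^+ k]. By expansion the flat piece has no larger content, which bounds its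
    projections. *)
Lemma expanding_minor_le n k (U : set 'rV[K]_n) (f : 'rV[K]_n -> 'rV[K]_n) (x0 : 'rV[K]_n)
    (r c : 'I_k -> 'I_n) :
  (0 < k)%N -> open U -> U x0 -> smooth_embedding U f -> expanding k U f ->
  `|\det (mxsub r c (invmx (jacobian f x0)))| <= minor_bound n k.
Proof.
move=> k0 oU Ux0 [sf rf _] ef; set L := invmx _.
have MB0 : 0 <= minor_bound n k by rewrite mulr_ge0 ?exprn_ge0 ?mulr_ge0 // addr_ge0 ?exprn_ge0 ?mulr_ge0.
have [->|D0] := eqVneq (\det (mxsub r c L)) 0; first by rewrite normr0.
have uJ : jacobian f x0 \in unitmx by rewrite -row_free_unit rf.
pose A := rowsub r L.
have cA : colsub c A = mxsub r c L by apply/matrixP => i j; rewrite !mxE.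
have fA : row_free A.
  apply/row_freeP; exists (colsub c 1%:M *m invmx (mxsub r c L)).
  rewrite mulmxA mulmx_colsub mulmx1 cA mulmxV // unitmxE unitfE //.
have rinj : injective r.
  move=> i1 i2 r12; apply/eqP; apply: contraNT D0 => i12; apply/eqP.
  by apply: (determinant_alternate i12) => j; rewrite !mxE r12.
have [a a0 ha] := mx_bounded A.
(* So small that the nonlinear error on the flat piece is at most [|z - z'|], which gives the
   Lipschitz constant 2 below. *)
pose w := (k%:R * a)^-1.
have ka0 : 0 < k%:R * a by rewrite mulr_gt0 // ltr0n.
have w0 : 0 < w by rewrite invr_gt0.
have [rho' rho'0 strict] := strict_differentiability oU Ux0 sf w0.
pose rho := rho' / (2 * (k%:R * a)).
have rho0 : 0 < rho by rewrite divr_gt0 // mulr_gt0.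
pose phi (z : 'rV[K]_k) := x0 + z *m A.
pose Q := [set z : 'rV[K]_k | forall a, (0 < z 0 a < rho)%R].
have phir z : Q z -> `|phi z - x0| < rho'.
  move=> Qz; rewrite /phi addrC addKr; apply: le_lt_trans (norm_mulmx_le z (ltW a0) ha) _.
  have : `|z| <= rho.
    apply/normrV_le; [exact: ltW|move=> i; have /andP[z0 zr] := Qz i].
    by rewrite ger0_norm ltW.
  move=> zr; apply: le_lt_trans (_ : k%:R * a * rho < _).
    by rewrite ler_wpM2l // ltW.
  have -> : k%:R * a * rho = rho' / 2 by rewrite /rho; field; rewrite !gt_eqF ?ltr0n.
  lra.
have lip z z' : Q z -> Q z' -> `|f (phi z) - f (phi z')| <= 2 * `|z - z'|.
  move=> Qz Qz'; have [_ _] := strict _ _ (phir _ Qz') (phir _ Qz).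
  have -> : phi z - phi z' = (z - z') *m A.
    by rewrite /phi mulmxBl opprD addrACA subrr add0r.
  set D := f _ - _ => le.
  have -> : D = (D - (z - z') *m A *m jacobian f x0) + (z - z') *m A *m jacobian f x0 by rewrite subrK.
  apply: le_trans (ler_normD _ _) _.
  have l1 : `|D - (z - z') *m A *m jacobian f x0| <= `|z - z'|.
    apply: le_trans le _; rewrite /w ler_pdivrMl //; exact: norm_mulmx_le (ltW a0) ha.
  have l2 : `|(z - z') *m A *m jacobian f x0| <= `|z - z'|.
    apply/normrV_le => // b; rewrite -mulmxA /A mul_rowsub_mx mulVmx //.
    rewrite mxE; have [/existsP[i /eqP ri]|/existsPn no] := boolP [exists i, r i == b].
      rewrite (bigD1 i) //= big1 => [|i' i'i].
        by rewrite !mxE ri eqxx mulr1 addr0; have := coord_le_norm (z - z') i; rewrite !mxE.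
      rewrite !mxE; case: eqP => [ri'|_]; last by rewrite mulr0.
      by move: i'i; rewrite (rinj i' i) ?eqxx // ri.
    rewrite big1 ?normr0 // => i _; rewrite !mxE; have := no i.
    by case: eqP => // _ _; rewrite mulr0.
  by lra.
have oQ : open Q.
  rewrite openE => z Qz.
  suff : \forall z' \near nbhs z, forall i, 0 < (z' : 'rV[K]_k) 0 i < rho by [].
  apply: filter_forall => i.
  have cont : {for z, continuous (fun z : 'rV[K]_k => z 0 i : K)} by exact: coord_continuous.
  have /andP[z0 zr] := Qz i.
  by near=> y; apply/andP; split; near: y; [exact: (cvgr_gt _ cont)|exact: (cvgr_lt _ cont)].
have sub : phi @` Q `<=` U.
  by move=> _ [z Qz <-]; have [] := strict _ _ (phir _ Qz) (phir _ Qz).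
have := ef _ sub (@affine_surface _ k n Q x0 A oQ fA).
(* The normalization of [kvol] cancels. For the flat piece the single scale 1 is used below the
   supremum; its image is bounded at every scale. *)
rewrite /kvol lee_pmul2l //; last by rewrite lte_fin divr_gt0 ?unit_ball_volume_gt0 // exprn_gt0.
move=> le.
have Dk : \det (colsub c A) != 0 by rewrite cA.
rewrite -cA.
apply: (@det_le_content k n A c x0 rho ((2 * n%:R) ^+ k) k0 rho0 _ Dk).
  by rewrite exprn_ge0 // mulr_ge0.
rewrite -exprMn; apply: le_trans (_ : (ereal_sup [set hausdorff_content k delta (phi @` Q) | delta in [set d : K | (0 < d)%R]] <= _)%E).
  by apply: ereal_sup_ubound; exists 1 => //=; rewrite ltr01.
apply: le_trans le _; apply: ge_ereal_sup => _ [delta /= d0 <-].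
rewrite image_comp; exact: content_cube_le.
Unshelve. all: by end_near.
Qed.
End Minor.

(** * Local linearization *)

Section Local.
Variable K : realType.

Lemma det_small_row_le k (B : 'M[K]_k) (b w : K) (i0 : 'I_k) : 1 <= b -> 0 <= w ->
  (forall i j, `|B i j| <= b) -> (forall j, `|B i0 j| <= w) ->
  `|\det B| <= k`!%:R * (w * b ^+ k).
Proof.
move=> b1 w0 hb hw; rewrite (le_trans (ler_norm_sum _ _ _)) //.
apply: le_trans (_ : \sum_(s : 'S_k) w * b ^+ k <= _); last first.
  by rewrite sumr_const card_Sn -[_ *+ k`!]mulr_natl.
apply: ler_sum => s _; rewrite normrM normrX normrN1 expr1n mul1r normr_prod.
rewrite (bigD1 i0) //= ler_pM ?prodr_ge0 //.
apply: le_trans (_ : \prod_(i < k | i != i0) b <= _).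
  by apply: ler_prod => i _; rewrite normr_ge0 hb.
by rewrite prodr_const ler_weXn2l // -[X in (_ <= X)%N]card_ord max_card.
Qed.

Lemma lebesgue_number n (S : set 'rV[K]_n) (rho : 'rV[K]_n -> K) : compact S ->
  (forall x, 0 < rho x) -> exists2 D : seq 'rV[K]_n, {in D, forall x, S x} & exists2 lambda : K,
    0 < lambda & forall x, S x -> exists2 x0, x0 \in D &
      forall x', `|x' - x| < lambda -> `|x' - x0| < rho x0.
Proof.
rewrite compact_cover => cS rho0.
have [||D DS covD] := cS _ S (fun x => ball x (rho x / 2)).
- by move=> x _; apply: ball_open; rewrite divr_gt0.
- by move=> x Sx; exists x => //; apply: ballxx; rewrite divr_gt0.
exists (finmap.enum_fset D); first by move=> x xD; have /set_mem := DS x xD.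
exists (\big[Num.min/1]_(x <- finmap.enum_fset D) (rho x / 2)).
  elim/big_ind: _ => // [a b|x _]; last by rewrite divr_gt0.
  by rewrite lt_min => -> ->.
move=> x Sx; have [x0 x0D /=] := covD x Sx.
rewrite -ball_normE /= => xx0; exists x0 => // x' x'x.
have : `|x' - x| < rho x0 / 2.
  by apply: lt_le_trans x'x _; apply: ge_bigmin_seq.
have := ler_normD (x' - x) (x - x0); rewrite subrKA.
rewrite distrC in xx0; lra.
Qed.


Lemma local_linear_inverse n (U : set 'rV[K]_n) (f : 'rV[K]_n -> 'rV[K]_n) (x0 : 'rV[K]_n) (w : K) :
  open U -> U x0 -> smooth_embedding U f -> 0 < w ->
  exists2 rho : K, 0 < rho & exists2 M : K, 0 < M &
    forall x x', `|x - x0| < rho -> `|x' - x0| < rho ->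
    `|x' - x - (f x' - f x) *m invmx (jacobian f x0)| <= w * `|f x' - f x| /\
    `|f x' - f x| <= M * `|x' - x|.
Proof.
move=> oU Ux0 [sf rf _] w0; set J := jacobian f x0; pose L := invmx J.
have uJ : J \in unitmx by rewrite -row_free_unit rf.
have [a a0 ha] := mx_bounded L; have [b b0 hb] := mx_bounded J.
pose c := n.+1%:R * a; pose d := n.+1%:R * b.
have c0 : 0 < c by rewrite mulr_gt0.
have nle (e : K) (z : 'rV[K]_n) : 0 < e -> n%:R * e * `|z| <= n.+1%:R * e * `|z|.
  by move=> e0; rewrite ler_wpM2r // ler_wpM2r ?(ltW e0) // ler_nat.
have hL (z : 'rV[K]_n) : `|z *m L| <= c * `|z| by apply: le_trans (norm_mulmx_le z (ltW a0) ha) _; apply: nle.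
have hJ (z : 'rV[K]_n) : `|z *m J| <= d * `|z| by apply: le_trans (norm_mulmx_le z (ltW b0) hb) _; apply: nle.
(* The first bound yields [e3], which controls [v] by [D]; the second one then brings the error down
   to [w]. *)
pose t := Num.min (2 * c)^-1 (w / (2 * c * c)).
have t0 : 0 < t by rewrite lt_min invr_gt0 divr_gt0 ?mulr_gt0.
have [rho rho0 strict] := strict_differentiability oU Ux0 sf t0.
exists rho => //; exists (d + t) => [|x x' xr x'r]; first by rewrite addr_gt0 ?mulr_gt0.
have [_ _ le] := strict x x' xr x'r; rewrite -/J in le.
set D := f x' - f x in le *; set v := x' - x in le *.
have tc : c * t <= 2^-1.
  rewrite -ler_pdivlMl //; apply: le_trans (_ : (2 * c)^-1 <= _); first by rewrite ge_min lexx.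
  by rewrite invfM mulrC.
have tw : 2 * c * (c * t) <= w.
  rewrite mulrA -ler_pdivlMl ?mulr_gt0 // mulrC ge_min; apply/orP; right.
  by rewrite mulrC.
have e1 : v - D *m L = - ((D - v *m J) *m L).
  by rewrite [(D - v *m J) *m L]mulmxBl -[v *m J *m L]mulmxA mulmxV // mulmx1 opprB.
have e2 : `|v - D *m L| <= c * t * `|v|.
  by rewrite e1 normrN; apply: le_trans (hL _) _; rewrite -mulrA ler_wpM2l // ltW.
have e3 : `|v| <= 2 * c * `|D|.
  have : `|v| <= `|v - D *m L| + `|D *m L| by rewrite -{1}(subrK (D *m L) v) ler_normD.
  have := hL D; have : c * t * `|v| <= 2^-1 * `|v| by rewrite ler_wpM2r.
  lra.
split.
  apply: le_trans e2 _; apply: le_trans (_ : c * t * (2 * c * `|D|) <= _).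
    by rewrite ler_wpM2l // mulr_ge0 // ltW.
  have := ler_wpM2r (normr_ge0 D) tw; lra.
have : `|D| <= `|D - v *m J| + `|v *m J| by rewrite -{1}(subrK (v *m J) D) ler_normD.
have := hJ v; rewrite mulrDl; lra.
Qed.

(** On the compact set of pairs at distance at least [e] the distance of the images has a positive
    minimum. *)
Lemma inverse_uniform n (S : set 'rV[K]_n) (f : 'rV[K]_n -> 'rV[K]_n) (e : K) :
  compact S -> (forall x, S x -> {for x, continuous f}) ->
  (forall x x', S x -> S x' -> f x = f x' -> x = x') -> 0 < e ->
  exists2 d : K, 0 < d & forall x x', S x -> S x' -> `|f x' - f x| <= d -> `|x' - x| < e.
Proof.
move=> cS cf inj e0; pose P := [set p : 'rV[K]_n * 'rV[K]_n | (S p.1 /\ S p.2) /\ e <= `|p.2 - p.1|].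
have [P0|/set0P P0] := eqVneq P set0.
  exists 1 => // x x' Sx Sx' _; rewrite ltNge; apply/negP => h.
  by have : P (x, x') by []; rewrite P0.
have sub_cont (g : 'rV[K]_n * 'rV[K]_n -> 'rV[K]_n) p : {for p, continuous g} -> {for p, continuous (fun p => `|g p| : K)}.
  by move=> cg; apply: (@continuous_comp _ _ _ g (fun z : 'rV[K]_n => `|z| : K)) => //; apply: norm_continuous.
have cP : compact P.
  apply: (@subclosed_compact _ _ (S `*` S)); last by move=> p [].
    have -> : P = (S `*` S) `&` (fun p : 'rV[K]_n * 'rV[K]_n => `|p.2 - p.1| : K) @^-1` [set y | e <= y].
      by apply/seteqP; split=> p [].
    apply: closedI; first by apply: compact_closed; [exact: norm_hausdorff|exact: compact_setX].
    apply: preimage_closed; last exact: closed_ge.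
    move=> p _; apply: (sub_cont (fun p => p.2 - p.1)).
    by apply: continuousB; [exact: cvg_snd|exact: cvg_fst].
  exact: compact_setX.
have cF : {within P, continuous (fun p => `|f p.2 - f p.1| : K)}.
  apply: continuous_in_subspaceT => p /set_mem[[S1 S2] _].
  apply: (sub_cont (fun p => f p.2 - f p.1)); apply: continuousB.
    by apply: (@continuous_comp _ _ _ snd f); [exact: cvg_snd|exact: cf].
  by apply: (@continuous_comp _ _ _ fst f); [exact: cvg_fst|exact: cf].
have [p /set_mem[[S1 S2] ep] minp] := compact_EVT_min P0 cP cF.
have p0 : 0 < `|f p.2 - f p.1|.
  rewrite normr_gt0 subr_eq0; apply/eqP => fe.
  have := inj _ _ S1 S2 (esym fe) => pe.
  by move: ep; rewrite pe subrr normr0 leNgt e0.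
exists (`|f p.2 - f p.1| / 2); first by rewrite divr_gt0.
move=> x x' Sx Sx' le; rewrite ltNge; apply/negP => h.
have := minp (x, x') (mem_set (conj (conj Sx Sx') h)) => /=.
lra.
Qed.

Definition local_matrix n k (L : 'M[K]_n) (w : K) (phi : 'I_k -> 'I_n) : 'M[K]_(n + k, k) :=
  col_mx (colsub phi L) w%:M.

Lemma local_matrix_minor n k (L : 'M[K]_n) (C : K) : 1 <= C ->
  (forall r c : 'I_k -> 'I_n, `|\det (mxsub r c L)| <= C) ->
  exists2 w : K, 0 < w & forall (phi : 'I_k -> 'I_n) (g : 'I_k -> 'I_(n + k)),
    `|\det (rowsub g (local_matrix L w phi))| <= C.
Proof.
move=> C1 hC; have [a a0 ha] := mx_bounded L.
pose b := a + 1; have b1 : 1 <= b by rewrite lerDr ltW.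
have b0 : 0 < b by apply: lt_le_trans b1.
have w0 : 0 < (k`!%:R * b ^+ k)^-1 by rewrite invr_gt0 mulr_gt0 ?exprn_gt0 // ltr0n fact_gt0.
have wb : (k`!%:R * b ^+ k)^-1 <= b.
  apply: (le_trans _ b1); rewrite invf_le1; last by rewrite -invr_gt0.
  by apply: mulr_ege1; [rewrite ler1n fact_gt0|apply: exprn_ege1; exact: b1].
exists (k`!%:R * b ^+ k)^-1 => // phi g.
have [/existsP[i0]|/existsPn small] := boolP [exists i, (n <= g i)%N]; last first.
  have gP i : {r : 'I_n | g i = lshift k r}.
    have lt : (g i < n)%N by have := small i; rewrite -ltnNge.
    by exists (Ordinal lt); apply: val_inj.
  suff -> : rowsub g (local_matrix L (k`!%:R * b ^+ k)^-1 phi) = mxsub (fun i => sval (gP i)) phi L by [].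
  apply/matrixP => i j; rewrite !mxE; case: (gP i) => r /= ->.
  by rewrite (unsplitK (inl r)) !mxE.
move=> gi0; have gE : exists r, g i0 = rshift n r.
  have lt : (g i0 - n < k)%N by have := ltn_ord (g i0); lia.
  by exists (Ordinal lt); apply: val_inj => /=; lia.
have [r0 er0] := gE.
apply: le_trans C1; apply: le_trans (@det_small_row_le k _ b _ i0 b1 (ltW w0) _ _) _.
- move=> i j; rewrite !mxE; case: (splitP (g i)) => r _; rewrite !mxE.
    by apply: le_trans (ha _ _) _; rewrite lerDl.
  case: eqP => _; rewrite ?mulr1n ?mulr0n ?normr0 ?(ltW b0) //.
  by rewrite ger0_norm // ltW.
- move=> j; rewrite !mxE er0 (unsplitK (inr r0)) !mxE.
  case: eqP => _; rewrite ?mulr1n ?mulr0n ?normr0 ?(ltW w0) //.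
  by rewrite ger0_norm // ltW.
rewrite mulrCA mulVf // gt_eqF // -invr_gt0 //.
Qed.

Lemma local_matrix_inj n k (L : 'M[K]_n) (w : K) (phi : 'I_k -> 'I_n) (z : 'cV[K]_k) :
  0 < w -> local_matrix L w phi *m z = 0 -> z = 0.
Proof.
move=> w0; rewrite mul_col_mx -[0](@col_mx0 K n k 1) => /eq_col_mx[_].
by rewrite mul_scalar_mx => /eqP; rewrite scaler_eq0 gt_eqF //= => /eqP.
Qed.

Definition linearizable n k (S : set 'rV[K]_n) (f : 'rV[K]_n -> 'rV[K]_n) (mb d e : K) (x : 'rV[K]_n) :=
  exists (L : 'M[K]_n) (w : K), [/\ 0 < w,
    forall (phi : 'I_k -> 'I_n) (g : 'I_k -> 'I_(n + k)),
    `|\det (rowsub g (local_matrix L w phi))| <= mb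
    & forall x', S x' -> `|f x' - f x| <= d ->
    `|x' - x| < e /\ `|x' - x - (f x' - f x) *m L| <= w * d].

(* A cell of side [delta] of the target pulls back into a parallelepiped spanned by the rows of
   [local_matrix], whose extra rows [w%:M] absorb the nonlinearity; [minor_bound] bounds its volume
   in every set of [k] coordinates. *)
Lemma local_linearization n k (U S : set 'rV[K]_n) (f : 'rV[K]_n -> 'rV[K]_n) (e : K) :
  (0 < k)%N -> open U -> compact S -> S `<=` U -> smooth_embedding U f -> expanding k U f -> 0 < e ->
  exists2 d0 : K, 0 < d0 & forall d, 0 < d <= d0 -> forall x, S x ->
    linearizable k S f (minor_bound K n k) d e x.
Proof.
move=> k0 oU cS SU ef xf e0.
have C1 : 1 <= minor_bound K n k.
  apply: mulr_ege1; first by rewrite exprn_ege1 // -natrM ler1n muln_gt0.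
  have : 0 <= (2 * n%:R) ^+ k :> K by rewrite exprn_ge0 // mulr_ge0.
  lra.
have pt x : exists rLw : K * 'M[K]_n * K, S x -> [/\ 0 < rLw.1.1, 0 < rLw.2,
    forall (phi : 'I_k -> 'I_n) (g : 'I_k -> 'I_(n + k)),
        `|\det (rowsub g (local_matrix rLw.1.2 rLw.2 phi))| <= minor_bound K n k
    & forall y z, `|y - x| < rLw.1.1 -> `|z - x| < rLw.1.1 ->
      `|z - y - (f z - f y) *m rLw.1.2| <= rLw.2 * `|f z - f y|].
  case: (pselect (S x)) => [Sx|nS]; last by exists (0, 0, 0).
  have [w w0 hw] := @local_matrix_minor n k (invmx (jacobian f x)) _ C1
    (fun r c => expanding_minor_le r c k0 oU (SU _ Sx) ef xf).
  have [rho rho0 [M _ h]] := local_linear_inverse oU (SU _ Sx) ef w0.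
  by exists (rho, invmx (jacobian f x), w) => _; split=> //= y z yr zr; have [] := h y z yr zr.
have [F hF] := choice pt.
pose rho x := if pselect (S x) then (F x).1.1 else 1.
have rho0 x : 0 < rho x by rewrite /rho; case: pselect => // Sx; have [] := hF x Sx.
have [D DS [lambda lambda0 leb]] := lebesgue_number cS rho0.
have cf x : S x -> {for x, continuous f}.
  by move=> Sx; apply: differentiable_continuous; case: ef => sf _ _; apply: (sf [::]); apply: SU.
have inj x x' : S x -> S x' -> f x = f x' -> x = x'.
  by move=> Sx Sx' fe; case: ef => _ _ [g gf _]; rewrite -(gf x) ?fe ?gf //; apply: SU.
have me0 : 0 < Num.min e lambda by rewrite lt_min e0.
have [d0 d00 hd] := inverse_uniform cS cf inj me0.
exists d0 => // d /andP[dp dd] x Sx.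
have [x0 x0D hx0] := leb x Sx; have Sx0 := DS x0 x0D.
have [r0 w0 hm hl] := hF x0 Sx0.
exists (F x0).1.2, (F x0).2; split=> // x' Sx' le.
have := hd x x' Sx Sx' (le_trans le dd); rewrite lt_min => /andP[xe xl]; split=> //.
have rE : rho x0 = (F x0).1.1 by rewrite /rho; case: pselect.
have x0x : `|x - x0| < (F x0).1.1 by rewrite -rE hx0 // subrr normr0.
apply: le_trans (hl _ _ x0x _) _; first by rewrite -rE hx0.
by rewrite ler_wpM2l // ltW.
Qed.

Lemma forward_uniform n k (U S : set 'rV[K]_n) (f : 'rV[K]_n -> 'rV[K]_n) (e : K) :
  (0 < k)%N -> open U -> compact S -> S `<=` U -> smooth_embedding U f -> 0 < e ->
  exists2 d : K, 0 < d & forall x x', S x -> S x' -> `|x' - x| <= d -> `|f x' - f x| <= e.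
Proof.
move=> k0 oU cS SU ef e0.
have pt x : exists rM : K * K, S x -> [/\ 0 < rM.1, 0 < rM.2
    & forall y z, `|y - x| < rM.1 -> `|z - x| < rM.1 -> `|f z - f y| <= rM.2 * `|z - y|].
  case: (pselect (S x)) => [Sx|nS]; last by exists (0, 0).
  have [rho rho0 [M M0 h]] := local_linear_inverse oU (SU _ Sx) ef (ltr01 : (0 : K) < 1).
  by exists (rho, M) => _; split=> //= y z yr zr; have [] := h y z yr zr.
have [F hF] := choice pt.
pose rho x := if pselect (S x) then Num.min (F x).1 (e / (F x).2 / 2) else 1.
have rho0 x : 0 < rho x.
  rewrite /rho; case: pselect => // Sx; have [F1 F2 _] := hF x Sx.
  by rewrite lt_min F1 !divr_gt0.
have [D DS [lambda lambda0 leb]] := lebesgue_number cS rho0.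
exists (lambda / 2) => [|x x' Sx Sx' le]; first by rewrite divr_gt0.
have [x0 x0D hx0] := leb x Sx; have Sx0 := DS x0 x0D.
have [F1 F2 h] := hF x0 Sx0.
have rE : rho x0 = Num.min (F x0).1 (e / (F x0).2 / 2) by rewrite /rho; case: pselect.
have h1 : `|x - x0| < rho x0 by rewrite hx0 // subrr normr0.
have h2 : `|x' - x0| < rho x0 by rewrite hx0 //; lra.
move: h1 h2; rewrite rE !lt_min => /andP[a1 a2] /andP[b1 b2].
apply: le_trans (h _ _ a1 b1) _; rewrite -ler_pdivlMl // mulrC.
have := ler_normD (x' - x0) (x0 - x); rewrite subrKA (distrC x0 x); lra.
Qed.

End Local.

Local Close Scope classical_set_scope.

(** * Hitting probabilities *)

Section Hits.
Variables (K : realType) (n' k h M : nat).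
Local Notation n := n'.+1.
Local Notation choice_ := ({ffun 'I_k -> 'I_n} * {set 'I_n})%type.
Variables (Nc : 'I_n -> nat) (off sg : 'I_n -> K) (f : 'rV[K]_n -> 'rV[K]_n) (S : set 'rV[K]_n) (delta e mb : K).
Definition pos (xi : 'I_n -> K) : 'rV[K]_n := \row_a (off a + sg a * xi a).
Definition cell_coord (xi : 'I_n -> K) (i : 'I_n) : K := f (pos xi) 0 i / delta.
Hypotheses (sg0 : forall a, 0 < sg a) (esg : forall a, e <= sg a) (d0 : 0 < delta) (mb0 : 0 <= mb).
Hypothesis posS : forall xi, box Nc xi -> S (pos xi).
Hypothesis local : forall x, S x -> linearizable k S f mb delta e x.

(** [p.1] enumerates the set [I] of a hit and [p.2] is its set [J]. *)
Definition selection (p : choice_) :=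
  [&& injectiveb p.1, #|p.2| == h & [disjoint [set p.1 t | t : 'I_k] & p.2]].
Definition in_window (base c : 'I_n -> nat) (Q : {set 'I_n}) :=
  [forall (a | a \in Q), (base a <= c a %% Nc a < base a + 4)%N].
(** The bound of [lattice_count] for the proportion of fine values that hit through the coordinates
    [p.1]; the inverse lengths come from measuring positions in units of pieces. *)
Definition density (p : choice_) : K :=
  (3 * (n + k)%:R) ^+ k * (mb * delta ^+ k * \prod_t (sg (p.1 t))^-1).
Local Notation support p := ([set p.1 t | t : 'I_k] :|: p.2).

Let scaled (L : 'M[K]_n) w (phi : 'I_k -> 'I_n) :=
  delta *: (local_matrix L w phi *m diag_mx (\row_t (sg (phi t))^-1)).

Let scaled_inj L w phi (z : 'cV[K]_k) : 0 < w -> scaled L w phi *m z = 0 -> z = 0.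
Proof.
move=> w0; rewrite /scaled -scalemxAl => /eqP; rewrite scaler_eq0 gt_eqF //= -mulmxA => /eqP.
move=> /(local_matrix_inj w0)/matrixP e0; apply/matrixP => t b; have := e0 t b.
rewrite mul_diag_mx !mxE => /eqP; rewrite mulf_eq0 invr_eq0 gt_eqF //= => /eqP -> //.
Qed.

Let scaled_minor L w phi (g : 'I_k -> 'I_(n + k)) :
  `|\det (rowsub g (local_matrix L w phi))| <= mb ->
  `|\det (rowsub g (scaled L w phi))| <= mb * delta ^+ k * \prod_t (sg (phi t))^-1.
Proof.
move=> hm; have -> : rowsub g (scaled L w phi) =
    delta *: (rowsub g (local_matrix L w phi) *m diag_mx (\row_t (sg (phi t))^-1)).
  by rewrite mul_rowsub_mx; apply/matrixP => i t; rewrite !mxE.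
rewrite detZ det_mulmx det_diag !normrM normrX (gtr0_norm d0) normr_prod mulrCA mulrA.
rewrite ler_pM ?mulr_ge0 ?exprn_ge0 ?(ltW d0) ?prodr_ge0 //.
  by rewrite ler_pM2r ?exprn_gt0.
rewrite le_eqVlt; apply/orP; left; apply/eqP; apply: eq_bigr => t _.
by rewrite mxE ger0_norm // invr_ge0 ltW.
Qed.

Lemma density_ge0 p : 0 <= density p.
Proof.
rewrite !mulr_ge0 ?exprn_ge0 ?mulr_ge0 ?(ltW d0) ?prodr_ge0 // => t _.
by rewrite invr_ge0 ltW.
Qed.

(** One position [xi0] in the cell serves as reference. The image of any other is within [delta], so
    its position lies in a parallelepiped about that of [xi0] and differs by less than one piece in
    every coordinate. A union bound over [I] and [J] follows. *)
Lemma card_hit_le (kappa : {ffun 'I_n -> 'I_M.+2}) : exists N0 (base : 'I_n -> nat),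
  forall N, (N0 <= N)%N -> (0 < N)%N -> forall c : 'I_n -> nat,
  #|[set z : {ffun 'I_n -> 'I_N} | hit k h N Nc cell_coord kappa c (fun a => z a)]|%:R <=
  (\sum_(p | selection p) (in_window base c (support p))%:R * density p) * N%:R ^+ n.
Proof.
have dens0 := density_ge0.
have [nohit|/existsNP[xi0 /contrapT[box0 cell0]]] := pselect (forall xi, ~ (box Nc xi /\
    forall i, (kappa i)%:R <= cell_coord xi i < (kappa i).+1%:R)).
  exists 0%N, (fun=> 0%N) => N _ _ c; rewrite (eq_card0 (A := [set _ | _])%SET) ?mulr_ge0 ?exprn_ge0 ?sumr_ge0 //.
    by move=> p _; rewrite mulr_ge0.
  move=> z; rewrite inE; apply/asboolP => -[I [J [_ _ _ [xi [b cell _ _]]]]].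
  exact: (nohit xi).
have [L [w [w0 hm hl]]] := local (posS box0).
have lat (phi : {ffun 'I_k -> 'I_n}) := lattice_count (fun z => @scaled_inj L w phi z w0)
  (fun g => @scaled_minor L w phi g (hm phi g)).
have [N0 hN0] := fin_all_exists lat.
(* If [xi a] lies in piece [c] and within 1 of [xi0 a], then [c] is between [xi0 a - 2] and
   [xi0 a + 1]: four consecutive integers suffice. *)
exists (\max_phi N0 phi), (fun a => Num.truncn (xi0 a - 2)) => N NN Npos c.
pose t0 (phi : {ffun 'I_k -> 'I_n}) : 'rV[K]_k := \row_t (xi0 (phi t) - (c (phi t) %% Nc (phi t))%:R).
pose B (phi : {ffun 'I_k -> 'I_n}) : {set {ffun 'I_k -> 'I_N}} := [set z : {ffun 'I_k -> 'I_N} |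
  `[< exists cc : 'rV[K]_(n + k), (forall i, `|cc 0 i| <= 1) /\
    \row_i ((z i)%:R / N%:R) = t0 phi + cc *m scaled L w phi >]].
pose win (p : choice_) := in_window (fun a => Num.truncn (xi0 a - 2)) c (support p).
pose E (p : choice_) : {set {ffun 'I_n -> 'I_N}} :=
  [set z : {ffun 'I_n -> 'I_N} | [ffun t => z (p.1 t)] \in B p.1].
have N0' : 0 < N%:R :> K by rewrite ltr0n.
have cardE p : selection p -> #|E p|%:R <= density p * N%:R ^+ n.
  move=> /and3P[/injectiveP inj _ _].
  have := card_comp_preim (B p.1) inj; rewrite !card_ord -(ler_nat K) !natrM !natrX => le.
  rewrite -(ler_pM2r (exprn_gt0 k N0')); apply: le_trans le _.
  rewrite mulrAC ler_pM2r ?exprn_gt0 //; apply: hN0.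
  by apply: leq_trans NN; apply: leq_bigmax.
apply: (@le_trans _ K (\sum_(p | selection p && win p) #|E p|%:R)); last first.
  rewrite mulr_suml [leRHS](bigID win) /= ler_wpDr ?sumr_ge0 // => [p _|].
    by apply: mulr_ge0; [apply: mulr_ge0|apply: exprn_ge0].
  by apply: ler_sum => p /andP[sp wp]; rewrite -/(win p) wp mul1r cardE.
have sub : [set z : {ffun 'I_n -> 'I_N} | hit k h N Nc cell_coord kappa c (fun a => z a)]%SET \subset
    \bigcup_(p | selection p && win p) E p.
  apply/fintype.subsetP => z; rewrite inE => /asboolP[I [J [Ik Jh dIJ [xi [bxi cell xiI xiJ]]]]].
  pose phi : {ffun 'I_k -> 'I_n} := [ffun t => enum_val (cast_ord (esym Ik) t)].
  have phiI : injective phi by move=> t t'; rewrite !ffunE => /enum_val_inj/cast_ord_inj.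
  have imI : [set phi t | t : 'I_k]%SET = I.
    apply/setP => a; apply/imsetP/idP => [[t _ ->]|aI]; first by rewrite ffunE enum_valP.
    exists (cast_ord Ik (enum_rank_in aI a)) => //.
    by rewrite ffunE cast_ordK enum_rankK_in.
  have fclose : `|f (pos xi) - f (pos xi0)| <= delta.
    apply/normrV_le => [|i]; first exact: ltW.
    have := cell i; have := cell0 i; rewrite /cell_coord !ler_pdivlMr // !ltr_pdivrMr //.
    rewrite !mxE ler_norml -natr1 => /andP[a1 a2] /andP[a3 a4]; apply/andP; split; lra.
  have [xclose lclose] := hl _ (posS bxi) fclose.
  have near_xi a : `|xi a - xi0 a| < 1.
    have : `|(pos xi - pos xi0) 0 a| < sg a.
      by apply: le_lt_trans (coord_le_norm _ _) _; apply: lt_le_trans xclose _.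
    have -> : (pos xi - pos xi0) 0 a = sg a * (xi a - xi0 a) by rewrite !mxE; ring.
    by rewrite normrM (gtr0_norm (sg0 a)) -ltr_pdivlMl // mulVf // gt_eqF.
  have inwin a : (c a %% Nc a)%:R <= xi a <= (c a %% Nc a)%:R + 1 ->
      (Num.truncn (xi0 a - 2) <= c a %% Nc a < Num.truncn (xi0 a - 2) + 4)%N.
    move: (near_xi a); rewrite ltr_distl => /andP[h1 h2] /andP[h3 h4].
    have [p2|n2] := leP 0 (xi0 a - 2).
      have /andP[t1 t2] := truncn_itv p2.
      apply/andP; split; first by rewrite -(ler_nat K); lra.
      by rewrite -(ltr_nat K) natrD; rewrite -natr1 in t2; lra.
    rewrite (_ : Num.truncn _ = 0%N) /=; last by apply/truncn0Pn; rewrite -ltNge; lra.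
    by rewrite -(ltr_nat K); lra.
  apply/finset.bigcupP; exists (phi, J).
    rewrite /selection /win /= imI dIJ Jh eqxx !andbT; apply/andP; split; first exact/injectiveP.
    apply/forallP => a; apply/implyP; rewrite inE => /orP[aI|/xiJ]; last exact: inwin.
    apply: inwin; rewrite xiI // lerDl divr_ge0 //= lerD2l ler_pdivrMr // mul1r ler_nat ltnW //.
  rewrite inE /= inE; apply/asboolP.
  pose D := f (pos xi) - f (pos xi0).
  pose Y := pos xi - pos xi0 - D *m L.
  (* The displacement of the image in units of [delta], and the nonlinear remainder in units of
     [w * delta]; both have entries at most 1. *)
  exists (row_mx (delta^-1 *: D) ((w * delta)^-1 *: colsub phi Y)); split.
    move=> i; rewrite mxE; case: splitP => i' _; rewrite !mxE normrM gtr0_norm ?invr_gt0 ?mulr_gt0 //.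
      by rewrite ler_pdivrMl // mulr1; apply: le_trans fclose; have := coord_le_norm D i'; rewrite !mxE.
    rewrite ler_pdivrMl ?mulr_gt0 // mulr1; apply: le_trans lclose.
    by have := coord_le_norm Y (phi i'); rewrite !mxE.
  have -> : row_mx (delta^-1 *: D) ((w * delta)^-1 *: colsub phi Y) *m scaled L w phi =
      \row_t (xi (phi t) - xi0 (phi t)).
    rewrite /scaled -scalemxAr mulmxA /local_matrix mul_row_col mul_mx_scalar -scalemxAl.
    have -> : D *m colsub phi L = colsub phi (D *m L) by rewrite mulmx_colsub.
    apply/rowP => t; rewrite mul_mx_diag !mxE -/D.
    have s0 := sg0 (phi t).
    field.
    by rewrite !gt_eqF.
  apply/rowP => t; rewrite !mxE ffunE xiI ?ffunE; first by ring.
  by rewrite enum_valP.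
apply: (@le_trans _ K #|\bigcup_(p | selection p && win p) E p|%:R).
  by rewrite ler_nat subset_leq_card.
elim/big_rec2: _ => [|p s C _ IH]; first by rewrite cards0.
apply: le_trans (_ : (#|E p| + #|C|)%:R <= _); first by rewrite ler_nat leq_card_setU.
by rewrite natrD lerD2l.
Qed.

End Hits.

Section Prob.
Variables (K : realType) (n' j l k h M : nat).
Local Notation n := n'.+1.
Local Notation choice_ := ({ffun 'I_k -> 'I_n} * {set 'I_n})%type.
Variables (S : 'I_n -> K) (sigma : K).
Hypotheses (jk : (j < k)%N) (khl : (k + h = l)%N) (ln : (l <= n)%N).
Hypotheses (S0 : forall a, 0 < S a) (Smono : forall a b : 'I_n, (a <= b)%N -> S a <= S b).
Hypotheses (sigma0 : 0 < sigma) (S_low : forall a : 'I_n, (a < j)%N -> S a <= sigma)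
  (S_high : forall a : 'I_n, (j <= a)%N -> sigma <= S a).

(* Pieces of length at most [sigma], and comparable to it when the side is long enough. *)
Definition pieces (a : 'I_n) : nat := (Num.truncn (S a / (2 * sigma))).+1.
(** The pieces fill only the middle half of a side, whence the 2: positions stay in a compact part
    of the source. *)
Definition piece_length (a : 'I_n) : K := S a / (2 * (pieces a)%:R).
Local Notation Nc := pieces.
Local Notation sg := piece_length.

Lemma pieces_ge a : S a / (2 * sigma) <= (pieces a)%:R.
Proof.
have /truncn_itv/andP[_ h1] : 0 <= S a / (2 * sigma) by rewrite divr_ge0 // ?mulr_ge0 // ltW.
exact: ltW.
Qed.

Lemma piece_length_gt0 a : 0 < piece_length a.
Proof. by rewrite divr_gt0 // mulr_gt0 // ltr0n. Qed.

Lemma piece_length_pieces a : piece_length a * (pieces a)%:R = S a / 2.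
Proof. by rewrite /piece_length; field; rewrite pnatr_eq0. Qed.

Lemma piece_length_ge a : Num.min (S a) sigma / 3 <= piece_length a.
Proof.
have S0a := S0 a; have N0 : 0 < (pieces a)%:R :> K by rewrite ltr0n.
rewrite /piece_length ler_pdivlMr ?mulr_gt0 //.
have [h1|h1] := leP (S a) sigma.
  rewrite (_ : pieces a = 1%N); first by lra.
  rewrite /pieces; congr _.+1; apply/truncn0Pn; rewrite -ltNge ltr_pdivrMr ?mulr_gt0 //; lra.
have /truncn_itv/andP[h2 _] : 0 <= S a / (2 * sigma) by rewrite divr_ge0 // ?mulr_ge0 // ltW.
have h3 : (pieces a)%:R <= S a / (2 * sigma) + 1 by rewrite /pieces -natr1 lerD2r.
have h4 : S a / (2 * sigma) * sigma = S a / 2 by field; rewrite gt_eqF.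
have h5 : (pieces a)%:R * sigma <= (S a / (2 * sigma) + 1) * sigma by rewrite ler_pM2r.
by rewrite mulrDl h4 in h5; lra.
Qed.

Lemma prod_min : \prod_(a < n | (a < k)%N) Num.min (S a) sigma =
  \prod_(a < n | (a < j)%N) S a * sigma ^+ (k - j).
Proof.
have kn : (k <= n)%N by lia.
rewrite (bigID (fun a : 'I_n => (a < j)%N)) /=; congr (_ * _).
  rewrite (eq_bigl (fun a : 'I_n => (a < j)%N)) => [|a]; last by rewrite andb_idl // => /ltn_trans; apply.
  by apply: eq_bigr => a aj; rewrite min_l // S_low.
rewrite (eq_bigr (fun=> sigma)) => [|a /andP[_ aj]]; last by rewrite min_r // S_high // leqNgt.
rewrite prodr_const; congr (_ ^+ _).
rewrite -(card_ord_interval j kn); apply: eq_card => i.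
by rewrite [RHS]inE unfold_in -leqNgt andbC.
Qed.

Variables (mb delta : K).
Hypotheses (mb0 : 0 <= mb) (d0 : 0 < delta).
Local Notation dens := (@density K n' k sg delta mb).
Local Notation supp p := ([set p.1 t | t : 'I_k]%SET :|: p.2).

(** There are at most [n ^ n * 2 ^ n] selections. The factor [18 * n] bounds [3 * (n + k)] from
    [lattice_count] times 3 from [piece_length_ge]; 8 is a window of 4 pieces times the 2 of the
    half sides. *)
Definition prob_const : K := (n ^ n * 2 ^ n * (18 * n) ^ n * 8 ^ n)%:R * mb.

Let npow (x m : nat) : (0 < x)%N -> (m <= n)%N -> (x ^ m <= x ^ n)%N.
Proof. by move=> x0 mn; rewrite leq_pexp2l. Qed.

Let kn : (k <= n)%N. Proof. lia. Qed.

Lemma card_selection : (#|[set p : choice_ | selection h p]| <= n ^ n * 2 ^ n)%N.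
Proof.
apply: leq_trans (max_card _) _.
rewrite card_prod card_ffun !card_ord leq_mul ?npow //.
by rewrite card_set_ord.
Qed.

Lemma sum_selection_le (F : choice_ -> K) (b : K) : 0 <= b ->
  (forall p, selection h p -> F p <= (18 * n%:R) ^+ n * 8 ^+ n * mb * b) ->
  \sum_(p | selection h p) F p <= prob_const * b.
Proof.
move=> b0 hF; apply: le_trans (ler_sum _ hF) _.
rewrite sumr_const -[_ *+ _]mulr_natl /prob_const !natrM !natrX natrM.
set X := (18 * _) ^+ n.
have X0 : 0 <= X by rewrite exprn_ge0 // mulr_ge0.
have c : #|selection h (k := k) (n' := n')|%:R <= n%:R ^+ n * 2 ^+ n :> K.
  rewrite -!natrX -natrM ler_nat; apply: leq_trans card_selection.
  by apply: eq_leq; apply: eq_card => p; rewrite inE.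
apply: le_trans (_ : n%:R ^+ n * 2 ^+ n * (X * 8 ^+ n * mb * b) <= _); last first.
  by rewrite !mulrA.
by rewrite ler_wpM2r // !mulr_ge0 ?exprn_ge0.
Qed.

Let prod_im (p : choice_) (F : 'I_n -> K) : injective p.1 ->
  \prod_t F (p.1 t) = \prod_(a in [set p.1 t | t : 'I_k]%SET) F a.
Proof. by move=> inj; rewrite big_imset //=; move=> t t' _ _; apply: inj. Qed.

Let card_im (p : choice_) : injective p.1 ->
  #|[set p.1 t | t : 'I_k]%SET| = k.
Proof. by move=> inj; rewrite card_imset // card_ord. Qed.

Let pow_le (x : K) m : 1 <= x -> (m <= n)%N -> x ^+ m <= x ^+ n.
Proof. by move=> x1 mn; rewrite ler_weXn2l. Qed.

(** The worst [k] coordinates are those of the shortest pieces, and the piece lengths are comparable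
    to the minimum of the side and [sigma]. *)
Lemma density_fine p : selection h p ->
  dens p <= (18 * n%:R) ^+ n * 8 ^+ n * mb *
    (delta ^+ k / (\prod_(a < n | (a < j)%N) S a * sigma ^+ (k - j))).
Proof.
move=> /and3P[/injectiveP inj _ _]; rewrite /density -prod_min.
have g0 a : 0 < Num.min (S a) sigma by rewrite lt_min S0.
have h1 : \prod_t (sg (p.1 t))^-1 <= 3 ^+ k / \prod_(a < n | (a < k)%N) Num.min (S a) sigma.
  apply: (@le_trans _ _ (\prod_(a in [set p.1 t | t : 'I_k]%SET) (3 / Num.min (S a) sigma))).
    rewrite (prod_im (fun a => (sg a)^-1) inj); apply: ler_prod => a _; rewrite invr_ge0 ltW ?piece_length_gt0 //=.
    rewrite -[3 / _]invf_div lef_pV2 ?posrE ?piece_length_gt0 ?divr_gt0 //.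
    exact: piece_length_ge.
  rewrite big_split /= prodr_const card_im // prodfV ler_pM2l ?exprn_gt0 //.
  rewrite lef_pV2 ?posrE ?prodr_gt0 //.
  apply: prod_initial_le => //; last exact: card_im.
  move=> a b ab; rewrite le_min ge_min Smono //= ge_min lexx orbT //.
have n1 : 1 <= n%:R :> K by rewrite ler1n.
have h2 : (3 * (n + k)%:R) ^+ k * 3 ^+ k <= (18 * n%:R) ^+ n :> K.
  rewrite -exprMn; apply: (@le_trans _ _ ((18 * n%:R) ^+ k)); last by apply: pow_le => //; lra.
  rewrite lerXn2r ?nnegrE ?mulr_ge0 // natrD.
  have : k%:R <= n%:R :> K by rewrite ler_nat.
  lra.
have h3 : 1 <= 8 ^+ n :> K by rewrite exprn_ege1 // ler1n.
set P := \prod_(a < n | (a < k)%N) _ in h1 *.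
have P0 : 0 < P by apply: prodr_gt0.
have D0 : 0 < delta ^+ k by rewrite exprn_gt0.
apply: (@le_trans _ _ ((3 * (n + k)%:R) ^+ k * (mb * delta ^+ k * (3 ^+ k / P)))).
  by rewrite ler_wpM2l ?exprn_ge0 ?mulr_ge0 // ler_wpM2l // mulr_ge0 // ltW.
rewrite (_ : _ * _ = (3 * (n + k)%:R) ^+ k * 3 ^+ k * (mb * (delta ^+ k / P))); last by ring.
rewrite -[leRHS]mulrA ler_wpM2r ?mulr_ge0 ?invr_ge0 ?(ltW D0) ?(ltW P0) //.
by rewrite -[leLHS]mulr1 ler_pM // mulr_ge0 ?exprn_ge0 ?mulr_ge0.
Qed.

Variable Mc : nat.
Hypothesis NcMc : forall a, (pieces a %| Mc)%N.

Lemma card_in_window base (Q : {set 'I_n}) :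
  #|[set c : {ffun 'I_n -> 'I_Mc} | in_window pieces base (fun a => c a) Q]|%:R <=
  Mc%:R ^+ n * \prod_(a in Q) (4 / (pieces a)%:R) :> K.
Proof.
pose F a : pred 'I_Mc := fun c => (a \in Q) ==> (base a <= c %% pieces a < base a + 4)%N.
have -> : #|[set c : {ffun 'I_n -> 'I_Mc} | in_window pieces base (fun a => c a) Q]| = (\prod_a #|F a|)%N.
  rewrite -card_family_prod; apply: eq_card => c; rewrite inE /in_window.
  by apply/forallP/familyP.
rewrite natr_prod [X in _ * X]big_mkcond /=.
rewrite -[X in X ^+ _]/(Mc%:R) -[X in _ ^+ X](card_ord n) -prodr_const -big_split /=.
apply: ler_prod => a _; rewrite ler0n /=; case: (boolP (a \in Q)) => aQ; last first.
  by rewrite mulr1 ler_nat; apply: leq_trans (max_card _) _; rewrite card_ord.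
rewrite mulrA ler_pdivlMr ?ltr0n // -!natrM ler_nat [(Mc * 4)%N]mulnC.
apply: leq_trans (card_mod_window (base a) (ltn0Sn _) (NcMc a)).
rewrite leq_mul2r; apply/orP; right; apply: subset_leq_card; apply/fintype.subsetP => c.
by rewrite inE unfold_in /F aQ.
Qed.

(** On [I] the inverse piece length and the window combine to [8 / S a], as the pieces fill half a
    side; on [J] the window alone gives at most [8 * sigma / S a]. The worst [l] coordinates are
    again the shortest sides. *)
Lemma density_coarse p : selection h p ->
  dens p * \prod_(a in supp p) (4 / (pieces a)%:R) <= (18 * n%:R) ^+ n * 8 ^+ n * mb *
    (delta ^+ k * sigma ^+ h / \prod_(a < n | (a < l)%N) S a).
Proof.
move=> /and3P[/injectiveP inj /eqP Jh dIJ]; rewrite /density (prod_im (fun a => (sg a)^-1) inj).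
set I := [set p.1 t | t : 'I_k]%SET.
have P0 : 0 < \prod_(a < n | (a < l)%N) S a by apply: prodr_gt0.
have D0 : 0 < delta ^+ k by rewrite exprn_gt0.
have s0 : 0 < sigma ^+ h by rewrite exprn_gt0.
have key : (\prod_(a in I) (sg a)^-1) * \prod_(a in I :|: p.2) (4 / (pieces a)%:R) <=
    8 ^+ n * (sigma ^+ h / \prod_(a < n | (a < l)%N) S a).
  have bigIJ (F : 'I_n -> K) : \prod_(a in I :|: p.2) F a = \prod_(a in I) F a * \prod_(a in p.2) F a.
    by rewrite -bigU //; apply: eq_bigl => a; rewrite !inE.
  have Q : #|I :|: p.2| = l.
    rewrite cardsU.
    have /eqP -> : I :&: p.2 == finset.set0 by rewrite setI_eq0.
    by rewrite cards0 subn0 card_im // Jh.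
  rewrite bigIJ [leLHS]mulrA -big_split /=.
  rewrite (eq_bigr (fun a => 8 / S a)) => [|a _]; last first.
    transitivity (8 / (2 * (sg a * (pieces a)%:R))).
      by field; rewrite pnatr_eq0 /= gt_eqF // piece_length_gt0.
    by rewrite piece_length_pieces mulrC [2 * _]mulrC divfK // mulrC.
  apply: (@le_trans _ _ (\prod_(a in I) (8 / S a) * \prod_(a in p.2) (8 / S a * sigma))).
    rewrite ler_wpM2l ?prodr_ge0 // => [a _|]; first by rewrite divr_ge0 // ltW.
    apply: ler_prod => a _; rewrite divr_ge0 //= ler_pdivrMr ?ltr0n //.
    have := pieces_ge a; rewrite ler_pdivrMr ?mulr_gt0 // => h1.
    rewrite -(ler_pM2r (S0 a)) (_ : 8 / S a * sigma * (pieces a)%:R * S a = 8 * sigma * (pieces a)%:R); first by lra.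
    by field; rewrite gt_eqF.
  rewrite [X in _ * X]big_split /= [leLHS]mulrA -(bigIJ (fun a => 8 / S a)) big_split /= !prodr_const Q Jh prodfV.
  rewrite -mulrA ler_pM ?exprn_ge0 //.
  - by rewrite mulr_ge0 ?invr_ge0 ?prodr_ge0 ?(ltW s0) // => a _; apply: ltW.
  - by rewrite pow_le // ler1n.
  rewrite mulrC ler_pM2l // lef_pV2 ?posrE ?prodr_gt0 //.
  exact: prod_initial_le.
have n1 : 1 <= n%:R :> K by rewrite ler1n.
have h2 : (3 * (n + k)%:R) ^+ k <= (18 * n%:R) ^+ n :> K.
  apply: (@le_trans _ _ ((18 * n%:R) ^+ k)); last by apply: pow_le => //; lra.
  rewrite lerXn2r ?nnegrE ?mulr_ge0 // natrD.
  have : k%:R <= n%:R :> K by rewrite ler_nat.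
  lra.
set P := \prod_(a < n | (a < l)%N) _ in P0 key *.
set X := \prod_(a in I) _ in key *; set Y := \prod_(a in _ :|: _) _ in key *.
rewrite [leLHS](_ : _ = (3 * (n + k)%:R) ^+ k * (mb * delta ^+ k * (X * Y))); last by ring.
rewrite [leRHS](_ : _ = (18 * n%:R) ^+ n * (mb * delta ^+ k * (8 ^+ n * (sigma ^+ h / P)))); last by ring.
have X0 : 0 <= X by apply: prodr_ge0 => a _; rewrite invr_ge0 ltW // piece_length_gt0.
have Y0 : 0 <= Y by apply: prodr_ge0 => a _; rewrite divr_ge0.
rewrite ler_pM ?exprn_ge0 ?mulr_ge0 ?(ltW D0) //.
by rewrite ler_wpM2l // mulr_ge0 // ltW.
Qed.

Variables (off : 'I_n -> K) (f : 'rV[K]_n -> 'rV[K]_n) (D : set 'rV[K]_n) (e : K).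
Hypothesis esg : forall a, e <= sg a.
Hypothesis posD : forall xi, box pieces xi -> D (pos off sg xi).
Hypothesis local : forall x, D x -> linearizable k D f mb delta e x.
Local Notation hit N := (hit (M := M) k h N pieces (cell_coord off sg f delta)).

Lemma hit_bounds : exists N0, forall N, (N0 <= N)%N -> (0 < N)%N -> forall kappa,
  (forall c, #|[set z : {ffun 'I_n -> 'I_N} | hit N kappa c (fun a => z a)]|%:R <=
    prob_const * (delta ^+ k / (\prod_(a < n | (a < j)%N) S a * sigma ^+ (k - j))) * N%:R ^+ n) /\
  \sum_(c : {ffun 'I_n -> 'I_Mc})
    #|[set z : {ffun 'I_n -> 'I_N} | hit N kappa (fun a => c a) (fun a => z a)]|%:R <=
    prob_const * (delta ^+ k * sigma ^+ h / \prod_(a < n | (a < l)%N) S a) * Mc%:R ^+ n * N%:R ^+ n.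
Proof.
have hk (kappa : {ffun 'I_n -> 'I_M.+2}) :=
  card_hit_le h piece_length_gt0 esg d0 mb0 posD local kappa.
have [N0 hN0] := fin_all_exists hk.
exists (\max_kappa N0 kappa) => N NN Npos kappa.
have [base hb] := hN0 kappa.
have {}hb := hb N (leq_trans (leq_bigmax kappa) NN) Npos.
have Nn0 : 0 < N%:R ^+ n :> K by rewrite exprn_gt0 // ltr0n.
have dens0 p : 0 <= dens p by apply: density_ge0 => //; apply: piece_length_gt0.
have D0 : 0 < delta ^+ k by rewrite exprn_gt0.
split=> [c|].
  apply: le_trans (hb c) _; rewrite ler_pM2r //; apply: sum_selection_le => [|p sp].
    by rewrite divr_ge0 ?(ltW D0) // mulr_ge0 ?exprn_ge0 ?(ltW sigma0) // prodr_ge0 // => a _; rewrite ltW.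
  apply: le_trans (density_fine sp); rewrite ler_piMl //.
  by case: (in_window _ _ _ _) => //=; rewrite ?ler01 ?lexx.
apply: (@le_trans _ K (\sum_(c : {ffun 'I_n -> 'I_Mc})
    ((\sum_(p : choice_ | selection h p)
      (in_window pieces base (fun a => c a) (supp p))%:R * dens p) * N%:R ^+ n))).
  by apply: ler_sum => c _; apply: hb.
rewrite -mulr_suml ler_pM2r // exchange_big /=.
apply: (@le_trans _ _ (\sum_(p : choice_ | selection h p) (Mc%:R ^+ n * (dens p * \prod_(a in supp p) (4 / (pieces a)%:R))))).
  apply: ler_sum => p _; rewrite -mulr_suml; move: (dens p) (dens0 p) => u u0.
  rewrite [leRHS]mulrCA [leLHS]mulrC ler_wpM2l //.
  apply: le_trans (card_in_window base (supp p)).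
  rewrite -sum1_card natr_sum big_mkcond /= [leRHS]big_mkcond /=.
  apply: ler_sum => c _; rewrite inE.
  by case: (in_window _ _ _ _).
rewrite -mulr_sumr mulrC ler_wpM2r ?exprn_ge0 //.
apply: sum_selection_le => [|p sp]; last exact: density_coarse.
apply/ltW/divr_gt0; first by apply: mulr_gt0 => //; apply: exprn_gt0.
exact: prodr_gt0.
Qed.

End Prob.

Local Open Scope classical_set_scope.
Local Open Scope ring_scope.

(** * Rectangles *)

Section Rectangles.
Variables (K : realType) (n : nat).

Lemma open_rectangle (d : 'I_n -> K) : open (rectangle d).
Proof.
rewrite openE => x hx; rewrite /interior /=.
suff : \forall y \near nbhs x, forall i : 'I_n, 0 < (y : 'rV[K]_n) ord0 i < d i by [].
apply: filter_forall => i.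
have /andP[h1 h2] := hx i.
have c := @coord_continuous K 1 n ord0 i x.
near=> y; apply/andP; split; near: y.
  exact: (c _ (open_nbhs_nbhs (conj (@open_gt K 0) h1))).
exact: (c _ (open_nbhs_nbhs (conj (@open_lt K (d i)) h2))).
Unshelve. all: by end_near.
Qed.

Lemma compact_box (a b : 'I_n -> K) :
  compact [set x : 'rV[K]_n | forall i, a i <= x ord0 i <= b i].
Proof.
have -> : [set x : 'rV[K]_n | forall i, a i <= x ord0 i <= b i] =
    [set x : 'rV[K]_n | forall i, `[a i, b i]%classic (x ord0 i)].
  by apply/seteqP; split=> x /= h i; have := h i; rewrite /= in_itv.
exact: (@rV_compact K n (fun i => `[a i, b i]%classic) (fun i => @segment_compact K _ _)).
Qed.

End Rectangles.

Lemma natr_prod_cells (K : realType) n m c (R : 'I_n -> K) (delta : K) : (m <= n)%N -> 0 < delta ->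
  (forall i, delta <= R i) ->
  (\prod_(i < n) (c * (if i < m then (Num.truncn (R i / delta)).+1 else 1)))%N%:R <=
  (2 * c)%:R ^+ n * (\prod_(i < n | (i < m)%N) R i / delta ^+ m).
Proof.
move=> mn d0 dR.
have -> : delta ^+ m = \prod_(i < n | (i < m)%N) delta.
  rewrite prodr_const; congr (_ ^+ _); apply/esym.
  transitivity #|[set i : 'I_n | (0 <= i < m)%N]%SET|; last by rewrite card_ord_interval // subn0.
  by apply: eq_card => i; rewrite [RHS]inE.
rewrite -prodf_div [X in _ * X]big_mkcond natr_prod /= -[X in _ ^+ X](card_ord n) -prodr_const -big_split /=.
apply: ler_prod => i _; rewrite ler0n /= natrM natrM -mulrA [leRHS]mulrCA ler_wpM2l //.
case: ifP => _; last by lra.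
have R1 : 1 <= R i / delta by rewrite ler_pdivlMr // mul1r.
have /truncn_itv/andP[h _] : 0 <= R i / delta by apply: le_trans R1.
by rewrite -natr1; lra.
Qed.

(** * The constants, and the two counts at one scale *)

Section Core.
Variables (K : realType) (n' : nat).
Local Notation n := n'.+1.

(** Summed over all [k], so that the constant depends on [n] only. *)
Definition minor_const : K := \sum_(k < n.+1) minor_bound K n k.
Definition region_const : nat := 2 ^ n * (2 * (11 * (2 * (n + 2) + 1))) ^ n.

Lemma minor_bound_gt0 k : 0 < minor_bound K n k.
Proof.
rewrite /minor_bound; apply: mulr_gt0.
  by case: k => [|k]; rewrite ?expr0 // exprn_gt0 // mulr_gt0 // ltr0n.
by rewrite ltr_wpDl // exprn_ge0 // mulr_ge0.
Qed.

Lemma minor_bound_le k : (k <= n)%N -> minor_bound K n k <= minor_const.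
Proof.
rewrite -ltnS => kn; rewrite /minor_const (bigD1 (Ordinal kn)) //= lerDl sumr_ge0 // => i _.
exact/ltW/minor_bound_gt0.
Qed.

Lemma minor_const_gt0 : 0 < minor_const.
Proof. exact: lt_le_trans (minor_bound_gt0 0) (minor_bound_le (leq0n _)). Qed.

Definition fine_const : K := region_const%:R * prob_const n' minor_const * (D2 n').+1%:R ^+ n.
Definition coarse_const : K :=
  region_const%:R * prob_const n' minor_const * 2 ^+ n * (D1 n').+1%:R ^+ n * (D2 n').+1%:R ^+ n.

Lemma prob_const_gt0 : 0 < prob_const n' minor_const.
Proof. by rewrite /prob_const mulr_gt0 ?minor_const_gt0 // ltr0n !muln_gt0 !expn_gt0. Qed.

Lemma region_const_gt0 : 0 < region_const%:R :> K.
Proof. by rewrite ltr0n !muln_gt0 !expn_gt0 !muln_gt0 addn1. Qed.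

Lemma fine_const_gt0 : 0 < fine_const.
Proof. exact: mulr_gt0 (mulr_gt0 region_const_gt0 prob_const_gt0) (exprn_gt0 _ (ltr0Sn K _)). Qed.

Lemma coarse_const_gt0 : 0 < coarse_const.
Proof.
apply: mulr_gt0; last exact/exprn_gt0/ltr0Sn.
apply: mulr_gt0; last exact/exprn_gt0/ltr0Sn.
by apply: mulr_gt0; [apply: mulr_gt0; [exact: region_const_gt0|exact: prob_const_gt0]|exact: exprn_gt0].
Qed.

Section Scale.
Variables (j k l : nat) (R S : 'I_n -> K) (f : 'rV[K]_n -> 'rV[K]_n) (jn : (j < n)%N) (x : K).
Hypotheses (jk : (j < k)%N) (kl : (k <= l)%N) (ln : (l <= n)%N) (x0 : 0 < x).
Hypotheses (dR : rectangle_dims R) (dS : rectangle_dims S).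
Hypothesis ef : expanding_embedding k (rectangle S) (rectangle R) f.
Local Notation sigma := (S (Ordinal jn)).
Local Notation h := (l - k)%N.

(* The walls are [2 * x] apart. *)
Lemma scale_alternative :
  ~ (fine_const * \prod_(i < n | (i < j)%N) R i * x ^+ (k - j) <
       \prod_(i < n | (i < j)%N) S i * sigma ^+ (k - j) /\
     coarse_const * \prod_(i < n | (i < l)%N) R i * sigma ^+ h <
       \prod_(i < n | (i < l)%N) S i * x ^+ h).
Proof.
move=> [fine coarse].
have [R0 Rmono] := dR; have [S0 Smono] := dS; have [sf fR xf] := ef.
have sigma0 : 0 < sigma by [].
have Slow (a : 'I_n) : (a < j)%N -> S a <= sigma by move=> aj; apply: Smono; apply: ltnW.
have Shigh (a : 'I_n) : (j <= a)%N -> sigma <= S a by move=> ja; apply: Smono.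
have khl : (k + h = l)%N by apply: subnKC.
have kn : (k <= n)%N by apply: leq_trans ln.
have jl : (j <= l)%N by apply: leq_trans (ltnW jk) kl.
have k0 : (0 < k)%N by apply: leq_ltn_trans jk.
have hq : (l - j - h = k - j)%N by move: jk kl; clear; lia.
have hjl : (h <= l - j)%N by apply: leq_sub2l (ltnW jk).
have n2 : (n.+1 < 2 * (n + 2))%N by clear; lia.
pose Nc := pieces S sigma; pose sg := piece_length S sigma; pose off a := S a / 4.
pose D := [set y : 'rV[K]_n | forall a, S a / 4 <= y ord0 a <= 3 * S a / 4].
have DS : D `<=` rectangle S.
  by move=> y hy a; have := hy a; have := S0 a => Sa /andP[h1 h2]; apply/andP; split; lra.
have cD : compact D by apply: compact_box.
have oS := @open_rectangle K n S.
have sg0 a : 0 < sg a by apply: piece_length_gt0.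
have sgN a : sg a * (Nc a)%:R = S a / 2 by apply: piece_length_pieces.
pose e := S ord0 / 3.
have e0 : 0 < e by rewrite divr_gt0.
have esg a : e <= sg a.
  apply: le_trans (piece_length_ge S0 sigma0 a).
  by rewrite ler_pM2r // le_min !Smono.
have [d0 d00 hd0] := local_linearization k0 oS cD DS sf xf e0.
(* Large [w] makes the cell side [delta = x / w] small: below the linearization scale [d0] and below
   every side of the target. The final bounds see only [delta * w = x]. *)
pose w := (2 * (n + 2) + (Num.truncn (x / d0)).+1 + \sum_i (Num.truncn (x / R i)).+1)%N.
have wn : (2 * (n + 2) <= w)%N by rewrite /w -addnA leq_addr.
have w0 : (0 < w)%N by apply: leq_trans wn.
have w0' : 0 < w%:R :> K by rewrite ltr0n.
pose delta := x / w%:R.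
have dl0 : 0 < delta by rewrite divr_gt0.
have dw : delta * w%:R = x by rewrite divfK // gt_eqF.
have div_le y (m : nat) : 0 < y -> (Num.truncn (x / y) < m)%N -> x / m%:R <= y.
  move=> y0 lt; have m0 : 0 < m%:R :> K by rewrite ltr0n; apply: leq_ltn_trans lt.
  rewrite ler_pdivrMr // mulrC -ler_pdivrMr //.
  have /truncn_itv/andP[_ h2] : 0 <= x / y by rewrite divr_ge0 // ltW.
  by apply: le_trans (ltW h2) _; rewrite ler_nat.
have dd0 : delta <= d0 by apply: div_le => //; rewrite /w addnAC; apply: leq_addl.
have ddR i : delta <= R i.
  by apply: div_le => //; apply: leq_trans (leq_addl _ _); rewrite (bigD1 i) //= leq_addr.
have posD xi : box Nc xi -> D (pos off sg xi).
  move=> bx a; rewrite mxE /off; have /andP[b1 b2] := bx a.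
  have s1 : sg a * xi a <= S a / 2 by rewrite -sgN ler_pM2l.
  have s2 : 0 <= sg a * xi a by rewrite mulr_ge0 // ltW.
  by apply/andP; split; lra.
have fpos xi i : box Nc xi -> 0 < f (pos off sg xi) ord0 i < R i.
  by move=> bx; apply: fR; exists (pos off sg xi) => //; apply/DS/posD.
have [d1 d10 hd1] := forward_uniform k0 oS cD DS sf (divr_gt0 dl0 (ltr0n K 4)).
(* Moving every [xi a] by an [r]-th of its range moves the point by at most [d1], hence the image by
   at most a quarter of a cell. *)
pose r := (Num.truncn ((\sum_a S a) / d1)).+1.
pose step := (2 * r + 4)%N.
pose Kmax i := Num.truncn (R i / delta).
pose M := Num.truncn ((\sum_i R i) / delta * step%:R).
pose Phi := cell_coord off sg f delta.
have st0 : (0 < step)%N by rewrite /step addnS.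
have step0 : 0 < step%:R :> K by rewrite ltr0n.
have sumR i : R i <= \sum_i R i by rewrite (bigD1 i) //= lerDl sumr_ge0 // => a _; rewrite ltW.
have sumS i : S i <= \sum_i S i by rewrite (bigD1 i) //= lerDl sumr_ge0 // => a _; rewrite ltW.
have Phi_gt0 xi i : box Nc xi -> 0 < Phi xi i.
  by move=> bx; have /andP[f1 _] := fpos xi i bx; rewrite divr_gt0.
have Phi_ltR xi i : box Nc xi -> Phi xi i < R i / delta.
  by move=> bx; have /andP[_ f2] := fpos xi i bx; rewrite ltr_pM2r ?invr_gt0.
have Phi_lt xi i : box Nc xi -> Phi xi i * step%:R < M.+1%:R.
  move=> bx; apply: (@lt_le_trans _ _ (R i / delta * step%:R)); first by rewrite ltr_pM2r // Phi_ltR.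
  have /truncn_itv/andP[_ /ltW] : 0 <= (\sum_i R i) / delta * step%:R.
    by rewrite !mulr_ge0 ?invr_ge0 ?(ltW dl0) ?(ltW step0) ?sumr_ge0 // => a _; apply: ltW.
  by apply: le_trans; rewrite ler_pM2r // ler_pM2r ?invr_gt0.
have Phi_max xi i : box Nc xi -> Phi xi i < (Kmax i).+1%:R.
  move=> bx; apply: lt_trans (Phi_ltR _ _ bx) _.
  by have /truncn_itv/andP[] : 0 <= R i / delta by rewrite divr_ge0 // ltW.
have r0 : 0 < r%:R :> K by rewrite ltr0n.
have Phi_cont xi xi' : box Nc xi -> box Nc xi' ->
    (forall a, `|xi a - xi' a| <= (Nc a)%:R / r%:R) -> forall i, `|Phi xi i - Phi xi' i| <= 4^-1.
  move=> bx bx' dxi i.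
  have close : `|pos off sg xi - pos off sg xi'| <= d1.
    apply/normrV_le => [|a]; first exact: ltW.
    rewrite !mxE opprD addrACA subrr add0r -mulrBr normrM (gtr0_norm (sg0 a)).
    apply: (@le_trans _ _ (sg a * ((Nc a)%:R / r%:R))); first by rewrite ler_pM2l.
    rewrite mulrA sgN ler_pdivrMr //.
    have /truncn_itv/andP[_ /ltW h1] : 0 <= (\sum_a S a) / d1.
      by rewrite divr_ge0 ?(ltW d10) // sumr_ge0 // => b _; apply: ltW.
    rewrite -/r ler_pdivrMr // in h1.
    have := sumS a; have := S0 a; rewrite mulrC; lra.
  have := hd1 _ _ (posD _ bx') (posD _ bx) close.
  rewrite /Phi /cell_coord -mulrBl normrM (ger0_norm (x := delta^-1)) ?invr_ge0 ?(ltW dl0) //.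
  rewrite ler_pdivrMr // => h1; apply: le_trans (le_trans h1 _); last by rewrite mulrC.
  by have := coord_le_norm (f (pos off sg xi) - f (pos off sg xi')) i; rewrite !mxE.
pose Mc := (\prod_a Nc a)%N.
have Mc0 : (0 < Mc)%N by rewrite prodn_gt0.
have NcMc a : (pieces S sigma a %| Mc)%N by rewrite /Mc (bigD1 a) //= dvdn_mulr.
have mbn : minor_bound K n k <= minor_const by apply: minor_bound_le.
have local y : D y -> linearizable k D f minor_const delta e y.
  have dd : 0 < delta <= d0 by rewrite dl0.
  move=> Dy; have [L [w' [w'0 hm hl]]] := hd0 _ dd y Dy.
  by exists L, w'; split=> // phi g; apply: le_trans (hm phi g) mbn.
have [N0 hN] := hit_bounds M jk khl ln S0 Smono sigma0 Slow Shigh (ltW minor_const_gt0) dl0 NcMc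
  esg posD local.
have {hN} := hN N0.+1 (leqnSn _) (ltn0Sn _) => hN.
pose A := \prod_(i < n | (i < j)%N) R i; pose B := \prod_(i < n | (i < j)%N) S i.
pose RL := \prod_(i < n | (i < l)%N) R i; pose SL := \prod_(i < n | (i < l)%N) S i.
have A0 : 0 < A by apply: prodr_gt0. have B0 : 0 < B by apply: prodr_gt0.
have RL0 : 0 < RL by apply: prodr_gt0. have SL0 : 0 < SL by apply: prodr_gt0.
have hu : (h <= #|[set i : 'I_n | isu j l i]%SET|)%N by rewrite card_ord_interval.
pose QA : K := region_const%:R * (RL / delta ^+ l) / w%:R ^+ h.
pose QB : K := region_const%:R * (A / delta ^+ j) * w%:R ^+ (k - j).
pose PA := prob_const n' minor_const * (delta ^+ k * sigma ^+ h / SL).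
pose PB := prob_const n' minor_const * (delta ^+ k / (B * sigma ^+ (k - j))).
have dX m : 0 < delta ^+ m by rewrite exprn_gt0.
have wX m : 0 < w%:R ^+ m :> K by rewrite exprn_gt0.
have sX m : 0 < sigma ^+ m by rewrite exprn_gt0.
have pc0 := prob_const_gt0; have rc0 := region_const_gt0.
have jn' : (j <= n)%N by apply: ltnW.
have rcE : region_const%:R = 2 ^+ n * (2 * (11 * (2 * (n + 2) + 1)))%N%:R ^+ n :> K.
  by rewrite /region_const natrM !natrX.
have regionA_le (y : {ffun 'I_n -> 'I_M.+2}) : #|regionA j l h step w Kmax y|%:R <= QA.
  rewrite ler_pdivlMr // -natrX -natrM.
  have := card_regionA Kmax jl ln st0 wn hu y; rewrite -(ler_nat K) => /le_trans; apply.
  rewrite natrM natrX rcE -mulrA ler_pM2l ?exprn_gt0 //.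
  apply: le_trans (natr_prod_cells _ ln dl0 ddR) _; rewrite ler_pM2r ?divr_gt0 //.
  by rewrite lerXn2r ?nnegrE ?ler0n // ler_nat !leq_mul2l leq_mul2r orbT.
have region_le (y : {ffun 'I_n -> 'I_M.+2}) : (forall a, 0 < cutoff j l h step w a (fun i => y i))%N ->
    #|region j l h step w Kmax y|%:R <= QB.
  move=> cy; have := card_region Kmax jl ln st0 wn hu cy.
  rewrite -(ler_nat K) hq natrM natrX natrM natrX.
  move=> /le_trans; apply; rewrite /QB mulrC [leRHS]mulrC -mulrA ler_pM2l // rcE.
  rewrite [leLHS]mulrC -mulrA ler_pM2l ?exprn_gt0 //.
  exact: natr_prod_cells.
apply: (assignment_contradiction (r := r) (step := step) (w := w) (M := M) (N := N0.+1) (Mc := Mc) (Nc := Nc)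
  (Kmax := Kmax) (Phi := Phi) jl ln khl _ _ _ _ _ (ltn0Sn _) Mc0 _ Phi_gt0 Phi_lt Phi_max Phi_cont
  (PA := PA) (PB := PB) (QA := QA) (QB := QB) _ _ _ _ _ _ regionA_le region_le) => //.
- by rewrite /step addnS ltnS leq_addr.
- exact: leq_addl.
- exact: leq_trans wn.
- by rewrite mulr_gt0 // divr_gt0 // mulr_gt0.
- by rewrite mulr_gt0 // divr_gt0 // mulr_gt0.
- by rewrite divr_gt0 // mulr_gt0 // divr_gt0.
- by rewrite mulr_gt0 // mulr_gt0 // divr_gt0.
- by move=> kappa; have [_] := hN kappa.
- by move=> kappa c; have [+ _] := hN kappa; apply.
(* Number of cells times probability of a hit: the powers of [delta] and [w] combine into powers of
   [x]. *)
- rewrite /B1 [ltLHS](_ : _ = coarse_const * RL * sigma ^+ h / (SL * x ^+ h)).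
    by rewrite ltr_pdivrMr ?mul1r // mulr_gt0 // exprn_gt0.
  have dlE : delta ^+ l = delta ^+ k * delta ^+ h by rewrite -exprD khl.
  rewrite -dw exprMn /QA /PA /coarse_const dlE.
  by field; rewrite !gt_eqF.
- rewrite [ltLHS](_ : _ = fine_const * A * x ^+ (k - j) / (B * sigma ^+ (k - j))).
    by rewrite ltr_pdivrMr ?mul1r // mulr_gt0.
  have dkE : delta ^+ k = delta ^+ j * delta ^+ (k - j) by rewrite -exprD subnKC // ltnW.
  rewrite -dw exprMn /QB /PB /fine_const dkE.
  by field; rewrite !gt_eqF.
Qed.

End Scale.
End Core.

(** * Elimination of the scale *)

(** Since [h <= n] and [q] is positive, the extra exponent [t = h / q] is at most [n]. Replacing
    [2 * C1] by [2 * C1 + 1], which exceeds 1, therefore bounds its power by one whose exponent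
    depends on [n] only. *)
Lemma powR_alternative (K : realType) (C1 C2 A B RV SV s : K) (q h n : nat) :
  0 < C1 -> 0 < C2 -> 0 < A -> 0 < B -> 0 < RV -> 0 < SV -> 0 < s -> (0 < q)%N -> (h <= n)%N ->
  (forall x, 0 < x -> ~ (C1 * A * x ^+ q < B * s ^+ q /\ C2 * (A * RV) * s ^+ h < B * SV * x ^+ h)) ->
  (C2 * (2 * C1 + 1) ^+ n)^-1 * B `^ ((q + h)%:R / q%:R) * SV <= A `^ ((q + h)%:R / q%:R) * RV.
Proof.
move=> C10 C20 A0 B0 RV0 SV0 s0 q0 hn alt.
have q0' : 0 < q%:R :> K by rewrite ltr0n.
pose t : K := h%:R / q%:R.
have powE (X : K) : 0 < X -> X `^ ((q + h)%:R / q%:R) = X * X `^ t.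
  move=> X0; rewrite natrD mulrDl divff ?gt_eqF // powRD ?powRr1 ?(ltW X0) //.
  by rewrite (gt_eqF X0) implybT.
pose D := B / (2 * C1 * A).
have D0 : 0 < D by rewrite divr_gt0 // !mulr_gt0.
pose x := D `^ (q%:R)^-1 * s.
have x0 : 0 < x by rewrite mulr_gt0 // powR_gt0.
have xq : x ^+ q = D * s ^+ q.
  rewrite exprMn -(powR_mulrn q (powR_ge0 D (q%:R)^-1)) -powRrM mulVf ?gt_eqF // powRr1 //.
  exact: ltW.
have xh : x ^+ h = D `^ t * s ^+ h.
  have -> : D `^ t = (D `^ (q%:R)^-1) ^+ h by rewrite /t mulrC powRrM powR_mulrn // powR_ge0.
  by rewrite exprMn.
have {}alt : B * SV * x ^+ h <= C2 * (A * RV) * s ^+ h.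
  rewrite leNgt; apply/negP => lt; apply: (alt x x0); split=> //.
  rewrite xq /D (_ : _ * _ = B * s ^+ q / 2); last by field; rewrite !gt_eqF.
  have : 0 < B * s ^+ q by rewrite mulr_gt0 // exprn_gt0.
  lra.
move: alt; rewrite xh mulrA ler_pM2r ?exprn_gt0 // => alt.
have DE : D `^ t * A `^ t * (2 * C1) `^ t = B `^ t.
  have -> : B = D * A * (2 * C1) by rewrite /D; field; rewrite !gt_eqF.
  have p1 : 0 <= D * A by rewrite ltW // mulr_gt0.
  have p2 : 0 <= 2 * C1 by rewrite ltW // mulr_gt0.
  by rewrite (powRM t p1 p2) (powRM t (ltW D0) (ltW A0)).
have t0 : 0 <= t by rewrite divr_ge0.
have C1t : (2 * C1) `^ t <= (2 * C1 + 1) ^+ n.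
  apply: (@le_trans _ _ ((2 * C1 + 1) `^ t)).
    by apply: ge0_ler_powR => //; rewrite ?nnegrE; lra.
  rewrite -powR_mulrn; last by lra.
  apply: ler_powR; first by lra.
  rewrite /t ler_pdivrMr // -natrM ler_nat; apply: leq_trans hn _.
  by rewrite leq_pmulr.
have Cn0 : 0 < (2 * C1 + 1) ^+ n by rewrite exprn_gt0 //; lra.
rewrite !powE // -DE -mulrA ler_pdivrMl ?mulr_gt0 //.
have At0 : 0 <= A `^ t by apply: powR_ge0.
have Ct0 : 0 <= (2 * C1) `^ t by apply: powR_ge0.
apply: (@le_trans _ _ (B * SV * D `^ t * (A `^ t * (2 * C1) `^ t))).
  by rewrite le_eqVlt; apply/orP; left; apply/eqP; ring.
apply: (@le_trans _ _ (C2 * (A * RV) * (A `^ t * (2 * C1 + 1) ^+ n))).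
  apply: ler_pM => //; rewrite ?mulr_ge0 ?(ltW B0) ?(ltW SV0) ?powR_ge0 //.
  by rewrite ler_wpM2l.
by rewrite le_eqVlt; apply/orP; left; apply/eqP; ring.
Qed.

Theorem theorem1 (K : realType) (n : nat) (hn : (1 <= n)%N) :
  exists c : K, 0 < c /\
    forall (k : nat), (1 <= k <= n)%N ->
    forall (R S : 'I_n -> K), rectangle_dims R -> rectangle_dims S ->
    (exists I : 'rV[K]_n -> 'rV[K]_n,
        expanding_embedding k (rectangle S) (rectangle R) I) ->
    forall (j l : nat), (j < k)%N -> (k <= l)%N -> (l <= n)%N ->
      (\prod_(i < n | (i < j)%N) R i) `^ ((l - j)%N%:R / (k - j)%N%:R)
        * \prod_(i < n | (j <= i < l)%N) R i
      >= c * (\prod_(i < n | (i < j)%N) S i) `^ ((l - j)%N%:R / (k - j)%N%:R)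
           * \prod_(i < n | (j <= i < l)%N) S i.
Proof.
case: n hn => // n _.
exists (coarse_const K n * (2 * fine_const K n + 1) ^+ n.+1)^-1.
have f0 := fine_const_gt0 K n; have c0 := coarse_const_gt0 K n.
split; first by rewrite invr_gt0 mulr_gt0 // exprn_gt0 // ltr_wpDl // mulr_ge0 // ltW.
move=> k _ R S dR dS [I eI] j l jk kl ln.
have jn : (j < n.+1)%N by apply: leq_trans jk (leq_trans kl ln).
have [R0 _] := dR; have [S0 _] := dS.
have split_prod (T : 'I_n.+1 -> K) : \prod_(i < n.+1 | (i < l)%N) T i =
    \prod_(i < n.+1 | (i < j)%N) T i * \prod_(i < n.+1 | (j <= i < l)%N) T i.
  have jl : (j <= l)%N by apply: leq_trans (ltnW jk) kl.
  rewrite (bigID (fun i : 'I_n.+1 => (i < j)%N)) /=; congr (_ * _); apply: eq_bigl => i.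
    by rewrite andb_idl // => /leq_trans; apply.
  by rewrite -leqNgt andbC.
have -> : (l - j = (k - j) + (l - k))%N by rewrite addnBAC ?subnKC // ltnW.
apply: (powR_alternative (s := S (Ordinal jn))) => //; try exact: prodr_gt0.
- by rewrite subn_gt0.
- by apply: leq_trans (leq_subr _ _) ln.
move=> x x0; rewrite -!split_prod.
exact: (scale_alternative jk kl ln x0 dR dS eI).
Qed.
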